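(* Let $k$ be a field, $n\ge 2$, and let $f=\sum_{1\le i,j\le n}f_{ij}x_ix_j$ be a non-degenerate quadratic relation over $k$ in non-commutative variables $x_1,\dots,x_n$ (i.e. the matrix $(f_{ij})$ is invertible). Let $z$ be an extra generator. Let $A=k\langle x_1,\dots,x_n\rangle/(f)$, and let $B$ be the $k$-algebra defined by the generators $x_1,\dots,x_n,z$ and the potential $w=fz$. Then: 1) $B$ is a skew polynomial ring over $A$ in the generator $z$, defined by an automorphism of $A$. 2) $z$ is normal in $B$, that is $Bz=zB$. 3) If $f$ is alternating, then $z$ is central in $B$. The converse holds if the characteristic of $k$ is $\neq 2$. 4) $B$ is Koszul and 3-Calabi-Yau. Moreover, $B$ is a domain. 5) The Hilbert series of the graded algebra $B$ is $h_B(t)=(1-(n+1)t+(n+1)t^2-t^3)^{-1}$. 6) The Gelfand-Kirillov dimension of $B$ is finite if and only if $n=2$, and in this case it equals $3$. 7) $B$ is left (or right) noetherian if and only if $n=2$.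
   Context: All generators have degree 1. The algebra defined by the potential $w=fz$ is the quotient of $k\langle x_1,\dots,x_n,z\rangle$ by the two-sided ideal generated by the cyclic partial derivatives of $w$, namely $\partial_{x_i}(w)=\sum_{j=1}^n(f_{ij}\,x_jz+f_{ji}\,zx_j)$ for $1\le i\le n$, and $\partial_z(w)=f$. ''Alternating'' means $f_{ii}=0$ and $f_{ij}=-f_{ji}$ for all $i,j$. The skew polynomial ring $A[z;\sigma]$ ($\sigma$ an automorphism of $A$) is the free left $A$-module with basis $(z^p)_{p\ge0}$ and multiplication determined by $za=\sigma(a)z$; in 1), the copy of $A$ in $B$ is the subalgebra generated by $x_1,\dots,x_n$. An algebra $B$ is 3-Calabi-Yau if, as a $B$-bimodule, it has a finite resolution by finitely generated projective bimodules, and $\mathrm{Ext}^i_{B^e}(B,B^e)$ is $0$ for $i\ne3$ and isomorphic to $B$ as a bimodule for $i=3$, where $B^e=B\otimes_kB^{op}$. *)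

(* Defs.v *)
From HB Require Import structures.
From mathcomp Require Import all_boot all_order all_algebra.
From mathcomp Require Import generic_quotient ring_quotient.
From mathcomp Require Import boolp classical_sets reals ereal sequences exp.
From mathcomp Require Import finmap.
(* The notations of monalg are incompatible with those of MathComp-Analysis. *)
From mathcomp Require Import -(notations) monalg.

Set Implicit Arguments.
Unset Strict Implicit.
Unset Printing Implicit Defensive.

Import Order.TTheory GRing.Theory Num.Theory.
Local Open Scope classical_set_scope.
Local Open Scope quotient_scope.
Local Open Scope ring_scope.

Section TwoSidedIdeal.
Variable R : nzRingType.

Definition two_sided_ideal (J : set R) : Prop :=
  [/\ J 0,
      forall a b, J a -> J b -> J (a + b) &
      forall u a v, J a -> J (u * a * v)].

Definition ideal_gen (G : set R) : set R := smallest two_sided_ideal G.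

Lemma ideal_genP G : two_sided_ideal (ideal_gen G).
Proof.
split=> [J [[]//]|a b Ja Jb J JP|u a v Ja J JP].
  by case: (JP) => -[_ + _] _; apply; [exact: Ja|exact: Jb].
by case: (JP) => -[_ _ +] _; apply; exact: Ja.
Qed.

Definition ideal_pred (G : set R) : {pred R} := fun a => `[< ideal_gen G a >].

Lemma ideal_pred_zmod G : zmod_closed (ideal_pred G).
Proof.
have [J0 JD JM] := ideal_genP G.
split=> [|a b /asboolP Ja /asboolP Jb]; apply/asboolP => //.
by apply: JD => //; have := JM (-1) b 1 Jb; rewrite mulr1 mulN1r.
Qed.

HB.instance Definition _ G :=
  GRing.isZmodClosed.Build R (ideal_pred G) (ideal_pred_zmod G).

Lemma ideal_predM G u a v : a \in ideal_pred G -> u * a * v \in ideal_pred G.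
Proof.
have [_ _ JM] := ideal_genP G.
by move=> /asboolP Ja; apply/asboolP; exact: JM.
Qed.

End TwoSidedIdeal.

(* The free associative algebra k<I> is the monoid algebra of words on I.  Its
   operations are those of monalg, locked because failing unifications would
   otherwise compute with them. *)
Definition freealg (k : fieldType) (I : choiceType) : Type := malg (fmonom I) k.

HB.instance Definition _ (k : fieldType) (I : choiceType) :=
  Choice.copy (freealg k I) (malg (fmonom I) k).

HB.lock Definition fa_zero (k : fieldType) (I : choiceType) : freealg k I :=
  0 : malg (fmonom I) k.
HB.lock Definition fa_opp (k : fieldType) (I : choiceType)
    (a : freealg k I) : freealg k I := - (a : malg (fmonom I) k).
HB.lock Definition fa_add (k : fieldType) (I : choiceType)
    (a b : freealg k I) : freealg k I := (a : malg (fmonom I) k) + b.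
HB.lock Definition fa_one (k : fieldType) (I : choiceType) : freealg k I :=
  1 : malg (fmonom I) k.
HB.lock Definition fa_mul (k : fieldType) (I : choiceType)
    (a b : freealg k I) : freealg k I := (a : malg (fmonom I) k) * b.
HB.lock Definition fa_scale (k : fieldType) (I : choiceType)
    (c : k) (a : freealg k I) : freealg k I := c *: (a : malg (fmonom I) k).

Section FreeAlgebra.
Variables (k : fieldType) (I : choiceType).
Local Notation F := (freealg k I).
Local Notation M := (malg (fmonom I) k).

Fact fa_addA : associative (@fa_add k I).
Proof. by move=> a b c; rewrite fa_add.unlock; exact: (@addrA M). Qed.
Fact fa_addC : commutative (@fa_add k I).
Proof. by move=> a b; rewrite fa_add.unlock; exact: (@addrC M). Qed.
Fact fa_add0 : left_id (@fa_zero k I) (@fa_add k I).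
Proof.
by move=> a; rewrite fa_add.unlock fa_zero.unlock; exact: (@add0r M).
Qed.
Fact fa_addN : left_inverse (@fa_zero k I) (@fa_opp k I) (@fa_add k I).
Proof.
move=> a; rewrite fa_add.unlock fa_zero.unlock fa_opp.unlock.
exact: (@addNr M).
Qed.

HB.instance Definition _ :=
  GRing.isZmodule.Build F fa_addA fa_addC fa_add0 fa_addN.

Fact fa_mulA : associative (@fa_mul k I).
Proof. by move=> a b c; rewrite fa_mul.unlock; exact: (@mulrA M). Qed.
Fact fa_1mul : left_id (@fa_one k I) (@fa_mul k I).
Proof. by move=> a; rewrite fa_mul.unlock fa_one.unlock; exact: (@mul1r M). Qed.
Fact fa_mul1 : right_id (@fa_one k I) (@fa_mul k I).
Proof. by move=> a; rewrite fa_mul.unlock fa_one.unlock; exact: (@mulr1 M). Qed.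
Fact fa_mulDl : left_distributive (@fa_mul k I) +%R.
Proof.
rewrite [+%R](_ : _ = @fa_add k I) // fa_mul.unlock fa_add.unlock.
exact: (@mulrDl M).
Qed.
Fact fa_mulDr : right_distributive (@fa_mul k I) +%R.
Proof.
rewrite [+%R](_ : _ = @fa_add k I) // fa_mul.unlock fa_add.unlock.
exact: (@mulrDr M).
Qed.
Fact fa_one_neq0 : @fa_one k I != 0.
Proof.
rewrite [0](_ : _ = fa_zero k I) // fa_one.unlock fa_zero.unlock.
exact: (@oner_neq0 M).
Qed.

HB.instance Definition _ := GRing.Zmodule_isNzRing.Build F
  fa_mulA fa_1mul fa_mul1 fa_mulDl fa_mulDr fa_one_neq0.

Fact fa_scaleA a b v :
  @fa_scale k I a (@fa_scale k I b v) = @fa_scale k I (a * b) v.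
Proof. by rewrite fa_scale.unlock; exact: (@scalerA k M). Qed.
Fact fa_scale1 : left_id 1 (@fa_scale k I).
Proof. by move=> a; rewrite fa_scale.unlock; exact: (@scale1r k M). Qed.
Fact fa_scaleDr : right_distributive (@fa_scale k I) +%R.
Proof.
rewrite [+%R](_ : _ = @fa_add k I) // fa_scale.unlock fa_add.unlock.
exact: (@scalerDr k M).
Qed.
Fact fa_scaleDl v : {morph (@fa_scale k I)^~ v : a b / a + b}.
Proof.
move=> a b; rewrite [RHS](_ : _ = fa_add (fa_scale a v) (fa_scale b v)) //.
rewrite fa_scale.unlock fa_add.unlock; exact: (@scalerDl k M).
Qed.

HB.instance Definition _ := GRing.Zmodule_isLmodule.Build k F
  fa_scaleA fa_scale1 fa_scaleDr fa_scaleDl.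

Fact fa_scaleAl (c : k) (a b : F) : c *: (a * b) = (c *: a) * b.
Proof.
rewrite [LHS](_ : _ = fa_scale c (fa_mul a b)) //.
rewrite [RHS](_ : _ = fa_mul (fa_scale c a) b) //.
rewrite fa_scale.unlock fa_mul.unlock; exact: (@scalerAl k M).
Qed.

Lemma fcoeffZ w c (a : F) : mcoeff w (c *: a) = c * mcoeff w a.
Proof.
rewrite [c *: a](_ : _ = fa_scale c a) // fa_scale.unlock; exact: mcoeffZ.
Qed.

Lemma fcoeffD w (a b : F) : mcoeff w (a + b) = mcoeff w a + mcoeff w b.
Proof.
rewrite [a + b](_ : _ = fa_add a b) // fa_add.unlock; exact: mcoeffD.
Qed.

Lemma fcoeff0 w : mcoeff w (0 : F) = 0.
Proof. rewrite [0](_ : _ = fa_zero k I) // fa_zero.unlock; exact: mcoeff0. Qed.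

Lemma fmulE (a b : F) : a * b = (a : M) * (b : M).
Proof. by rewrite [LHS](_ : _ = fa_mul a b) // fa_mul.unlock. Qed.

Fact fa_scaleAr (c : k) (a b : F) : c *: (a * b) = a * (c *: b).
Proof.
apply/malgP => w; rewrite fcoeffZ !fmulE.
have sZ : (msupp (c *: b) `<=` msupp b)%fset.
  rewrite [c *: b](_ : _ = fa_scale c b) // fa_scale.unlock; exact: msuppZ_le.
rewrite [X in _ * X]mcoeffMl [RHS](mcoeffMlw _ (fsubset_refl _) sZ).
rewrite mulr_sumr; apply: eq_bigr => u _; rewrite mulr_sumr.
by apply: eq_bigr => v _; rewrite fcoeffZ mulrnAr mulrCA.
Qed.

HB.instance Definition _ := GRing.Lmodule_isLalgebra.Build k F fa_scaleAl.
HB.instance Definition _ := GRing.Lalgebra_isAlgebra.Build k F fa_scaleAr.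

End FreeAlgebra.

HB.lock Definition fword (k : fieldType) (I : choiceType) (w : seq I) :
  freealg k I := mkmalgU (FMonom w) 1.

Definition fgen {k : fieldType} {I : choiceType} (i : I) : freealg k I :=
  fword k [:: i].

Section ConstantTerm.
Variables (k : fieldType) (I : choiceType).
Implicit Types a b : freealg k I.

Lemma fwordM (u v : seq I) : fword k u * fword k v = fword k (u ++ v).
Proof.
apply/malgP => w; rewrite fmulE fword.unlock.
rewrite (mcoeffMlw _ msuppU_le msuppU_le) !big_seq_fset1.
by rewrite !mcoeffUU mulr1 mcoeffU [monalg.mul _ _]fmmulE.
Qed.

Definition const_coef a : k := mcoeff (@monalg.one _) a.

Lemma const_coefD a b : const_coef (a + b) = const_coef a + const_coef b.
Proof. exact: fcoeffD. Qed.

Lemma const_coefZ c a : const_coef (c *: a) = c * const_coef a.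
Proof. exact: fcoeffZ. Qed.

Lemma const_coefM a b : const_coef (a * b) = const_coef a * const_coef b.
Proof.
by rewrite fmulE; exact: (rmorphM (mcoeff (@monalg.one (fmonom I)))).
Qed.

Lemma const_coef1 : const_coef 1 = 1.
Proof.
rewrite [1](_ : _ = fa_one k I) // fa_one.unlock.
exact: (rmorph1 (mcoeff (@monalg.one (fmonom I)))).
Qed.

Lemma const_coef0 : const_coef 0 = 0. Proof. exact: fcoeff0. Qed.

Lemma const_coef_sum (J : finType) (E : J -> freealg k I) :
  (forall j, const_coef (E j) = 0) -> const_coef (\sum_j E j) = 0.
Proof.
move=> E0; elim/big_ind: _ => [|a b a0 b0|j _]; first exact: const_coef0.
  by rewrite const_coefD a0 b0 addr0.
exact: E0.
Qed.

Lemma const_coef_gen2 c (i j : I) : const_coef (c *: (fgen i * fgen j)) = 0.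
Proof.
rewrite const_coefZ fwordM /const_coef fword.unlock mcoeffU.
by rewrite -(inj_eq val_inj) /= fm1 mulr0.
Qed.

End ConstantTerm.

Section PresentedAlgebra.
Variables (k : fieldType) (I : choiceType) (G : set (freealg k I)).
Local Notation F := (freealg k I).

(* k<I>/(G).  It may be the zero ring, hence only a pzRing in general. *)
Definition qalg : Type := Quotient.quot (ideal_pred G).

HB.instance Definition _ := GRing.Zmodule.on qalg.

Definition qpi (a : F) : qalg := \pi_(Quotient.quot (ideal_pred G)) a.

Definition qrepr (x : qalg) : F := repr (x : Quotient.quot (ideal_pred G)).

Lemma qreprK : cancel qrepr qpi. Proof. exact: reprK. Qed.

Lemma qpiE a b : (qpi a = qpi b) <-> (a - b \in ideal_pred G).
Proof.
rewrite Quotient.idealrBE; split=> [ab|/eqP//]; exact/eqP.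
Qed.

Lemma qpi_zmod : zmod_morphism qpi.
Proof. by move=> a b; rewrite /qpi raddfB. Qed.

HB.instance Definition _ := GRing.isZmodMorphism.Build F qalg qpi qpi_zmod.

Definition qone : qalg := qpi 1.
Definition qmul (x y : qalg) : qalg := locked (qpi (qrepr x * qrepr y)).
Definition qscale (c : k) (x : qalg) : qalg := locked (qpi (c *: qrepr x)).

Lemma qpi_mul a b : qmul (qpi a) (qpi b) = qpi (a * b).
Proof.
rewrite /qmul -lock; apply/qpiE; set a' := qrepr _; set b' := qrepr _.
have Ja : a' - a \in ideal_pred G by apply/qpiE; rewrite qreprK.
have Jb : b' - b \in ideal_pred G by apply/qpiE; rewrite qreprK.
have -> : a' * b' - a * b = 1 * (a' - a) * b' + a * (b' - b) * 1.
  by rewrite mul1r mulr1 mulrBl mulrBr addrA subrK.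
by rewrite rpredD// ideal_predM.
Qed.

Lemma qpi_scale c a : qscale c (qpi a) = qpi (c *: a).
Proof.
rewrite /qscale -lock; apply/qpiE; rewrite -scalerBr.
have Ja : qrepr (qpi a) - a \in ideal_pred G by apply/qpiE; rewrite qreprK.
by have := ideal_predM (c%:A) 1 Ja; rewrite mulr1 -scalerAl mul1r.
Qed.

Fact qmulA : associative qmul.
Proof.
by move=> x y z; rewrite -[x]qreprK -[y]qreprK -[z]qreprK !qpi_mul mulrA.
Qed.
Fact qmul1 : left_id qone qmul.
Proof. by move=> x; rewrite -[x]qreprK qpi_mul mul1r. Qed.
Fact q1mul : right_id qone qmul.
Proof. by move=> x; rewrite -[x]qreprK qpi_mul mulr1. Qed.
Fact qmulDl : left_distributive qmul +%R.
Proof.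
move=> x y z; rewrite -[x]qreprK -[y]qreprK -[z]qreprK.
by rewrite -raddfD !qpi_mul -raddfD -mulrDl.
Qed.
Fact qmulDr : right_distributive qmul +%R.
Proof.
move=> x y z; rewrite -[x]qreprK -[y]qreprK -[z]qreprK.
by rewrite -raddfD !qpi_mul -raddfD -mulrDr.
Qed.

HB.instance Definition _ :=
  GRing.Zmodule_isPzRing.Build qalg qmulA qmul1 q1mul qmulDl qmulDr.

Fact qscaleA a b x : qscale a (qscale b x) = qscale (a * b) x.
Proof. by rewrite -[x]qreprK !qpi_scale scalerA. Qed.
Fact qscale1 : left_id 1 qscale.
Proof. by move=> x; rewrite -[x]qreprK qpi_scale scale1r. Qed.
Fact qscaleDr : right_distributive qscale +%R.
Proof.
move=> c x y; rewrite -[x]qreprK -[y]qreprK.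
by rewrite -raddfD !qpi_scale -raddfD -scalerDr.
Qed.
Fact qscaleDl x : {morph qscale^~ x : a b / a + b}.
Proof. by move=> a b; rewrite -[x]qreprK !qpi_scale -raddfD -scalerDl. Qed.

HB.instance Definition _ :=
  GRing.Zmodule_isLmodule.Build k qalg qscaleA qscale1 qscaleDr qscaleDl.

Lemma qpi1 : qpi 1 = 1. Proof. by []. Qed.

Lemma qpiM a b : qpi (a * b) = qpi a * qpi b.
Proof. by rewrite -qpi_mul. Qed.

Lemma qpiZ c a : qpi (c *: a) = c *: qpi a.
Proof. by rewrite -qpi_scale. Qed.

Fact qalg_scaleAl (c : k) (x y : qalg) : c *: (x * y) = (c *: x) * y.
Proof.
by rewrite -[x]qreprK -[y]qreprK -qpiM -!qpiZ -qpiM scalerAl.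
Qed.

Fact qalg_scaleAr (c : k) (x y : qalg) : c *: (x * y) = x * (c *: y).
Proof.
by rewrite -[x]qreprK -[y]qreprK -qpiM -!qpiZ -qpiM scalerAr.
Qed.

(* The ring is nonzero as soon as the relations have no constant term. *)
Lemma qalg_nonzero : (forall r, G r -> const_coef r = 0) -> 1 != 0 :> qalg.
Proof.
move=> G0; apply/eqP; change (qpi 1 = 0 -> False).
rewrite -(raddf0 qpi) => /qpiE; rewrite subr0 => /asboolP J1.
have J : two_sided_ideal [set a : F | const_coef a = 0].
  split=> [|a b /= a0 b0|u a v /= a0]; first exact: const_coef0.
    by rewrite const_coefD a0 b0 addr0.
  by rewrite !const_coefM a0 mulr0 mul0r.
have /= := J1 _ (conj J G0).
by rewrite const_coef1 => /eqP; rewrite oner_eq0.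
Qed.

Definition homogeneous (d : nat) : set F :=
  [set a | forall w : fmonom I, w \in msupp a -> size w = d].

Definition qdeg (d : nat) : set qalg := qpi @` homogeneous d.

End PresentedAlgebra.

Section Potential.
Variables (k : fieldType) (I : choiceType).
Local Notation F := (freealg k I).

(* The cyclic derivative with respect to x_i sends a word to the sum of the v u
   over all its factorizations u x_i v, and is extended linearly. *)
Definition cder_word (i : I) (w : seq I) : F :=
  \sum_(p < size w | nth i w p == i) fword k (drop p.+1 w ++ take p w).

Definition cder (i : I) (a : F) : F :=
  \sum_(w <- msupp a) mcoeff w a *: cder_word i w.

Lemma cderE (d : {fset fmonom I}) i (a : F) : (msupp a `<=` d)%fset ->
  cder i a = \sum_(w <- d) mcoeff w a *: cder_word i w.
Proof.
move=> le; rewrite [LHS](big_fset_incl _ le) // => w _ /mcoeff_outdom ->.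
by rewrite scale0r.
Qed.

Lemma cder_is_linear i : linear (cder i).
Proof.
move=> c a b.
have lea : (msupp a `<=` msupp a `|` msupp b)%fset by exact: fsubsetUl.
have leb : (msupp b `<=` msupp a `|` msupp b)%fset by exact: fsubsetUr.
have leD : (msupp (c *: a + b)%R `<=` msupp a `|` msupp b)%fset.
  apply/fsubsetP => w; rewrite inE; apply: contraLR.
  rewrite negb_or => /andP[/mcoeff_outdom wa /mcoeff_outdom wb].
  by rewrite -mcoeff_eq0 fcoeffD fcoeffZ wa wb mulr0 addr0.
rewrite (cderE _ lea) (cderE _ leb) (cderE _ leD) scaler_sumr -big_split.
by apply: eq_bigr => w _; rewrite fcoeffD fcoeffZ scalerDl scalerA.
Qed.

HB.instance Definition _ i :=
  GRing.isLinear.Build k F F *:%R (cder i) (cder_is_linear i).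

Lemma cder_fword i (w : seq I) : cder i (fword k w) = cder_word i w.
Proof.
rewrite (@cderE [fset (FMonom w : fmonom I)]%fset).
  by rewrite big_seq_fset1 fword.unlock mcoeffUU scale1r.
by rewrite fword.unlock; exact: msuppU_le.
Qed.

Definition jacobi_rel (w : F) : set F := [set cder i w | i in setT].

End Potential.

Section QuadraticRelation.
Variables (k : fieldType) (n : nat) (f : 'M[k]_n).

Definition qform (R : algType k) (x : 'I_n -> R) : R :=
  \sum_i \sum_j f i j *: (x i * x j).

Definition xvar : choiceType := 'I_n.
(* None indexes the extra generator z. *)
Definition xzvar : choiceType := option 'I_n.

Definition quad_rel : freealg k xvar := qform (@fgen k xvar).

Local Notation x i := (@fgen k xzvar (Some i)).
Local Notation z := (@fgen k xzvar None).

Definition potential : freealg k xzvar := qform (fun i => x i) * z.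

Lemma potentialE : potential =
  \sum_i \sum_j f i j *: (fword k [:: Some i; Some j; None] : freealg k xzvar).
Proof.
rewrite /potential /qform mulr_suml; apply: eq_bigr => i _.
rewrite mulr_suml; apply: eq_bigr => j _.
by rewrite -scalerAl !fwordM.
Qed.

Lemma cder_potential_x i : @cder k xzvar (Some i) potential =
  \sum_j (f i j *: (x j * z) + f j i *: (z * x j)).
Proof.
rewrite potentialE !linear_sum big_split /=.
have E a b : @cder k xzvar (Some i) (fword k [:: Some a; Some b; None]) =
    (if a == i then x b * z else 0) + (if b == i then z * x a else 0).
  rewrite cder_fword /cder_word big_mkcond !big_ord_recl big_ord0 /=.
  by rewrite !addr0 !fwordM.
under eq_bigr => a _ do rewrite linear_sum.
under eq_bigr => a _ do under eq_bigr => b _ do rewrite linearZ /= E scalerDr.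
under eq_bigr => a _ do rewrite big_split /=.
rewrite big_split /=; congr (_ + _).
  rewrite (bigD1 i) //= eqxx [X in _ + X]big1 ?addr0 // => a /negPf ne.
  by rewrite big1 // => b _; rewrite ne scaler0.
apply: eq_bigr => a _; rewrite (bigD1 i) //= eqxx big1 ?addr0 // => b /negPf ne.
by rewrite ne scaler0.
Qed.

Lemma cder_potential_z :
  @cder k xzvar None potential = qform (fun i => x i).
Proof.
rewrite potentialE linear_sum; apply: eq_bigr => i _.
rewrite linear_sum; apply: eq_bigr => j _; rewrite linearZ /= cder_fword.
congr (_ *: _); rewrite /cder_word big_mkcond !big_ord_recl big_ord0 /=.
by rewrite !fwordM /= !add0r addr0.
Qed.

Lemma const_coef_qform (I : choiceType) (y : 'I_n -> I) :
  const_coef (qform (fun i => fgen (y i)) : freealg k I) = 0.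
Proof.
by apply: const_coef_sum => i; apply: const_coef_sum => j; exact: const_coef_gen2.
Qed.

Definition quad_alg : Type := qalg [set quad_rel].
Definition pot_alg : Type := qalg (jacobi_rel potential).

HB.instance Definition _ := GRing.PzRing.on quad_alg.
HB.instance Definition _ := GRing.Lmodule.on quad_alg.
HB.instance Definition _ := GRing.PzRing.on pot_alg.
HB.instance Definition _ := GRing.Lmodule.on pot_alg.

Fact quad_alg_nonzero : 1 != 0 :> quad_alg.
Proof. by apply: qalg_nonzero => r ->; exact: const_coef_qform. Qed.

Fact pot_alg_nonzero : 1 != 0 :> pot_alg.
Proof.
apply: qalg_nonzero => _ [[i|] _ <-]; last first.
  by rewrite cder_potential_z; exact: const_coef_qform.
rewrite cder_potential_x; apply: const_coef_sum => j.
by rewrite const_coefD !const_coef_gen2 addr0.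
Qed.

HB.instance Definition _ :=
  GRing.PzSemiRing_isNonZero.Build quad_alg quad_alg_nonzero.
HB.instance Definition _ :=
  GRing.Lmodule_isLalgebra.Build k quad_alg (@qalg_scaleAl _ _ _).
HB.instance Definition _ :=
  GRing.Lalgebra_isAlgebra.Build k quad_alg (@qalg_scaleAr _ _ _).
HB.instance Definition _ :=
  GRing.PzSemiRing_isNonZero.Build pot_alg pot_alg_nonzero.
HB.instance Definition _ :=
  GRing.Lmodule_isLalgebra.Build k pot_alg (@qalg_scaleAl _ _ _).
HB.instance Definition _ :=
  GRing.Lalgebra_isAlgebra.Build k pot_alg (@qalg_scaleAr _ _ _).

Definition quad_x (i : 'I_n) : quad_alg := qpi _ (@fgen k xvar i).
Definition pot_x (i : 'I_n) : pot_alg := qpi _ (x i).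
Definition pot_z : pot_alg := qpi _ z.
Definition pot_deg (d : nat) : set pot_alg := @qdeg k _ (jacobi_rel potential) d.

Definition alternating : Prop :=
  (forall i, f i i = 0) /\ (forall i j, f i j = - f j i).

End QuadraticRelation.

Arguments pot_deg {k n} f d.

Section VectorSpaceDimension.
Variables (k : fieldType) (V : lmodType k).

Definition kspan (s : seq V) : set V :=
  [set v | exists c : 'I_(size s) -> k, v = \sum_i c i *: s`_i].

(* S is a subspace with a basis of d elements. *)
Definition has_dim (S : set V) (d : nat) : Prop :=
  exists e : 'I_d -> V,
    (forall v, S v <-> exists c : 'I_d -> k, v = \sum_i c i *: e i) /\
    (forall c : 'I_d -> k, \sum_i c i *: e i = 0 -> forall i, c i = 0).

Definition dimk (S : set V) : nat := xget 0%N [set d | has_dim S d].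

End VectorSpaceDimension.

Section RingNotions.
Variable R : nzRingType.

Definition is_domain : Prop :=
  (1 : R) != 0 /\ (forall x y : R, x * y = 0 -> x = 0 \/ y = 0).

Definition central (z : R) : Prop := forall b, b * z = z * b.

Definition normal (z : R) : Prop :=
  [set b * z | b in setT] = [set z * b | b in setT].

Definition left_ideal (J : set R) : Prop :=
  [/\ J 0, forall a b, J a -> J b -> J (a + b) & forall u a, J a -> J (u * a)].

Definition right_ideal (J : set R) : Prop :=
  [/\ J 0, forall a b, J a -> J b -> J (a + b) & forall u a, J a -> J (a * u)].

Definition left_noetherian : Prop := forall J, left_ideal J ->
  exists s : seq R, forall a,
    J a <-> exists c : 'I_(size s) -> R, a = \sum_i c i * s`_i.

Definition right_noetherian : Prop := forall J, right_ideal J ->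
  exists s : seq R, forall a,
    J a <-> exists c : 'I_(size s) -> R, a = \sum_(i < size s) s`_i * c i.

End RingNotions.

(* B is a free left A-module (through iota) on the powers of z, and
   z a = sigma(a) z; i.e. B = A[z; sigma]. *)
Definition skew_polynomial (k : fieldType) (A B : algType k)
    (iota : {lrmorphism A -> B}) (sigma : {lrmorphism A -> A}) (z : B) : Prop :=
  [/\ bijective sigma,
      forall a, z * iota a = iota (sigma a) * z,
      forall b, exists m (c : 'I_m -> A), b = \sum_i iota (c i) * z ^+ i &
      forall m (c : 'I_m -> A),
        \sum_i iota (c i) * z ^+ i = 0 -> forall i, c i = 0].

Section GradedAlgebra.
Variables (k : fieldType) (B : algType k) (deg : nat -> set B).

Definition connected_grading : Prop :=
  [/\ forall d, deg d 0 /\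
        (forall (c : k) a b, deg d a -> deg d b -> deg d (c *: a + b)),
      forall d e a b, deg d a -> deg e b -> deg (d + e)%N (a * b),
      deg 0%N = [set c%:A | c in setT],
      forall b, exists m (a : 'I_m -> B),
        (forall i : 'I_m, deg i (a i)) /\ b = \sum_i a i &
      forall m (a : 'I_m -> B), (forall i : 'I_m, deg i (a i)) ->
        \sum_i a i = 0 -> forall i, a i = 0].

Definition augmentation_ideal : set B :=
  [set b | exists m (a : 'I_m -> B),
    (forall i : 'I_m, deg i.+1 (a i)) /\ b = \sum_i a i].

(* The trivial left module k = B / B_+ has a linear free resolution
     ... -> B(-2)^(r 2) -> B(-1)^(r 1) -> B -> k -> 0,
   the maps being right multiplications of row vectors by matrices with entries
   of degree 1.  Finite ranks are no restriction, because the components of B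
   are required to be finite dimensional. *)
Definition koszul : Prop :=
  [/\ connected_grading, forall d, exists D, has_dim (deg d) D &
      exists (r : nat -> nat) (M : forall i, 'M[B]_(r i.+1, r i)),
      [/\ r 0%N = 1%N,
          forall i p q, deg 1%N (M i p q),
          forall u : 'rV[B]_(r 0%N),
            (forall q, augmentation_ideal (u 0 q)) <->
            (exists v, u = v *m M 0%N) &
          forall i (u : 'rV[B]_(r i.+1)),
            u *m M i = 0 <-> exists v, u = v *m M i.+1]].

Definition power_series := nat -> int.

Definition ps_one : power_series := fun m => (m == 0)%:R.

Definition ps_mul (g h : power_series) : power_series :=
  fun m => \sum_(i < m.+1) g i * h (m - i)%N.

Definition ps_of_poly (p : {poly int}) : power_series := fun i => p`_i.

Definition is_hilbert_series (h : power_series) : Prop :=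
  forall d, exists D : nat, has_dim (deg d) D /\ h d = D%:Z.

End GradedAlgebra.

Section GelfandKirillov.
Variables (R : realType) (k : fieldType) (B : algType k).

Fixpoint products (s : seq B) (m : nat) : seq B :=
  if m is m'.+1 then [seq a * b | a <- s, b <- products s m'] else [:: 1].

(* sup over the finite-dimensional subspaces V = span(1, s) containing 1 of
   limsup_m log (dim V^m) / log m *)
Definition GKdim : \bar R :=
  ereal_sup [set limn_esup (fun m =>
    (ln (dimk (kspan (products (1 :: s) m)))%:R / ln m%:R)%:E) | s in setT].

End GelfandKirillov.

Section CalabiYau.
Variables (k : fieldType) (B : algType k).

Definition env_gen : choiceType := (B * B)%type.

Local Notation t a b := (@fgen k env_gen (a, b)).

Definition env_rel : set (freealg k env_gen) :=
  [set r | exists c a a' b,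
     r = t (c *: a + a') b - (c *: t a b + t a' b)] `|`
  [set r | exists c a b b',
     r = t a (c *: b + b') - (c *: t a b + t a b')] `|`
  [set r | exists a b a' b', r = t a b * t a' b' - t (a * a') (b' * b)] `|`
  [set t 1 1 - 1].

(* B^e = B (x) B^op, presented by the symbols a (x) b. *)
Definition env : Type := qalg env_rel.

HB.instance Definition _ := GRing.PzRing.on env.
HB.instance Definition _ := GRing.Lmodule.on env.

Definition tens (a b : B) : env := qpi _ (t a b).

(* Left B^e-modules are B-bimodules, with (a (x) b) p = a p b. *)
Definition fg_projective (P : lmodType env) : Prop :=
  exists m (i : {linear P -> 'rV[env]_m}) (p : {linear 'rV[env]_m -> P}),
    cancel i p.

Definition bimod_map (P : lmodType env) (eps : {additive P -> B}) : Prop :=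
  forall a b p, eps (tens a b *: p) = a * eps p * b.

Section Resolution.
Variables (P : nat -> lmodType env).
Variables (d : forall i, {linear P i.+1 -> P i}) (eps : {additive P 0%N -> B}).

Definition finite_fgp_resolution : Prop :=
  [/\ (forall i, fg_projective (P i)) /\
      (exists N, forall i, (N <= i)%N -> forall p : P i, p = 0),
      bimod_map eps,
      forall b, exists p, eps p = b,
      forall p, eps p = 0 <-> exists q, p = d 0%N q &
      forall i p, d i p = 0 <-> exists q, p = d i.+1 q].

(* The complex Hom_{B^e}(P, B^e); Ext^i_{B^e}(B, B^e) is the quotient of its
   cocycles by its coboundaries. *)
Definition hom_env (i : nat) : set (P i -> env) :=
  [set phi | linear_for *%R phi].

Definition cocycle (i : nat) : set (P i -> env) :=
  [set phi | hom_env phi /\ forall p, phi (d i p) = 0].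

Definition coboundary (i : nat) : set (P i -> env) :=
  if i is j.+1 then [set psi \o d j | psi in @hom_env j]
  else [set fun=> 0].

Definition ext_zero (i : nat) : Prop := @cocycle i `<=` @coboundary i.

(* A bimodule isomorphism Ext^i(B, B^e) -> B, as a map on cocycles; the bimodule
   structure on Hom(P_i, B^e) comes from right multiplication in B^e (the inner
   structure): (b phi a)(p) = phi(p) (a (x) b). *)
Definition ext_iso (i : nat) : Prop :=
  exists theta : (P i -> env) -> B,
    [/\ forall phi psi, cocycle phi -> cocycle psi ->
          theta (fun p => phi p + psi p) = theta phi + theta psi,
        forall a b phi, cocycle phi ->
          theta (fun p => phi p * tens a b) = b * theta phi * a,
        forall b, exists2 phi, cocycle phi & theta phi = b &
        forall phi, cocycle phi -> (theta phi = 0 <-> coboundary phi)].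

End Resolution.

Definition calabi_yau (m : nat) : Prop :=
  exists (P : nat -> lmodType env) (d : forall i, {linear P i.+1 -> P i})
         (eps : {additive P 0%N -> B}),
    [/\ finite_fgp_resolution d eps,
        forall i, i <> m -> ext_zero d i &
        ext_iso d m].

End CalabiYau.

(* Main.v *)
(* Let sum_i l_i x_i be the relation f.  An equality sum_i a_i x_i = 0 in A forces
   a_i = u l_i for some u, and since f is non-degenerate and n >= 2, an induction
   on the degree shows that right multiplication by a nonzero linear form is
   injective.  Hence, for a finite-dimensional subspace V of A,
     0 -> (V : A_1) -> V^n -> V A_1 -> 0
   is exact.  This gives the Hilbert series of A; applied to V = a A_j it gives
   dim a A_j = dim A_j for a <> 0, so that A is a domain; and for n = 2 it shows
   that the leading forms of a right ideal are generated in bounded degree, so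
   that A is noetherian.

   Writing x for the column of the x_i, the relations of B involving z say that
   z x = - f^-T f x z, and x |-> - f^-T f x is an automorphism of A because it
   preserves f.  The normal form of words shows that B = A[z; sigma].

   The Koszul complex of B has the matrices X, (m_ab) and X^T, where X is the
   column of the generators and r_a = sum_b m_ab X_b are the relations.  It is
   exact because syzygies of the generators come from the relations and because,
   modulo z, right multiplication by a linear form is injective.  The bimodule
   complex has the matrices X (x) 1 - 1 (x) X, m (x) 1 + 1 (x) m^T and the
   transpose of the first; it is exact because its part of lowest degree in the
   second factor is the Koszul complex.  By cyclic invariance of the potential the flip a (x) b |-> b (x) a
   of B^e maps it to its own dual, whence the Calabi-Yau property.

   For n >= 3 one has B x_1 /\ B x_2 = 0, so B contains infinite direct sums of
   left ideals and is not left noetherian; for n = 2, Hilbert's basis theorem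
   applies.  The two sides are exchanged by the anti-isomorphism B(f) -> B(f^T). *)

Require Import Defs.
From HB Require Import structures.
From mathcomp Require Import all_boot all_order all_algebra.
From mathcomp Require Import boolp classical_sets reals ereal.
From mathcomp Require Import constructive_ereal topology normedtype sequences exp.
From mathcomp Require Import zify ring lra finmap.
From mathcomp Require Import -(notations) monalg.

Import Order.TTheory GRing.Theory Num.Theory.
Local Open Scope ring_scope.

Set Implicit Arguments.
Unset Strict Implicit.
Unset Printing Implicit Defensive.

(** No monomial basis of [A] or [B] is chosen. The ideals of relations are controlled through last
    letters: taking the coefficient of a last letter sends the ideal, modulo itself, to left
    multiples of the relations. This gives the first syzygies, and dimension counts do the rest. The
    bound [dim a A_j >= dim A_j] is a comparison argument: for [V = a A_j] the dimensions [v_s] of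
    [{u | u A_s <= V}] satisfy [n v_(s+1) <= v_s + v_(s+2)], while the Hilbert function of [A]
    solves the equality case with initial values 1 and [n]; as [v_s] is 0 for large [s] and
    [v_j > 0] because of [a], the value [v_0 = dim V] is at least [dim A_j]. [A] and [B] are
    arbitrary algebras with a given presentation until the very end, so that their quotient types
    never enter a computation. *)

(** * Free algebras, presentations and morphisms defined on generators *)

Section LinearExtension.
Variables (k : fieldType) (I : choiceType) (M : lmodType k) (h : seq I -> M).
Implicit Types a b : freealg k I.

Definition flin a : M := \sum_(w <- msupp a) mcoeff w a *: h w.

Lemma flinE (d : {fset fmonom I}) a : (msupp a `<=` d)%fset ->
  flin a = \sum_(w <- d) mcoeff w a *: h w.
Proof.
move=> le; rewrite [LHS](big_fset_incl _ le) // => w _ /mcoeff_outdom ->.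
by rewrite scale0r.
Qed.

Lemma flin_is_linear : linear flin.
Proof.
move=> c a b.
have lea : (msupp a `<=` msupp a `|` msupp b)%fset by exact: fsubsetUl.
have leb : (msupp b `<=` msupp a `|` msupp b)%fset by exact: fsubsetUr.
have leD : (msupp (c *: a + b)%R `<=` msupp a `|` msupp b)%fset.
  apply/fsubsetP => w; rewrite inE; apply: contraLR.
  rewrite negb_or => /andP[/mcoeff_outdom wa /mcoeff_outdom wb].
  by rewrite -mcoeff_eq0 fcoeffD fcoeffZ wa wb mulr0 addr0.
rewrite (flinE lea) (flinE leb) (flinE leD) scaler_sumr -big_split.
by apply: eq_bigr => w _; rewrite fcoeffD fcoeffZ scalerDl scalerA.
Qed.

HB.instance Definition _ :=
  GRing.isLinear.Build k (freealg k I) M *:%R flin flin_is_linear.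

Lemma flin_word (w : seq I) : flin (fword k w) = h w.
Proof.
rewrite (@flinE [fset (FMonom w : fmonom I)]%fset).
  by rewrite big_seq_fset1 fword.unlock mcoeffUU scale1r.
by rewrite fword.unlock; exact: msuppU_le.
Qed.

End LinearExtension.

Section FreeAlgebraInduction.
Variables (k : fieldType) (I : choiceType).
Implicit Types a b : freealg k I.

Lemma fcoeff_sum (w : fmonom I) (J : Type) (s : seq J) (E : J -> freealg k I) :
  mcoeff w (\sum_(j <- s) E j) = \sum_(j <- s) mcoeff w (E j).
Proof.
elim: s => [|j s IH]; first by rewrite !big_nil fcoeff0.
by rewrite !big_cons fcoeffD IH.
Qed.

Lemma flin_fword a : flin (fword k (I := I)) a = a.
Proof.
apply/malgP => w; rewrite [in LHS]/flin fcoeff_sum.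
under eq_bigr => v _ do rewrite fcoeffZ fword.unlock mcoeffU.
have E (v : fmonom I) : FMonom (v : seq I) = v by case: v.
case: (boolP (w \in msupp a)) => wa.
  rewrite (bigD1_seq w) //= E eqxx mulr1 big1 ?addr0 // => v /negPf ne.
  by rewrite E ne mulr0.
rewrite (mcoeff_outdom wa) big_seq big1 // => v va; rewrite E.
by case: eqP => [vw|]; [rewrite vw (negPf wa) in va|rewrite mulr0].
Qed.

Lemma freealg_ind (P : freealg k I -> Prop) : P 0 ->
  (forall c a b, P a -> P b -> P (c *: a + b)) ->
  (forall w, P (fword k w)) -> forall a, P a.
Proof.
move=> P0 PD Pw a; rewrite -[a]flin_fword /flin.
elim/big_rec: _ => // w b _ Pb; exact: PD.
Qed.

Lemma fword0 : fword k (nil : seq I) = 1.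
Proof.
rewrite [1](_ : _ = fa_one k I) // fa_one.unlock fword.unlock.
apply/malgP => w; rewrite mcoeff1 mcoeffU -!(inj_eq val_inj) /= fm1.
by rewrite eq_sym.
Qed.

Lemma fword_cons i (w : seq I) : fword k (i :: w) = fgen i * fword k w.
Proof. by rewrite fwordM. Qed.

Lemma fword_rcons i (w : seq I) : fword k (rcons w i) = fword k w * fgen i.
Proof. by rewrite fwordM cats1. Qed.

(** By linearity, multiplication on both sides by arbitrary elements reduces to multiplication by
    words, one side at a time. Linear maps given on words are shown to vanish on an ideal in this
    way. *)
Lemma ideal_gen_ind (G : set (freealg k I)) (P : freealg k I -> Prop) :
  P 0 -> (forall c a b, P a -> P b -> P (c *: a + b)) ->
  (forall w a, P a -> P (fword k w * a)) ->
  (forall w a, P a -> P (a * fword k w)) ->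
  (forall r, G r -> P r) -> forall a, ideal_gen G a -> P a.
Proof.
move=> P0 PD Pl Pr PG a; apply; split=> //; split=> // [b c Pb Pc|u b v Pb].
  by rewrite -[b]scale1r; exact: PD.
have {}Pb : P (b * v).
  elim/freealg_ind: v => [|c v1 v2 P1 P2|w]; rewrite ?mulr0//; last exact: Pr.
  by rewrite mulrDr -scalerAr; exact: PD.
rewrite -mulrA; elim/freealg_ind: u => [|c u1 u2 P1 P2|w]; rewrite ?mul0r//.
  by rewrite mulrDl -scalerAl; exact: PD.
exact: Pl.
Qed.

End FreeAlgebraInduction.

Section Presentation.
Variables (k : fieldType) (I : choiceType) (G : set (freealg k I)).

(** The form in which [A], [B] and the enveloping algebra are handled. [p] is a bare function, so
    that it can be a linear map or an algebra morphism according to use. *)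
Definition presents (V : lmodType k) (p : freealg k I -> V) : Prop :=
  (forall r, exists a, p a = r) /\ (forall a, p a = 0 <-> ideal_gen G a).

Lemma presents_desc (V M : lmodType k) (p : {linear freealg k I -> V})
    (h : {linear freealg k I -> M}) : presents p ->
  (forall a, ideal_gen G a -> h a = 0) ->
  exists q : {linear V -> M}, forall a, q (p a) = h a.
Proof.
move=> [p_surj p_ker] h0.
pose l r := projT1 (cid (p_surj r)); have lK r : p (l r) = r by rewrite /l; case: cid.
pose q r := h (l r).
have qE a : q (p a) = h a.
  apply/eqP; rewrite -subr_eq0 -linearB; apply/eqP/h0/p_ker.
  by rewrite linearB /= lK subrr.
have q_lin : linear q.
  by move=> c r s; rewrite -[r]lK -[s]lK -linearP !qE linearP.
pose Q : {linear V -> M} := HB.pack q (GRing.isLinear.Build _ _ _ _ q q_lin).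
by exists Q.
Qed.

End Presentation.

Lemma qalg_presents (k : fieldType) (I : choiceType) (G : set (freealg k I)) :
  presents G (qpi G).
Proof.
split=> [r|a]; first by exists (qrepr r); exact: qreprK.
rewrite -(raddf0 (qpi G)); split=> [/qpiE|Ja].
  by rewrite subr0 => /asboolP.
by apply/qpiE; rewrite subr0; exact/asboolP.
Qed.

Section Evaluation.
Variables (k : fieldType) (I : choiceType) (S : algType k) (g : I -> S).

Definition feval : freealg k I -> S := flin (fun w => \prod_(i <- w) g i).

HB.instance Definition _ := GRing.Linear.on feval.

Lemma feval_word w : feval (fword k w) = \prod_(i <- w) g i.
Proof. exact: flin_word. Qed.

Lemma feval_gen i : feval (fgen i) = g i.
Proof. by rewrite feval_word big_seq1. Qed.

Lemma fevalM a b : feval (a * b) = feval a * feval b.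
Proof.
elim/freealg_ind: a => [|c a a' Ea Ea'|v]; first by rewrite mul0r linear0 mul0r.
  by rewrite mulrDl -scalerAl !linearP /= Ea Ea' mulrDl -scalerAl.
elim/freealg_ind: b => [|c b b' Eb Eb'|w]; first by rewrite mulr0 linear0 mulr0.
  by rewrite mulrDr -scalerAr !linearP /= Eb Eb' mulrDr -scalerAr.
by rewrite fwordM !feval_word big_cat.
Qed.

Lemma feval1 : feval 1 = 1.
Proof. by rewrite -fword0 feval_word big_nil. Qed.

HB.instance Definition _ := GRing.isMonoidMorphism.Build _ _ feval
  (conj feval1 fevalM).

(** Reversing the words makes this evaluation an antimorphism; it serves to pass from [f] to
    [f^T]. *)
Definition feval_rev : freealg k I -> S :=
  flin (fun w => \prod_(i <- rev w) g i).

HB.instance Definition _ := GRing.Linear.on feval_rev.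

Lemma feval_rev_word w : feval_rev (fword k w) = \prod_(i <- rev w) g i.
Proof. exact: flin_word. Qed.

Lemma feval_rev_gen i : feval_rev (fgen i) = g i.
Proof. by rewrite feval_rev_word big_seq1. Qed.

Lemma feval_revM a b : feval_rev (a * b) = feval_rev b * feval_rev a.
Proof.
elim/freealg_ind: a => [|c a a' Ea Ea'|v]; first by rewrite mul0r linear0 mulr0.
  by rewrite mulrDl -scalerAl !linearP /= Ea Ea' mulrDr -scalerAr.
elim/freealg_ind: b => [|c b b' Eb Eb'|w]; first by rewrite mulr0 linear0 mul0r.
  by rewrite mulrDr -scalerAr !linearP /= Eb Eb' mulrDl -scalerAl.
by rewrite fwordM !feval_rev_word rev_cat big_cat.
Qed.

Lemma feval_rev1 : feval_rev 1 = 1.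
Proof. by rewrite -fword0 feval_rev_word big_nil. Qed.

Variables (G : set (freealg k I)) (R : algType k).
Variables (p : {lrmorphism freealg k I -> R}) (p_pres : presents G p).

Lemma presents_lrmorphism : (forall r, G r -> feval r = 0) ->
  exists q : {lrmorphism R -> S}, forall i, q (p (fgen i)) = g i.
Proof.
move=> G0; have [|q qE] := @presents_desc _ _ _ _ _ p feval p_pres.
  move=> a; elim/ideal_gen_ind => //; first exact: linear0.
  - by move=> c b d Eb Ed; rewrite linearP /= Eb Ed scaler0 addr0.
  - by move=> w b /= Eb; rewrite fevalM Eb mulr0.
  - by move=> w b /= Eb; rewrite fevalM Eb mul0r.
have [p_surj _] := p_pres.
have qM : monoid_morphism q.
  split=> [|r s]; first by rewrite -(rmorph1 p) qE /= feval1.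
  have [a <-] := p_surj r; have [b <-] := p_surj s.
  by rewrite -rmorphM !qE /= fevalM.
pose Q : {lrmorphism R -> S} := HB.pack (q : R -> S) (GRing.Linear.class q)
  (GRing.isMonoidMorphism.Build _ _ q qM).
by exists Q => i; rewrite /= qE /= feval_gen.
Qed.

Lemma presents_antimorphism : (forall r, G r -> feval_rev r = 0) ->
  exists q : {linear R -> S}, [/\ q 1 = 1, forall r s, q (r * s) = q s * q r &
    forall i, q (p (fgen i)) = g i].
Proof.
move=> G0; have [|q qE] := @presents_desc _ _ _ _ _ p feval_rev p_pres.
  move=> a; elim/ideal_gen_ind => //; first exact: linear0.
  - by move=> c b d Eb Ed; rewrite linearP /= Eb Ed scaler0 addr0.
  - by move=> w b /= Eb; rewrite feval_revM Eb mul0r.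
  - by move=> w b /= Eb; rewrite feval_revM Eb mulr0.
have [p_surj _] := p_pres.
exists q; split=> [|r s|i]; first by rewrite -(rmorph1 p) qE /= feval_rev1.
  have [a <-] := p_surj r; have [b <-] := p_surj s.
  by rewrite -rmorphM !qE /= feval_revM.
by rewrite qE /= feval_rev_gen.
Qed.

End Evaluation.

(** * Grading and syzygies of a presented algebra *)

Section Presented.
Variables (k : fieldType) (I : finType) (G : set (freealg k I)).
Variables (R : algType k) (p : {lrmorphism freealg k I -> R}).
Hypothesis p_pres : presents G p.
Let X i := p (fgen i).

Lemma presented_ind (P : R -> Prop) : P 0 ->
  (forall c a b, P a -> P b -> P (c *: a + b)) ->
  P 1 -> (forall a i, P a -> P (a * X i)) -> forall a, P a.
Proof.
move=> P0 PD P1 PX r; have [p_surj _] := p_pres; have [a <-] := p_surj r.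
elim/freealg_ind: a => [|c a b Pa Pb|w]; first by rewrite linear0.
  by rewrite linearP; exact: PD.
elim/last_ind: w => [|w i IH]; first by rewrite fword0 rmorph1.
by rewrite fword_rcons rmorphM; exact: PX.
Qed.

Let pieceF (d : nat) : {linear freealg k I -> R} :=
  flin (fun w => if size w == d then p (fword k w) else 0).

Lemma presented_grading : (forall r, G r -> exists e, homogeneous e r) ->
  exists comp : nat -> {linear R -> R}, forall d w, comp d (p (fword k w)) =
    if size w == d then p (fword k w) else 0.
Proof.
move=> Ghom.
have E w d : pieceF d (fword k w) = if size w == d then p (fword k w) else 0.
  exact: flin_word.
(* On a homogeneous element a piece is either all of [p a] or 0. *)
have Zp a : (exists e, homogeneous e a) -> p a = 0 ->
    forall d, pieceF d a = 0.
  move=> [e ha] pa0 d.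
  have -> : pieceF d a = \sum_(w <- msupp a) mcoeff w a *:
      (if size w == d then p (fword k w) else 0) by [].
  case: (eqVneq e d) => [ed|ne].
    rewrite -[RHS]pa0 -[in RHS](flin_fword a) [in RHS]/flin linear_sum /=.
    rewrite !big_seq; apply: eq_bigr => w /ha wd.
    by rewrite linearZ /= wd ed eqxx.
  rewrite big_seq big1 // => w /ha wd.
  by rewrite wd (negPf ne) scaler0.
have Z a : ideal_gen G a -> forall d, pieceF d a = 0.
  elim/ideal_gen_ind.
  - by move=> d; rewrite linear0.
  - by move=> c b b' Eb Eb' d; rewrite linearP /= Eb Eb' scaler0 addr0.
  - move=> w b Eb d.
    (* Multiplication by [w] shifts the pieces by [size w], which is why vanishing is proved for all
       [d] at once. *)
    have -> : pieceF d (fword k w * b) =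
        if (size w <= d)%N then p (fword k w) * pieceF (d - size w)%N b else 0.
      elim/freealg_ind: b {Eb} => [|c b b' Eb Eb'|v].
      - by rewrite mulr0 !linear0 mulr0 if_same.
      - rewrite mulrDr -scalerAr !linearP /= Eb Eb'.
        by case: ifP => _; rewrite ?scaler0 ?addr0 // mulrDr -scalerAr.
      rewrite fwordM !E size_cat; case: leqP => [le|lt].
        rewrite -{1}(subnKC le) eqn_add2l; case: eqP => _; last by rewrite mulr0.
        by rewrite -fwordM rmorphM.
      by rewrite gtn_eqF // (leq_trans lt) // leq_addr.
    by rewrite Eb mulr0 if_same.
  - move=> w b Eb d.
    have -> : pieceF d (b * fword k w) =
        if (size w <= d)%N then pieceF (d - size w)%N b * p (fword k w) else 0.
      elim/freealg_ind: b {Eb} => [|c b b' Eb Eb'|v].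
      - by rewrite mul0r !linear0 mul0r if_same.
      - rewrite mulrDl -scalerAl !linearP /= Eb Eb'.
        by case: ifP => _; rewrite ?scaler0 ?addr0 // mulrDl -scalerAl.
      rewrite fwordM !E size_cat; case: leqP => [le|lt].
        rewrite -{1}(subnK le) eqn_add2r; case: eqP => _; last by rewrite mul0r.
        by rewrite -fwordM rmorphM.
      by rewrite gtn_eqF // (leq_trans lt) // leq_addl.
    by rewrite Eb mul0r if_same.
  move=> r Gr d; apply: Zp; first exact: Ghom.
  by have [_ ker] := p_pres; apply/ker => J [_]; exact.
have q d : {q : {linear R -> R} | forall a, q (p a) = pieceF d a}.
  apply: cid; apply: (@presents_desc _ _ _ _ _ p (pieceF d) p_pres).
  by move=> a /Z.
by exists (fun d => projT1 (q d)) => d w; rewrite (projT2 (q d)) E.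
Qed.

Lemma fgen_const i : const_coef (fgen i : freealg k I) = 0.
Proof.
by rewrite /const_coef /fgen fword.unlock mcoeffU -(inj_eq val_inj) /= fm1.
Qed.

(* Extracting the coefficient of a last letter x_i maps the ideal of relations
   into the left submodule generated by the (rd s i), modulo the ideal itself. *)
Lemma presented_syzygy (J : finType) (rd : J -> I -> freealg k I) :
  (forall r, G r <-> exists s, r = \sum_i rd s i * fgen i) ->
  forall a : I -> R, \sum_i a i * X i = 0 ->
  exists u : J -> R, forall i, a i = \sum_s u s * p (rd s i).
Proof.
move=> GE a a0; have [p_surj p_ker] := p_pres.
have [D Dw] : exists D : I -> {linear freealg k I -> freealg k I}, forall i w,
    D i (fword k w) = if rev w is j :: w' then
      if j == i then fword k (rev w') else 0 else 0.
  exists (fun i => flin (fun w => if rev w is j :: w' then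
    if j == i then fword k (rev w') else 0 else 0)) => i w.
  exact: flin_word.
have DX i b j : D i (b * fgen j) = if j == i then b else 0.
  elim/freealg_ind: b => [|c b b' Eb Eb'|w].
  - by rewrite mul0r linear0 if_same.
  - by rewrite mulrDl -scalerAl linearP /= Eb Eb'; case: eqP; rewrite ?scaler0 ?addr0.
  by rewrite -fword_rcons Dw rev_rcons revK.
have DM i u c : const_coef c = 0 -> D i (u * c) = u * D i c.
  (* The rule [D i (u * c) = u * D i c + const_coef c *: D i u] holds for all [c] and is linear in
     [c], so it can be checked on words. *)
  move=> c0; rewrite -[RHS]addr0 -(scale0r (D i u)) -c0 => {c0}.
  elim/freealg_ind: c => [|c b b' Eb Eb'|w].
  - by rewrite mulr0 linear0 const_coef0 scale0r mulr0 addr0.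
  - rewrite mulrDr -scalerAr !linearP /= Eb Eb' mulrDr const_coefD const_coefZ.
    by rewrite scalerDl scalerDr -scalerAr scalerA addrACA.
  elim/last_ind: w => [|w j _].
    by rewrite fword0 mulr1 const_coef1 scale1r -fword0 Dw mulr0 add0r.
  rewrite fword_rcons mulrA !DX const_coefM fgen_const mulr0 scale0r addr0.
  by case: eqP => //; rewrite mulr0.
(* The first condition lets [D i] commute with left multiplication. The second makes [D i (c * w)]
   vanish in [R] for a nonempty word [w], since only the last letter of [w] is removed. *)
pose P c := [/\ const_coef c = 0, p c = 0 &
  exists u : J -> R, forall i, p (D i c) = \sum_s u s * p (rd s i)].
have PG c : ideal_gen G c -> P c.
  elim/ideal_gen_ind.
  - split; rewrite ?linear0 ?const_coef0 //; exists (fun=> 0) => i.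
    by rewrite linear0 linear0 big1 // => s _; rewrite mul0r.
  - move=> e b b' [b1 b2 [u bu]] [b1' b2' [u' bu']].
    split; rewrite ?linearP ?const_coefD ?const_coefZ /= ?(b1, b2, b1', b2').
    + by rewrite mulr0 addr0.
    + by rewrite scaler0 addr0.
    exists (fun s => e *: u s + u' s) => i; rewrite !linearP /= bu bu'.
    rewrite scaler_sumr -big_split; apply: eq_bigr => s _ /=.
    by rewrite mulrDl scalerAl.
  - move=> w b [b1 b2 [u bu]]; split; first by rewrite const_coefM b1 mulr0.
      by rewrite rmorphM /= b2 mulr0.
    exists (fun s => p (fword k w) * u s) => i.
    rewrite DM // rmorphM /= bu mulr_sumr.
    by apply: eq_bigr => s _; rewrite mulrA.
  - move=> w b [b1 b2 bu]; split; first by rewrite const_coefM b1 mul0r.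
      by rewrite rmorphM /= b2 mul0r.
    case/lastP: w => [|w j]; first by rewrite fword0 mulr1.
    exists (fun=> 0) => i; rewrite fword_rcons mulrA DX.
    rewrite big1 => [|s _]; last by rewrite mul0r.
    by case: eqP; rewrite ?linear0 // rmorphM /= b2 mul0r.
  move=> r /GE[s ->]; split.
  - apply: (big_ind (fun c => const_coef c = 0)) => [|b b' b1 b2|i _].
    + exact: const_coef0.
    + by rewrite const_coefD b1 b2 addr0.
    by rewrite const_coefM fgen_const mulr0.
  - by apply/p_ker => S [_]; apply; apply/GE; exists s.
  exists (fun t => (t == s)%:R) => i; rewrite !linear_sum /=.
  rewrite (bigD1 i) //= DX eqxx big1 => [|j /negPf ne]; last first.
    by rewrite DX ne linear0.
  rewrite (bigD1 s) //= eqxx mul1r big1 ?addr0 // => t /negPf ->.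
  by rewrite mul0r.
have [b bE] : exists b : I -> freealg k I, forall i, p (b i) = a i.
  by exists (fun i => projT1 (cid (p_surj (a i)))) => i; case: cid.
have [_ _ [u uE]] : P (\sum_i b i * fgen i).
  apply/PG/p_ker; rewrite rmorph_sum -[RHS]a0; apply: eq_bigr => i _.
  by rewrite rmorphM /= bE.
exists u => i; rewrite -uE -bE; congr (p _); rewrite !linear_sum /=.
rewrite (bigD1 i) //= DX eqxx big1 ?addr0 // => j /negPf ne.
by rewrite DX ne.
Qed.

End Presented.

(** * Gradings given by their projections *)

Section Graded.
Local Open Scope classical_set_scope.
Variables (k : fieldType) (I : finType) (R : algType k) (X : I -> R).
Variable comp : nat -> {linear R -> R}.

(* R is generated by the X i, and comp d is the projection on the component of
   degree d of a grading for which they have degree 1. *)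
Definition graded_gen : Prop :=
  [/\ forall P : R -> Prop, P 0 ->
        (forall c a b, P a -> P b -> P (c *: a + b)) ->
        P 1 -> (forall a i, P a -> P (a * X i)) -> forall a, P a,
      forall d, comp d 1 = if d == 0%N then 1 else 0 &
      forall i a, comp 0%N (a * X i) = 0 /\
        forall d, comp d.+1 (a * X i) = comp d a * X i].

Hypothesis gg : graded_gen.

Let R_ind (P : R -> Prop) : P 0 ->
  (forall c a b, P a -> P b -> P (c *: a + b)) ->
  P 1 -> (forall a i, P a -> P (a * X i)) -> forall a, P a.
Proof. by case: gg => + _ _; apply. Qed.

Lemma comp1 d : comp d 1 = if d == 0%N then 1 else 0.
Proof. by case: gg. Qed.

Lemma compXr0 a i : comp 0%N (a * X i) = 0.
Proof. by case: gg => _ _ /(_ i a)[]. Qed.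

Lemma compXr d a i : comp d.+1 (a * X i) = comp d a * X i.
Proof. by case: gg => _ _ /(_ i a)[]. Qed.

Lemma comp_comp d e a : comp d (comp e a) = if d == e then comp d a else 0.
Proof.
elim/R_ind: a d e => [|c a b Ea Eb||a i Ea] d e.
- by rewrite !linear0 if_same.
- by rewrite !linearP Ea Eb; case: eqP; rewrite ?scaler0 ?addr0.
- rewrite comp1; case: (e =P 0%N) => [->|]; last first.
    by rewrite linear0 comp1; case: (d =P e) => // ->; case: eqP.
  by rewrite comp1; case: eqP.
case: e d => [|e] [|d].
- by rewrite !compXr0 linear0.
- by rewrite compXr0 linear0.
- by rewrite compXr compXr0.
by rewrite !compXr Ea eqSS; case: eqP; rewrite ?mul0r.
Qed.

Lemma comp_id d a : comp d (comp d a) = comp d a.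
Proof. by rewrite comp_comp eqxx. Qed.

(** Degree less than [m]. With a strict bound, [m = 0] singles out the zero element, where
    inductions on the degree start. *)
Definition dlt m a := forall d, (m <= d)%N -> comp d a = 0.

Lemma dlt0 m : dlt m 0. Proof. by move=> d _; rewrite linear0. Qed.

Lemma dltP m c a b : dlt m a -> dlt m b -> dlt m (c *: a + b).
Proof. by move=> a0 b0 d md; rewrite linearP a0 // b0 // scaler0 addr0. Qed.

Lemma dlt_leq m m' a : (m <= m')%N -> dlt m a -> dlt m' a.
Proof. by move=> le a0 d md; apply: a0; apply: leq_trans md. Qed.

Lemma dlt_sumr m (J : finType) (E : J -> R) :
  (forall j, dlt m (E j)) -> dlt m (\sum_j E j).
Proof. by move=> E0 d md; rewrite linear_sum big1 // => j _; exact: E0. Qed.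

Lemma dltZ m c a : dlt m a -> dlt m (c *: a).
Proof. by move=> a0; rewrite -[_ *: _]addr0; apply: dltP => //; exact: dlt0. Qed.

Lemma dltD m a b : dlt m a -> dlt m b -> dlt m (a + b).
Proof. by move=> a0 b0; rewrite -[a]scale1r; exact: dltP. Qed.

Lemma dlt_comp d a : dlt d.+1 (comp d a).
Proof. by move=> e de; rewrite comp_comp gtn_eqF. Qed.

Lemma dlt_sub_comp m b : dlt m.+1 b -> dlt m (b - comp m b).
Proof.
move=> bm d; rewrite leq_eqVlt linearB /= => /predU1P[<-|md].
  by rewrite comp_id subrr.
by rewrite [comp d b]bm // sub0r dlt_comp // oppr0.
Qed.

Lemma dlt_bound a : exists m, forall N, (m <= N)%N ->
  a = \sum_(d < N) comp d a /\ dlt N a.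
Proof.
elim/R_ind: a => [|c a b [m Em] [m' Em']||a i [m Em]].
- exists 0%N => N _; split; last exact: dlt0.
  by rewrite big1 // => d _; rewrite linear0.
- exists (maxn m m') => N; rewrite geq_max => /andP[/Em[Ea a0] /Em'[Eb b0]].
  split; last exact: dltP.
  rewrite {1}Ea {1}Eb scaler_sumr -big_split.
  by apply: eq_bigr => d _; rewrite linearP.
- exists 1%N => -[//|N] _; split.
    rewrite big_ord_recl comp1 /= big1 ?addr0 // => j _.
    by rewrite comp1.
  by move=> [//|d] _; rewrite comp1.
exists m.+1 => -[//|N]; rewrite ltnS => /Em[Ea a0]; split.
  rewrite big_ord_recl compXr0 add0r {1}Ea mulr_suml.
  by apply: eq_bigr => d _; rewrite compXr.
by move=> [//|d] Nd; rewrite compXr a0 // mul0r.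
Qed.

Lemma dlt_exists a : exists m, dlt m a.
Proof. by have [m /(_ m (leqnn m))[]] := dlt_bound a; exists m. Qed.

Lemma dlt_sum m a : dlt m a -> a = \sum_(d < m) comp d a.
Proof.
move=> a0; have [N /(_ _ (leq_maxl N m))[Ea _]] := dlt_bound a.
rewrite {1}Ea -!(big_mkord xpredT (comp^~ a)).
rewrite (big_cat_nat (leq0n m) (leq_maxr N m)) /= [X in _ + X]big_nat_cond.
by rewrite [X in _ + X]big1 ?addr0 // => d /andP[/andP[md _] _]; exact: a0.
Qed.

Lemma dlt0_eq0 a : dlt 0 a -> a = 0.
Proof. by move/dlt_sum; rewrite big_ord0. Qed.

Lemma comp_homl d e a b : comp d a = a ->
  comp e (a * b) = if (d <= e)%N then a * comp (e - d)%N b else 0.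
Proof.
move=> ha; elim/R_ind: b e => [|c b b' Eb Eb'||b i Eb] e.
- by rewrite mulr0 !linear0 mulr0 if_same.
- rewrite mulrDr -scalerAr !linearP Eb Eb' mulrDr -scalerAr.
  by case: ifP; rewrite ?scaler0 ?addr0.
- rewrite mulr1 -{1}ha comp_comp comp1 subn_eq0.
  case: (ltngtP d e) => [de|ed|<-]; rewrite ?mulr0 ?mulr1 //.
case: e => [|e]; rewrite mulrA.
  by rewrite compXr0 sub0n compXr0 mulr0 if_same.
rewrite compXr Eb; case: (ltngtP d e.+1) => [|ed|ed].
- by rewrite ltnS => de; rewrite de subSn // compXr mulrA.
- by rewrite leqNgt ltnW //= mul0r.
by rewrite ed ltnn mul0r subnn compXr0 mulr0.
Qed.

Lemma compM e a b : comp e (a * b) = \sum_(i < e.+1) comp i a * comp (e - i)%N b.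
Proof.
have [m /(_ _ (leq_maxl m e.+1))[Ea _]] := dlt_bound a.
rewrite {1}Ea mulr_suml linear_sum /=.
under eq_bigr => d _ do rewrite (comp_homl _ _ (comp_id d a)).
rewrite -(big_mkord xpredT (fun d => if (d <= e)%N then
  comp d a * comp (e - d)%N b else 0)).
rewrite (big_cat_nat (leq0n e.+1) (leq_maxr m e.+1)) /= big_mkord.
rewrite [X in _ + X]big_nat_cond [X in _ + X]big1 ?addr0.
  by apply: eq_bigr => d _; rewrite -ltnS ltn_ord.
by move=> d /andP[/andP[ed _] _]; rewrite leqNgt ed.
Qed.

Lemma compM_top p q a b : dlt p.+1 a -> dlt q.+1 b ->
  comp (p + q)%N (a * b) = comp p a * comp q b.
Proof.
move=> a0 b0; rewrite compM (bigD1 (inord p)) //= inordK ?ltnS ?leq_addr //.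
rewrite addKn big1 ?addr0 // => i; rewrite -val_eqE /= inordK ?ltnS ?leq_addr //.
case: (ltngtP i p) => // [ip|pi] _; last by rewrite a0 ?mul0r.
by rewrite b0 ?mulr0 // ltn_subRL ltn_add2r.
Qed.

Lemma dltM p q a b : dlt p a -> dlt q.+1 b -> dlt (p + q)%N (a * b).
Proof.
move=> a0 b0 d pqd; rewrite compM big1 // => i _.
case: (leqP p i) => [pi|ip]; first by rewrite a0 ?mul0r.
by rewrite b0 ?mulr0 // ltn_subRL (leq_trans _ pqd) // ltn_add2r.
Qed.

Definition trunc m a := \sum_(d < m) comp d a.

Lemma trunc_linear m : linear (trunc m).
Proof.
move=> c a b; rewrite /trunc scaler_sumr -big_split.
by apply: eq_bigr => d _; rewrite linearP.
Qed.

HB.instance Definition _ m :=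
  GRing.isLinear.Build k R R *:%R (trunc m) (trunc_linear m).

Lemma comp_trunc d m a : comp d (trunc m a) = if (d < m)%N then comp d a else 0.
Proof.
rewrite linear_sum; case: ltnP => [dm|md].
  rewrite (bigD1 (Ordinal dm)) //= comp_id big1 ?addr0 // => e.
  by rewrite -val_eqE comp_comp /= eq_sym => /negPf ->.
rewrite big1 // => e _; rewrite comp_comp gtn_eqF //.
exact: leq_trans (ltn_ord e) md.
Qed.

Lemma dlt_trunc m a : dlt m (trunc m a).
Proof. by move=> d md; rewrite comp_trunc ltnNge md. Qed.

Lemma trunc_id m a : dlt m a -> trunc m a = a.
Proof. by move=> /dlt_sum. Qed.

Definition gdeg d : set R := [set a | comp d a = a].

Lemma gdeg_homog d a : gdeg d (comp d a).
Proof. exact: comp_id. Qed.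

Lemma gdeg_dlt d a : gdeg d a -> dlt d.+1 a.
Proof. by move=> <-; exact: dlt_comp. Qed.

Lemma gdeg_sub d c a b : gdeg d a -> gdeg d b -> gdeg d (c *: a + b).
Proof. by rewrite /gdeg /= linearP => -> ->. Qed.

Lemma gdegX i : gdeg 1 (X i).
Proof. by rewrite /gdeg /= -[X i]mul1r compXr comp1. Qed.

Lemma gdegM d e a b : gdeg d a -> gdeg e b -> gdeg (d + e)%N (a * b).
Proof.
by rewrite /gdeg /= => ha hb; rewrite (comp_homl _ _ ha) leq_addr addKn hb.
Qed.

Lemma comp0_scalar a : exists c, comp 0 a = c%:A.
Proof.
elim/R_ind: a => [|c a b [x Ex] [y Ey]||a i _].
- by exists 0; rewrite linear0 scale0r.
- by exists (c * x + y); rewrite linearP Ex Ey scalerA scalerDl.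
- by exists 1; rewrite comp1 scale1r.
by exists 0; rewrite compXr0 scale0r.
Qed.

Lemma compSP d a : exists b : I -> R,
  (forall i, gdeg d (b i)) /\ comp d.+1 a = \sum_i b i * X i.
Proof.
elim/R_ind: a => [|c a b [x [hx Ex]] [y [hy Ey]]||a i _].
- exists (fun=> 0); split=> [i|]; first exact: linear0.
  by rewrite linear0 big1 // => i _; rewrite mul0r.
- exists (fun i => c *: x i + y i); split=> [i|]; first exact: gdeg_sub.
  rewrite linearP Ex Ey scaler_sumr -big_split.
  by apply: eq_bigr => i _; rewrite /= mulrDl scalerAl.
- exists (fun=> 0); split=> [i|]; first exact: linear0.
  by rewrite comp1 big1 // => i _; rewrite mul0r.
exists (fun j => if j == i then comp d a else 0); split=> [j|].
  by case: eqP => _; [exact: gdeg_homog | exact: linear0].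
rewrite compXr (bigD1 i) //= eqxx big1 ?addr0 // => j /negPf ->.
by rewrite mul0r.
Qed.

Lemma gdeg0E : gdeg 0 = [set c%:A | c in setT].
Proof.
apply/seteqP; split=> [a /= <-|_ [c _ <-] /=].
  by have [c ->] := comp0_scalar a; exists c.
by rewrite /gdeg /= linearZ /= comp1.
Qed.

Lemma gdeg_connected : connected_grading gdeg.
Proof.
split.
- by move=> d; split=> [|c a b]; [exact: linear0 | exact: gdeg_sub].
- by move=> d e a b; exact: gdegM.
- exact: gdeg0E.
- move=> b; have [m /dlt_sum bE] := dlt_exists b.
  by exists m, (fun d => comp d b); split=> // d; exact: gdeg_homog.
move=> m a ha a0 i; have := congr1 (comp i) a0.
rewrite linear0 linear_sum (bigD1 i) //= big1 ?addr0 => [<-|j].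
  by rewrite ha.
by rewrite -val_eqE -(ha j) comp_comp eq_sym => /negPf ->.
Qed.

Lemma augmentation_idealE a :
  augmentation_ideal gdeg a <-> exists v : I -> R, a = \sum_i v i * X i.
Proof.
split=> [[m [b [hb ->]]]|[v ->]].
  have /choice[v vE] d : exists v : I -> R, forall e : 'I_m, e = d :> nat ->
      b e = \sum_i v i * X i.
    case: (ltnP d m) => [dm|md].
      have [v [_ vE]] := compSP d (b (Ordinal dm)); exists v => e ed.
      have -> : e = Ordinal dm by exact: val_inj.
      by rewrite -vE; exact/esym/(hb (Ordinal dm)).
    by exists (fun=> 0) => e ed; have := ltn_ord e; rewrite ed ltnNge md.
  exists (fun i => \sum_(d < m) v d i).
  under [RHS]eq_bigr => i _ do rewrite mulr_suml.
  by rewrite exchange_big; apply: eq_bigr => d _; exact: vE.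
have [m Em] := dlt_exists (\sum_i v i * X i).
exists m, (fun d => comp d.+1 (\sum_i v i * X i)).
split=> [d|]; first exact: gdeg_homog.
have : dlt m.+1 (\sum_i v i * X i) by exact: dlt_leq Em.
move=> /dlt_sum {1}->; rewrite big_ord_recl linear_sum big1 ?add0r //= => i _.
exact: compXr0.
Qed.

End Graded.

(** * Finite-dimensional subspaces *)

Section Dimension.
Local Open Scope classical_set_scope.
Variable k : fieldType.
Implicit Types V W : lmodType k.

Definition subsp V (S : set V) : Prop :=
  S 0 /\ forall (c : k) a b, S a -> S b -> S (c *: a + b).

Lemma subspD V (S : set V) a b : subsp S -> S a -> S b -> S (a + b).
Proof. by move=> [_ SD] Sa Sb; rewrite -[a]scale1r; exact: SD. Qed.

Lemma subspZ V (S : set V) c a : subsp S -> S a -> S (c *: a).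
Proof. by move=> [S0 SD] Sa; rewrite -[_ *: _]addr0; exact: SD. Qed.

Lemma subspB V (S : set V) a b : subsp S -> S a -> S b -> S (a - b).
Proof.
by move=> sS Sa Sb; rewrite -scaleN1r; apply: subspD => //; exact: subspZ.
Qed.

Lemma subsp_sum V (S : set V) (J : finType) (E : J -> V) :
  subsp S -> (forall j, S (E j)) -> S (\sum_j E j).
Proof.
move=> sS SE; elim/big_ind: _ => // [|a b]; first by case: sS.
exact: subspD.
Qed.

(** A basis becomes an injective linear map from row vectors, which makes the rank theory of
    matrices available. *)
Lemma has_dimP V (S : set V) d : has_dim S d <->
  exists2 phi : {linear 'rV[k]_d -> V}, injective phi &
    forall v, S v <-> exists x, v = phi x.
Proof.
split=> [[e [eS e0]]|[phi phi_inj phiS]].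
  pose h (x : 'rV[k]_d) := \sum_i x 0 i *: e i.
  have h_lin : linear h.
    move=> c x y; rewrite /h scaler_sumr -big_split; apply: eq_bigr => i _.
    by rewrite !mxE scalerDl scalerA.
  pose phi : {linear 'rV[k]_d -> V} :=
    HB.pack h (GRing.isLinear.Build _ _ _ _ h h_lin).
  exists phi => [x y /eqP|v].
    rewrite -subr_eq0 -linearB => /eqP /e0 xy; apply/rowP => i.
    by have /eqP := xy i; rewrite !mxE subr_eq0 => /eqP.
  rewrite eS; split=> [[c ->]|[x ->]]; last by exists (x 0).
  by exists (\row_i c i); apply: eq_bigr => i _; rewrite mxE.
have phiE x : phi x = \sum_i x 0 i *: phi (delta_mx 0 i).
  by rewrite {1}[x]row_sum_delta linear_sum; apply: eq_bigr => i _; rewrite linearZ.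
exists (fun i => phi (delta_mx 0 i)); split=> [v|c c0 i].
  rewrite phiS; split=> [[x ->]|[c ->]]; first by exists (x 0).
  exists (\row_i c i); rewrite phiE; apply: eq_bigr => i _; by rewrite mxE.
have : phi (\row_i c i) = phi 0.
  by rewrite linear0 -[RHS]c0 phiE; apply: eq_bigr => j _; rewrite mxE.
by move/phi_inj/rowP/(_ i); rewrite !mxE.
Qed.

Lemma has_dim_subsp V (S : set V) d : has_dim S d -> subsp S.
Proof.
move=> /has_dimP[phi _ SE]; split=> [|c a b /SE[x ->] /SE[y ->]]; apply/SE.
  by exists 0; rewrite linear0.
by exists (c *: x + y); rewrite linearP.
Qed.

(** A row-free matrix with rows in [T] and as many rows as possible spans [T], since any further
    vector of [T] could be added as a row. *)
Lemma rV_subsp d (T : set 'rV[k]_d) : subsp T ->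
  exists r (M : 'M[k]_(r, d)), row_free M /\ forall v, T v <-> (v <= M)%MS.
Proof.
move=> sT; have [T0 TD] := sT.
pose P r := `[< exists M : 'M[k]_(r, d), row_free M /\ forall i, T (row i M) >].
have P0 : exists r, P r.
  exists 0%N; apply/asboolP; exists 0; split=> [|[]//].
  by rewrite /row_free mxrank0.
have Pd r : P r -> (r <= d)%N.
  by move=> /asboolP[M [/eqP rM _]]; rewrite -rM; exact: rank_leq_col.
case: (ex_maxnP P0 Pd) => r /asboolP[M [Mfree TM]] r_max.
exists r, M; split=> // v; split=> [Tv|/submxP[u ->]]; last first.
  rewrite mulmx_sum_row; apply: subsp_sum => // i; exact: subspZ.
apply: contrapT => /negP vM; suff : P (1 + r)%N by move/r_max; rewrite add1n ltnn.
apply/asboolP; exists (col_mx v M); split=> [|i]; last first.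
  by case: (split_ordP i) => j ->; rewrite ?rowKu ?rowKd // row_id.
rewrite -row_leq_rank -addsmxE (leq_trans _ (_ : \rank M < _)%N) //.
  by rewrite (eqP Mfree) add1n.
rewrite ltn_neqAle mxrankS ?addsmxSr // andbT.
apply: contra vM => /eqP eqr.
have /andP[_ le] : (M == v + M)%MS.
  by rewrite -(geq_leqif (mxrank_leqif_eq (addsmxSr v M))) eqr.
exact: submx_trans (addsmxSl v M) le.
Qed.

Lemma rank_nullity V W (phi : {linear V -> W}) (S : set V) d : has_dim S d ->
  exists r s, [/\ has_dim [set v | S v /\ phi v = 0] r,
    has_dim (phi @` S) s & (r + s)%N = d].
Proof.
move=> /has_dimP[e e_inj eS].
have [|r [M [Mfree ME]]] := @rV_subsp d [set x | phi (e x) = 0].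
  split=> [|c a b /= a0 b0]; rewrite /= ?linear0 //.
  by rewrite !linearP /= a0 b0 scaler0 addr0.
have rd : (r <= d)%N by rewrite -(eqP Mfree); exact: rank_leq_col.
have rkC : \rank (M^C)%MS = (d - r)%N by rewrite mxrank_compl (eqP Mfree).
exists r, (d - r)%N; split; last exact: subnKC.
  apply/has_dimP; exists (e \o mulmxr M : {linear 'rV[k]_r -> V}) => [x y /=|v].
    by move=> /e_inj; exact: row_free_inj.
  split=> [[/eS[x ->]] /ME/submxP[u ->]|[x ->] /=]; first by exists u.
  by split; [apply/eS; eexists | apply/ME; exact: submxMl].
rewrite -rkC; pose N := row_base (M^C)%MS.
apply/has_dimP; exists (phi \o (e \o mulmxr N) : {linear 'rV[k]_(\rank (M^C)%MS) -> W}).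
  move=> x y /= /eqP; rewrite -subr_eq0 -!linearB /= -mulmxBl => /eqP /ME xyM.
  have xyC : ((x - y) *m N <= M^C)%MS.
    by apply: submx_trans (submxMl _ _) _; rewrite eq_row_base.
  have : ((x - y) *m N <= M :&: M^C)%MS by rewrite sub_capmx xyM.
  rewrite capmx_compl submx0 => /eqP xy0.
  apply/eqP; rewrite -subr_eq0; apply/eqP.
  by apply: (row_free_inj (row_base_free (M^C)%MS)); rewrite xy0 mul0mx.
move=> w; split=> [[v /eS[x ->] <-]|[x ->] /=]; last first.
  by exists (e (x *m N)) => //; apply/eS; eexists.
have /sub_addsmxP[[u1 u2] /= ->] : (x <= M + M^C)%MS.
  by apply: submx_full; exact: addsmx_compl_full.
have /submxP[y yE] : (u2 *m (M^C)%MS <= N)%MS.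
  by rewrite eq_row_base; exact: submxMl.
exists y; rewrite !linearD /= -yE (_ : phi (e (u1 *m M)) = 0) ?add0r //.
by apply/ME; exact: submxMl.
Qed.

Lemma has_dim_rV d : has_dim [set: 'rV[k]_d] d.
Proof.
by apply/has_dimP; exists idfun => // v; split=> // _; exists v.
Qed.

Lemma has_dim_sub V (S T : set V) d : has_dim S d -> subsp T -> T `<=` S ->
  exists e, has_dim T e.
Proof.
move=> /has_dimP[phi phi_inj SE] [T0 TD] TS.
have [|r [M [Mfree ME]]] := @rV_subsp d [set x | T (phi x)].
  by split=> [|c a b /= Ta Tb]; rewrite /= ?linear0 // linearP; exact: TD.
exists r; apply/has_dimP.
exists (phi \o mulmxr M : {linear 'rV[k]_r -> V}) => [x y /=|v].
  by move=> /phi_inj; exact: row_free_inj.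
split=> [Tv|[x ->] /=]; last by apply/ME; exact: submxMl.
have /SE[x vE] := TS _ Tv; rewrite vE in Tv *.
by have /ME/submxP[u ->] := Tv; exists u.
Qed.

Lemma has_dim_transfer V (S T : set V) d e : has_dim S d -> has_dim T e ->
  S `<=` T -> (d <= e)%N /\ (d = e -> T `<=` S).
Proof.
move=> /has_dimP[phi phi_inj SE] /has_dimP[psi psi_inj TE] ST.
have /choice[y yE] (i : 'I_d) : exists y, phi (delta_mx 0 i) = psi y.
  by apply/TE/ST/SE; eexists.
pose A := \matrix_i y i.
have AE x : phi x = psi (x *m A).
  rewrite {1}[x]row_sum_delta mulmx_sum_row !linear_sum; apply: eq_bigr => i _.
  by rewrite !linearZ /= yE rowK.
have Afree : row_free A.
  rewrite -kermx_eq0; apply/eqP/row_matrixP => i; rewrite row0.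
  by apply: phi_inj; rewrite AE -row_mul mulmx_ker row0 !linear0.
split=> [|de v /TE[u ->]]; first by rewrite -(eqP Afree); exact: rank_leq_col.
have /submxP[x ->] : (u <= A)%MS.
  by apply: submx_full; rewrite /row_full (eqP Afree) de.
by rewrite -AE; apply/SE; exists x.
Qed.

Lemma has_dim_leq V (S T : set V) d e : has_dim S d -> has_dim T e ->
  S `<=` T -> (d <= e)%N.
Proof. by move=> Sd Te /(has_dim_transfer Sd Te)[]. Qed.

Lemma has_dim_eq V (S T : set V) d : has_dim S d -> has_dim T d ->
  S `<=` T -> T `<=` S.
Proof. by move=> Sd Te /(has_dim_transfer Sd Te)[_]; apply. Qed.

Lemma has_dim_uniq V (S : set V) d e : has_dim S d -> has_dim S e -> d = e.
Proof.
by move=> Sd Se; apply/eqP; rewrite eqn_leq (has_dim_leq Sd Se) ?(has_dim_leq Se Sd).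
Qed.

Lemma dimkE V (S : set V) d : has_dim S d -> dimk S = d.
Proof.
move=> Sd; apply: (@has_dim_uniq _ S) => //.
exact: (@xgetPex _ 0%N [set d | has_dim S d] (ex_intro _ d Sd)).
Qed.

Lemma has_dim_kspan V (s : seq V) : exists d, has_dim (kspan s) d.
Proof.
pose h (x : 'rV[k]_(size s)) := \sum_i x 0 i *: s`_i.
have h_lin : linear h.
  move=> c x y; rewrite /h scaler_sumr -big_split; apply: eq_bigr => i _.
  by rewrite !mxE scalerDl scalerA.
pose phi : {linear 'rV[k]_(size s) -> V} :=
  HB.pack h (GRing.isLinear.Build _ _ _ _ h h_lin).
have [_ [d [_ hd _]]] := rank_nullity phi (has_dim_rV (size s)).
exists d; rewrite (_ : kspan s = phi @` setT) //.
apply/seteqP; split=> [_ [c ->]|_ [x _ <-]]; last by exists (x 0).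
by exists (\row_i c i) => //; apply: eq_bigr => i _; rewrite mxE.
Qed.

Lemma has_dim_image V W (phi : {linear V -> W}) (S : set V) d : has_dim S d ->
  (forall v, S v -> phi v = 0 -> v = 0) -> has_dim (phi @` S) d.
Proof.
move=> /has_dimP[e e_inj eS] phi0; apply/has_dimP.
exists (phi \o e : {linear 'rV[k]_d -> W}) => [x y /= /eqP|w].
  rewrite -subr_eq0 -!linearB => /eqP /phi0 xy; apply: e_inj.
  by apply/eqP; rewrite -subr_eq0 -linearB xy //; apply/eS; eexists.
split=> [[v /eS[x ->] <-]|[x ->]]; first by exists x.
by exists (e x) => //; apply/eS; exists x.
Qed.

(** Here the finite dimension of [S] is a conclusion, in contrast to [has_dim_image]. This is how
    [(V : A_1)] is seen to be finite-dimensional. *)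
Lemma has_dim_preimage V W (phi : {linear V -> W}) (S : set V) d :
  subsp S -> has_dim (phi @` S) d ->
  (forall v, S v -> phi v = 0 -> v = 0) -> has_dim S d.
Proof.
move=> sS [e [eS e0]] phi0.
have /choice[e' e'P] (i : 'I_d) : exists v, S v /\ phi v = e i.
  suff [v Sv vE] : (phi @` S) (e i) by exists v.
  apply/eS; exists (fun j => (j == i)%:R).
  rewrite (bigD1 i) //= eqxx scale1r big1 ?addr0 // => j /negPf ->.
  by rewrite scale0r.
have sum_phi (c : 'I_d -> k) : phi (\sum_i c i *: e' i) = \sum_i c i *: e i.
  by rewrite linear_sum; apply: eq_bigr => i _; rewrite linearZ /= (e'P i).2.
have Ssum (c : 'I_d -> k) : S (\sum_i c i *: e' i).
  by apply: subsp_sum => // i; apply: subspZ => //; case: (e'P i).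
exists e'; split=> [v|c c0]; last by apply: e0; rewrite -sum_phi c0 linear0.
split=> [Sv|[c ->] //].
have /eS[c cE] : (phi @` S) (phi v) by exists v.
exists c; apply/eqP; rewrite -subr_eq0; apply/eqP; apply: phi0.
  exact: subspB.
by rewrite linearB sum_phi cE subrr.
Qed.

Lemma has_dim_ffun V (S : set V) d n : has_dim S d ->
  has_dim [set a : {ffun 'I_n -> V} | forall i, S (a i)] (n * d).
Proof.
move=> /has_dimP[e e_inj eS].
pose h (x : 'rV[k]_(n * d)) := [ffun i => e (row i (vec_mx x))].
have h_lin : linear h.
  by move=> c x y; apply/ffunP => i; rewrite !ffunE !linearP.
pose phi : {linear 'rV[k]_(n * d) -> {ffun 'I_n -> V}} :=
  HB.pack h (GRing.isLinear.Build _ _ _ _ h h_lin).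
apply/has_dimP; exists phi => [x y /ffunP xy|a].
  apply: (can_inj vec_mxK); apply/row_matrixP => i; apply: e_inj.
  by have := xy i; rewrite !ffunE.
split=> [Sa|[x ->] i]; last by rewrite ffunE; apply/eS; eexists.
have /choice[x xE] i : exists x, a i = e x by exact/eS/Sa.
exists (mxvec (\matrix_i x i)); apply/ffunP => i.
by rewrite ffunE mxvecK rowK xE.
Qed.

Lemma has_dim_add V (S T : set V) d e : has_dim S d -> has_dim T e ->
  (forall v, S v -> T v -> v = 0) ->
  has_dim [set v | exists s t, [/\ S s, T t & v = s + t]] (d + e).
Proof.
move=> /has_dimP[phi phi_inj SE] /has_dimP[psi psi_inj TE] ST0.
pose h (x : 'rV[k]_(d + e)) := phi (lsubmx x) + psi (rsubmx x).
have h_lin : linear h.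
  by move=> c x y; rewrite /h !linearP /= scalerDr addrACA.
pose chi : {linear 'rV[k]_(d + e) -> V} :=
  HB.pack h (GRing.isLinear.Build _ _ _ _ h h_lin).
have h0 x : h x = 0 -> x = 0.
  move=> /eqP; rewrite addr_eq0 => /eqP xE.
  have p0 : phi (lsubmx x) = 0.
    apply: ST0; first by apply/SE; eexists.
    by rewrite xE -linearN; apply/TE; eexists.
  rewrite p0 in xE; move/esym/eqP: xE; rewrite oppr_eq0 => /eqP q0.
  have -> : x = row_mx (lsubmx x) (rsubmx x) by rewrite hsubmxK.
  have -> : rsubmx x = 0 by apply: psi_inj; rewrite q0 linear0.
  have -> : lsubmx x = 0 by apply: phi_inj; rewrite p0 linear0.
  exact: row_mx0.
apply/has_dimP; exists chi => [x y /eqP|v].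
  by rewrite -subr_eq0 -linearB => /eqP/h0/eqP; rewrite subr_eq0 => /eqP.
split=> [[s [t [/SE[x ->] /TE[y ->] ->]]]|[x ->]].
  by exists (row_mx x y); rewrite /= /h row_mxKl row_mxKr.
by exists (phi (lsubmx x)), (psi (rsubmx x)); split; rewrite ?SE ?TE //; eexists.
Qed.

Lemma has_dim0 V : has_dim [set (0 : V)] 0.
Proof.
exists (fun=> 0); split=> [v|c _ []//].
by split=> [->|[c ->]]; [exists (fun=> 0)|]; rewrite /= big_ord0.
Qed.

Lemma has_dim0_eq0 V (S : set V) v : has_dim S 0 -> S v -> v = 0.
Proof. by move=> [e [eS _]] /eS[c ->]; rewrite big_ord0. Qed.

Lemma has_dim_gt0 V (S : set V) d v : has_dim S d -> S v -> v != 0 -> (0 < d)%N.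
Proof.
case: d => // S0 Sv; rewrite (has_dim0_eq0 S0 Sv) eqxx; by [].
Qed.

End Dimension.

Lemma graded_top (k : fieldType) (I : finType) (R : algType k) (X : I -> R)
    (comp : nat -> {linear R -> R}) : graded_gen X comp ->
  forall a, a != 0 -> exists p, dlt comp p.+1 a /\ comp p a != 0.
Proof.
move=> gg a a0; have [m ma] := dlt_exists gg a.
elim: m ma => [/(dlt0_eq0 gg)|m IH ma]; first by move/eqP; rewrite (negPf a0).
have [am|] := eqVneq (comp m a) 0; last by exists m.
apply: IH => d; rewrite leq_eqVlt => /predU1P[<-//|]; exact: ma.
Qed.

(* The Taylor coefficients of 1 / (1 - n t + t^2); the truncated subtraction is
   never truncating for n >= 2. *)
Fixpoint hilbA (n d : nat) : nat :=
  if d is d1.+1 then if d1 is d2.+1 then n * hilbA n d1 - hilbA n d2 else n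
  else 1.

(** * The recurrence for the Hilbert function of A *)

Section HilbertFunction.
Local Open Scope classical_set_scope.
Variable n : nat.
Hypothesis n_ge2 : (2 <= n)%N.

Lemma hilbA_SS d : hilbA n d.+2 = (n * hilbA n d.+1 - hilbA n d)%N.
Proof. by []. Qed.

Lemma hilbA_leqS d : (hilbA n d <= hilbA n d.+1)%N.
Proof.
elim: d => [|d IH]; first exact: ltnW.
rewrite hilbA_SS -(leq_add2r (hilbA n d)) subnK.
  by rewrite (leq_trans (_ : _ <= 2 * hilbA n d.+1)%N) ?leq_mul2r ?n_ge2 ?orbT //
     mul2n -addnn leq_add2l.
by rewrite (leq_trans IH) // leq_pmull // ltnW.
Qed.

Lemma hilbA_growth d : ((n - 1) * hilbA n d <= hilbA n d.+1)%N.
Proof.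
case: d => [|d]; first by rewrite muln1 leq_subr.
by rewrite hilbA_SS mulnBl mul1n leq_sub2l // hilbA_leqS.
Qed.

Lemma hilbA_add d : (hilbA n d.+2 + hilbA n d = n * hilbA n d.+1)%N.
Proof.
rewrite hilbA_SS subnK // (leq_trans (hilbA_leqS d)) //.
by rewrite leq_pmull // ltnW.
Qed.

Lemma hilbA_homo i j : (i <= j)%N -> (hilbA n i <= hilbA n j)%N.
Proof.
by apply: (@homo_leq _ (hilbA n) leq) => // [? ? ?|]; [exact: leq_trans|exact: hilbA_leqS].
Qed.

(* Discrete Sturm comparison: v_0 >= h_s v_s - h_(s-1) v_(s+1) for all s. *)
Lemma hilbA_convex (v : nat -> nat) m j :
  (forall s, n * v s.+1 <= v s + v s.+2)%N ->
  (forall s, m <= s -> v s = 0)%N -> (0 < v j)%N -> (hilbA n j <= v 0)%N.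
Proof.
move=> vconv v0 vj.
have sturm s : (hilbA n s * v s <=
    v 0 + (if s is s'.+1 then hilbA n s' else 0) * v s.+1)%N.
  elim: s => [|s IH]; first by rewrite mul1n mul0n addn0.
  set h' := (if s is s'.+1 then hilbA n s' else 0)%N in IH.
  have hE : (hilbA n s.+1 + h' = n * hilbA n s)%N.
    by rewrite /h'; case: (s) => [|s']; rewrite ?addn0 ?muln1 // hilbA_add.
  (* Adding [h' v_(s+1)] turns the left side into [n h_s v_(s+1)], to which convexity applies; no
     subtraction is left. *)
  rewrite -(leq_add2r (h' * v s.+1)) -mulnDl hE -mulnA mulnCA.
  rewrite (leq_trans (leq_mul (leqnn _) (vconv s))) // mulnDr addnAC.
  by rewrite leq_add2r.
(* At the last [s >= j] with [v s > 0] the correction term of [sturm] is 0, and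
   [h_j <= h_s <= h_s v_s <= v_0]. *)
pose P s := (j <= s)%N && (0 < v s)%N.
have Pj : exists s, P s by exists j; rewrite /P leqnn.
have Pm s : P s -> (s <= m)%N.
  by case/andP=> _; case: (ltnP m s) => // /ltnW/v0 ->.
case: (ex_maxnP Pj Pm) => s /andP[js vs] s_max.
have vs1 : v s.+1 = 0%N.
  apply/eqP; rewrite -leqn0 leqNgt; apply/negP => vs1.
  by have := s_max s.+1; rewrite /P vs1 leqW // ltnn => /(_ isT).
rewrite (leq_trans (hilbA_homo js)) // (leq_trans (leq_pmulr _ vs)) //.
by rewrite (leq_trans (sturm s)) // vs1 muln0 addn0.
Qed.

End HilbertFunction.

(** * The quadratic algebra A: regular linear forms, Hilbert function, domain property *)

Section QuadraticAlgebra.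
Local Open Scope classical_set_scope.
Variables (k : fieldType) (n : nat) (f : 'M[k]_n).
Variables (A : algType k) (x : 'I_n -> A) (comp : nat -> {linear A -> A}).
Hypotheses (n_ge2 : (2 <= n)%N) (f_unit : f \in unitmx).
Hypothesis gg : graded_gen x comp.

Definition lform (c : 'rV[k]_n) : A := \sum_i c 0 i *: x i.

(* The linear forms l_i such that sum_i l_i x_i is the relation. *)
Definition lrow (i : 'I_n) : A := lform (row i f^T).

Hypothesis lrow_x : \sum_i lrow i * x i = 0.
Hypothesis syz : forall a : 'I_n -> A, \sum_i a i * x i = 0 ->
  exists u, forall i, a i = u * lrow i.

Lemma lform_linear : linear lform.
Proof.
move=> c u v; rewrite /lform scaler_sumr -big_split; apply: eq_bigr => i _.
by rewrite !mxE scalerDl scalerA.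
Qed.

HB.instance Definition _ :=
  GRing.isLinear.Build k 'rV[k]_n A *:%R lform lform_linear.

Lemma lform_delta i : lform (delta_mx 0 i) = x i.
Proof.
rewrite /lform (bigD1 i) //= mxE !eqxx scale1r big1 ?addr0 // => j /negPf ne.
by rewrite mxE ne andbF scale0r.
Qed.

Lemma lform_mulT (c : 'rV[k]_n) : lform (c *m f^T) = \sum_i c 0 i *: lrow i.
Proof.
by rewrite mulmx_sum_row linear_sum; apply: eq_bigr => i _; rewrite linearZ.
Qed.

Lemma lform_lrow c : exists d : 'I_n -> k, lform c = \sum_i d i *: lrow i.
Proof.
exists ((c *m invmx f^T) 0); rewrite -lform_mulT mulmxKV // unitmx_tr.
exact: f_unit.
Qed.

Lemma compSl d a c : comp d.+1 (a * lform c) = comp d a * lform c.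
Proof.
rewrite !mulr_sumr linear_sum; apply: eq_bigr => i _.
by rewrite -!scalerAr linearZ /= (compXr gg).
Qed.

Lemma trunc_lform m a c :
  trunc comp m.+1 (a * lform c) = trunc comp m a * lform c.
Proof.
rewrite /trunc big_ord_recl mulr_suml [X in X + _](_ : _ = 0) ?add0r.
  by apply: eq_bigr => d _; rewrite compSl.
rewrite mulr_sumr linear_sum big1 // => i _.
by rewrite -scalerAr linearZ /= (compXr0 gg) scaler0.
Qed.

(* If w l = 0, with l = sum_i c_i x_i, then c_i w = u l_i for some u.  A nonzero
   vector a orthogonal to c gives u (sum_i a_i l_i) = 0, and u has lower degree
   than w. *)
Lemma lform_rreg c w : c != 0 -> w * lform c = 0 -> w = 0.
Proof.
have [m wm] := dlt_exists gg w; elim: m c w wm => [|m IH] c w wm c0 w0.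
  exact: (dlt0_eq0 gg wm).
have [p cp] : exists p, c 0 p != 0.
  apply: contrapT => /forallNP cz; case/negP: c0; apply/eqP/rowP => i.
  by rewrite mxE; apply/eqP; move/negP: (cz i); rewrite negbK.
have [q pq] : exists q : 'I_n, q != p.
  have n0 : (0 < n)%N by exact: ltnW.
  case: (eqVneq (Ordinal n0) p) => [<-|]; last by exists (Ordinal n0).
  by exists (Ordinal n_ge2).
have [u uE] : exists u, forall i, c 0 i *: w = u * lrow i.
  by apply: syz; rewrite -[RHS]w0 mulr_sumr; apply: eq_bigr => i _;
     rewrite -scalerAl -scalerAr.
(* This is where the degree drops: [c_i w] has degree at most [m] and [lrow i] is linear, so only
   the part of [u] of degree less than [m] contributes. *)
have {uE}uE i : c 0 i *: w = trunc comp m u * lrow i.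
  rewrite -trunc_lform -uE linearZ /= (trunc_id gg) //.
pose a : 'rV[k]_n := c 0 q *: delta_mx 0 p - c 0 p *: delta_mx 0 q.
have a0 : a *m f^T != 0.
  apply/eqP => /(congr1 (mulmx^~ (invmx f^T))).
  rewrite mulmxK ?unitmx_tr // mul0mx => /rowP/(_ q)/eqP.
  rewrite !mxE eqxx (negPf pq) mulr0 eqxx mulr1 sub0r oppr_eq0.
  by rewrite (negPf cp).
have u0 : trunc comp m u = 0.
  apply: (IH (a *m f^T)) => //; first exact: (dlt_trunc gg).
  rewrite lform_mulT mulr_sumr.
  under eq_bigr => i _ do rewrite -scalerAr -uE scalerA.
  rewrite -scaler_suml (_ : \sum_i _ = 0) ?scale0r //.
  under eq_bigr => i _ do rewrite !mxE eqxx /= mulrBl.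
  rewrite sumrB (bigD1 p) //= eqxx mulr1 [X in _ + X - _]big1 ?addr0.
    rewrite (bigD1 q) //= eqxx mulr1 [X in _ - (_ + X)]big1 ?addr0.
      by rewrite mulrC subrr.
    by move=> i /negPf ->; rewrite mulr0 mul0r.
  by move=> i /negPf ->; rewrite mulr0 mul0r.
have := uE p; rewrite u0 mul0r => /eqP.
by rewrite scaler_eq0 (negPf cp) => /eqP.
Qed.

Lemma x_rreg i w : w * x i = 0 -> w = 0.
Proof.
rewrite -lform_delta; apply: lform_rreg; apply/eqP => /rowP/(_ i)/eqP.
by rewrite !mxE !eqxx oner_eq0.
Qed.

Lemma lform_eq0 c : lform c = 0 -> c = 0.
Proof.
move=> c0; apply/eqP/negPn/negP => cn0.
have := @lform_rreg c 1 cn0; rewrite mul1r => /(_ c0)/eqP.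
by rewrite oner_eq0.
Qed.

Lemma lrow_rreg i w : w * lrow i = 0 -> w = 0.
Proof.
apply: lform_rreg; apply/eqP => /(congr1 (mulmx^~ (invmx f^T))).
rewrite -row_mul mulmxV ?unitmx_tr // mul0mx => /rowP/(_ i)/eqP.
by rewrite !mxE eqxx oner_eq0.
Qed.

Definition colon (V : set A) : set A := [set u | forall i, V (u * x i)].

Definition mulX (V : set A) : set A :=
  [set b | exists2 a : 'I_n -> A, forall i, V (a i) & b = \sum_i a i * x i].

Lemma colon_subsp V : subsp V -> subsp (colon V).
Proof.
move=> [V0 VD]; split=> [i|c a b Va Vb i]; first by rewrite mul0r.
by rewrite mulrDl -scalerAl; exact: VD.
Qed.

(* 0 -> (V : A_1) -> V^n -> V A_1 -> 0 is exact. *)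
Lemma colon_mulX V v : has_dim V v -> exists u w,
  [/\ has_dim (colon V) u, has_dim (mulX V) w & (u + w = n * v)%N].
Proof.
move=> Vv; have sV := has_dim_subsp Vv.
have h_lin : linear (fun a : {ffun 'I_n -> A} => \sum_i a i * x i).
  move=> c a b; rewrite scaler_sumr -big_split; apply: eq_bigr => i _.
  by rewrite !ffunE mulrDl scalerAl.
pose h : {linear {ffun 'I_n -> A} -> A} := HB.pack
  (fun a : {ffun 'I_n -> A} => \sum_i a i * x i) (GRing.isLinear.Build _ _ _ _ _ h_lin).
have g_lin : linear (fun u : A => [ffun i => u * lrow i]).
  by move=> c a b; apply/ffunP => i; rewrite !ffunE mulrDl scalerAl.
pose g : {linear A -> {ffun 'I_n -> A}} := HB.pack
  (fun u : A => [ffun i => u * lrow i]) (GRing.isLinear.Build _ _ _ _ _ g_lin).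
have [u [w [kerd imd uw]]] := rank_nullity h (has_dim_ffun n Vv).
exists u, w; split=> //; last first.
  rewrite (_ : mulX V = h @` [set a : {ffun 'I_n -> A} | forall i, V (a i)]) //.
  apply/seteqP; split=> [_ [a Va ->]|_ [a Va <-]]; last by exists a.
  exists (finfun a : {ffun 'I_n -> A}) => [i|]; first by rewrite ffunE.
  by apply: eq_bigr => i _; rewrite ffunE.
(* The map [u |-> (u l_i)_i] identifies the colon with the kernel of [h]. It lands in [V^n] because
   the [l_i] are combinations of the [x_i]; that it hits the whole kernel uses that, [f] being
   invertible, the [x_i] are combinations of the [l_i]. *)
apply: (@has_dim_preimage _ _ _ g); first exact: colon_subsp.
  rewrite (_ : g @` colon V = [set a : {ffun 'I_n -> A} | (forall i, V (a i)) /\ h a = 0]) //.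
  apply/seteqP; split=> [_ [b Vb <-]|a [Va /= a0]].
    split=> [i|] /=.
      rewrite ffunE mulr_sumr; apply: subsp_sum => // j.
      by rewrite -scalerAr; apply: subspZ => //; exact: Vb.
    under eq_bigr => i _ do rewrite ffunE -mulrA.
    by rewrite -mulr_sumr lrow_x mulr0.
  have [b bE] := syz a0; exists b; last by apply/ffunP => i; rewrite ffunE bE.
  move=> i; have [c cE] := lform_lrow (delta_mx 0 i).
  rewrite -lform_delta cE mulr_sumr; apply: subsp_sum => // j.
  by rewrite -scalerAr -bE; exact: subspZ.
move=> b _ /= /ffunP b0; have n0 : (0 < n)%N by exact: ltnW.
by have := b0 (Ordinal n0); rewrite !ffunE => /lrow_rreg.
Qed.

Lemma colon_gdegS d : colon (gdeg comp d.+1) = gdeg comp d.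
Proof.
apply/seteqP; split=> [u /= ux|u /= ux i]; last first.
  by rewrite /gdeg /= (compXr gg) ux.
have n0 : (0 < n)%N by exact: ltnW.
apply/eqP; rewrite -subr_eq0; apply/eqP/(@x_rreg (Ordinal n0)).
by rewrite mulrBl -(compXr gg) ux subrr.
Qed.

Lemma colon_gdeg0 : colon (gdeg comp 0) = [set 0].
Proof.
apply/seteqP; split=> [u /= ux|_ -> i]; last by rewrite mul0r /gdeg /= linear0.
have n0 : (0 < n)%N by exact: ltnW.
by apply: (@x_rreg (Ordinal n0)); rewrite -ux (compXr0 gg).
Qed.

Lemma mulX_gdeg d : mulX (gdeg comp d) = gdeg comp d.+1.
Proof.
apply/seteqP; split=> [_ [a ha ->]|a ha].
  rewrite /gdeg /= linear_sum; apply: eq_bigr => i _.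
  by rewrite (compXr gg) ha.
by have [b [hb bE]] := compSP gg d a; exists b => //; rewrite -bE ha.
Qed.

(** For [V = A_d] the colon is [A_(d-1)] and [V A_1] is [A_(d+1)], so the exact sequence becomes the
    recurrence of [hilbA]. *)
Lemma has_dim_gdegA d : has_dim (gdeg comp d) (hilbA n d).
Proof.
have H0 : has_dim (gdeg comp 0) 1.
  exists (fun=> 1); split=> [v|c]; rewrite ?big_ord1.
    rewrite (gdeg0E gg); split=> [[c _ <-]|[c ->]].
      by exists (fun=> c); rewrite big_ord1.
    by exists (c ord0); rewrite ?big_ord1.
  by move/eqP; rewrite scaler_eq0 oner_eq0 orbF => /eqP c0 i; rewrite ord1.
suff [] : has_dim (gdeg comp d) (hilbA n d) /\
  has_dim (gdeg comp d.+1) (hilbA n d.+1) by [].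
elim: d => [|d [IH0 IH1]]; split=> //.
  have [u [w []]] := colon_mulX H0; rewrite colon_gdeg0 mulX_gdeg => u0 w1.
  by rewrite (has_dim_uniq u0 (has_dim0 _)) muln1 add0n => <-.
have [u [w []]] := colon_mulX IH1; rewrite colon_gdegS mulX_gdeg => u0 w1.
by rewrite (has_dim_uniq u0 IH0) hilbA_SS => <-; rewrite addKn.
Qed.

Lemma colon_dlt V m : V `<=` dlt comp m -> colon V `<=` dlt comp m.-1.
Proof.
move=> Vm u Vu d md; have n0 : (0 < n)%N by exact: ltnW.
apply: (@x_rreg (Ordinal n0)); rewrite -(compXr gg).
by apply: (Vm _ (Vu _)); case: (m) md.
Qed.

(* With v_s = dim {u | u A_s <= V}, the exact sequence above gives
   n v_(s+1) <= v_s + v_(s+2). *)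
Lemma dim_ge_hilbA V v a j : has_dim V v -> a != 0 ->
  (forall b, gdeg comp j b -> V (a * b)) -> (hilbA n j <= v)%N.
Proof.
(* [C s] consists of the [u] with [u A_s <= V]. Its dimension vanishes for [s >= m] for degree
   reasons and is positive at [s = j] because [C j] contains [a]. *)
move=> Vv a0 aV; pose C s := iter s colon V.
have /choice[d dP] s : exists d, has_dim (C s) d.
  elim: s => [|s [e IH]]; first by exists v.
  by have [u [_ [Cu _ _]]] := colon_mulX IH; exists u.
have [m Vm] : exists m, V `<=` dlt comp m.
  have [e [eV _]] := Vv; have /choice[m mE] i := dlt_exists gg (e i).
  exists (\max_i m i) => b /eV[c ->]; apply: dlt_sumr => i; apply: dltZ.
  by apply: dlt_leq (mE i); exact: leq_bigmax.
have Cm s : C s `<=` dlt comp (m - s).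
  elim: s => [|s IH]; first by rewrite subn0.
  by rewrite subnS; exact: colon_dlt.
have -> : v = d 0%N by apply: has_dim_uniq Vv _; exact: (dP 0%N).
apply: (@hilbA_convex n n_ge2 d m j) => [s|s ms|].
- have [u [w [Cu Cw <-]]] := colon_mulX (dP s.+1).
  rewrite (has_dim_uniq Cu (dP s.+2)) addnC leq_add2r.
  apply: (has_dim_leq Cw (dP s)) => _ [b Cb ->].
  by apply: subsp_sum => [|i]; [exact: has_dim_subsp (dP s) | exact: Cb].
- apply: has_dim_uniq (dP s) _.
  rewrite (_ : C s = [set 0]); first exact: has_dim0.
  apply/seteqP; split=> [b /Cm|_ ->].
    by move: ms; rewrite -subn_eq0 => /eqP -> /(dlt0_eq0 gg).
  by case: (has_dim_subsp (dP s)).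
have aC s : (s <= j)%N -> forall b, gdeg comp (j - s) b -> C s (a * b).
  elim: s => [_|s IH sj b hb i]; first by rewrite subn0.
  rewrite -mulrA; apply: IH; first exact: ltnW.
  have := gdegM gg hb (gdegX gg i); rewrite addn1 -subSn ?subSS //.
apply: (has_dim_gt0 (dP j)) a0; rewrite -[a]mulr1; apply: aC => //.
by rewrite subnn /gdeg /= (comp1 gg).
Qed.

Lemma domain_homog (a b : A) j : a != 0 -> gdeg comp j b -> a * b = 0 -> b = 0.
Proof.
move=> a0 hb ab0.
have h_lin : linear (fun u : A => a * u) by move=> c u v; rewrite mulrDr -scalerAr.
pose h : {linear A -> A} := HB.pack (fun u : A => a * u) (GRing.isLinear.Build _ _ _ _ _ h_lin).
have [r [s [kerd imd]]] := rank_nullity h (has_dim_gdegA j).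
have js : (hilbA n j <= s)%N.
  by apply: (dim_ge_hilbA imd a0) => c hc; exists c.
move/eqP; rewrite -{1}[s]add0n => /eqP rs.
have r0 : r = 0%N by apply/eqP; rewrite -leqn0 -(leq_add2r s) add0n rs.
by apply: (has_dim0_eq0 (S := [set c | gdeg comp j c /\ h c = 0])) => //; rewrite -r0.
Qed.

Lemma quad_domain (a b : A) : a * b = 0 -> a = 0 \/ b = 0.
Proof.
move=> ab0; case: (eqVneq a 0) => [|a0]; first by left.
case: (eqVneq b 0) => [|b0]; first by right.
have [p [pa ap]] := graded_top gg a0; have [q [qb bq]] := graded_top gg b0.
have := compM_top gg pa qb; rewrite ab0 linear0 => /esym/(domain_homog ap).
by move=> /(_ q (gdeg_homog gg _ _)) /eqP; rewrite (negPf bq).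
Qed.

(** The syzygy with entries [a], [b] and 0 elsewhere is [u] times the [l_i]. Its entry at the third
    index [i2] is 0, and [l_i2] is regular, so [u = 0]. Hence the need for [n >= 3]. *)
Lemma x0x1_independent (i0 i1 i2 : 'I_n) (a b : A) : i0 != i1 -> i0 != i2 -> i1 != i2 ->
  a * x i0 + b * x i1 = 0 -> a = 0 /\ b = 0.
Proof.
move=> n01 n02 n12 ab0.
pose c i := if i == i0 then a else if i == i1 then b else 0.
have [|u uE] := @syz c.
  rewrite (bigD1 i0) //= (bigD1 i1) 1?eq_sym //= big1 ?addr0.
    by rewrite /c !eqxx eq_sym (negPf n01).
  by move=> i /andP[/negPf i0' /negPf i1']; rewrite /c i0' i1' mul0r.
have /lrow_rreg u0 : u * lrow i2 = 0.
  by rewrite -uE /c ![i2 == _]eq_sym (negPf n02) (negPf n12).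
have := uE i0; have := uE i1.
by rewrite u0 !mul0r /c !eqxx eq_sym (negPf n01) => -> ->.
Qed.

End QuadraticAlgebra.

(** * Right ideals, and noetherianity of A for n = 2 *)

Section RightIdeals.
Local Open Scope classical_set_scope.
Variable R : nzRingType.
Implicit Types J K : set R.

(** Generation is expressed by minimality among right ideals, so that no families of coefficients
    have to be carried through the proofs. *)
Definition fg_right J := exists2 s : seq R, forall a, a \in s -> J a &
  forall K, right_ideal K -> (forall a, a \in s -> K a) -> J `<=` K.

Lemma right_ideal_sum J (I : finType) (E : I -> R) : right_ideal J ->
  (forall i, J (E i)) -> J (\sum_i E i).
Proof.
by move=> [J0 JD _] JE; elim/big_ind: _ => // a b; exact: JD.
Qed.

Lemma right_idealB J a b : right_ideal J -> J a -> J b -> J (a - b).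
Proof. by move=> [_ JD JM] Ja Jb; rewrite -mulrN1; apply/JD/JM. Qed.

Lemma right_noetherianP :
  (forall J, right_ideal J -> fg_right J) <-> right_noetherian R.
Proof.
split=> [fg J rJ|rn J rJ].
  have [s sJ Js] := fg J rJ; exists s => a; split=> [|[c ->]]; last first.
    apply: right_ideal_sum => // i; case: rJ => _ _; apply; apply: sJ.
    exact: mem_nth.
  apply: (Js [set a | exists c : 'I_(size s) -> R, a = \sum_(i < size s) s`_i * c i])
    => [|b bs].
    split.
    - by exists (fun=> 0); rewrite big1 // => i _; rewrite mulr0.
    - move=> _ _ [c ->] [d ->]; exists (fun i => c i + d i).
      by rewrite -big_split; apply: eq_bigr => i _; rewrite mulrDr.
    - move=> u _ [c ->]; exists (fun i => c i * u).
      by rewrite mulr_suml; apply: eq_bigr => i _; rewrite mulrA.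
  have bi : (index b s < size s)%N by rewrite index_mem.
  exists (fun i => (i == Ordinal bi)%:R).
  rewrite (bigD1 (Ordinal bi)) //= eqxx mulr1 nth_index // big1 ?addr0 //.
  by move=> i /negPf ->; rewrite mulr0.
have [s sE] := rn J rJ; exists s => [a /(nthP 0)[i ilt <-]|K rK sK a].
  apply/sE; exists (fun j => (j == Ordinal ilt)%:R).
  rewrite (bigD1 (Ordinal ilt)) //= eqxx mulr1 big1 ?addr0 //.
  by move=> j /negPf ->; rewrite mulr0.
move=> /sE[c ->]; apply: right_ideal_sum => // i.
by case: rK => _ _; apply; apply: sK; exact: mem_nth.
Qed.

End RightIdeals.

Section QuadraticNoetherian.
Local Open Scope classical_set_scope.
Variables (k : fieldType) (n : nat) (f : 'M[k]_n).
Variables (A : algType k) (x : 'I_n -> A) (comp : nat -> {linear A -> A}).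
Hypotheses (n_ge2 : (2 <= n)%N) (f_unit : f \in unitmx).
Hypothesis gg : graded_gen x comp.
Hypothesis lrow_x : \sum_i lrow f x i * x i = 0.
Hypothesis syz : forall a : 'I_n -> A, \sum_i a i * x i = 0 ->
  exists u, forall i, a i = u * lrow f x i.

Let colon_mulX := colon_mulX n_ge2 f_unit gg lrow_x syz.

(** Let [C] be the colon of [V], of dimension [u > 0], and [u2] the dimension of its own colon. By
    induction on the degree bound [u2 < u]; as [C A_1 <= V], the exact sequence for [C] gives
    [v >= n u - u2 >= 2 u - u2 > u]. *)
Lemma colon_lt m V v u : V `<=` dlt comp m -> has_dim V v ->
  has_dim (colon x V) u -> (0 < v)%N -> (u < v)%N.
Proof.
elim: m V v u => [|m IH] V v u Vm Vv Cu v0.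
  have V0 : V = [set 0].
    apply/seteqP; split=> [b /Vm/(dlt0_eq0 gg)//|_ ->].
    by case: (has_dim_subsp Vv).
  by rewrite V0 in Vv; rewrite (has_dim_uniq Vv (has_dim0 _)) in v0.
case: (posnP u) => [-> //|u0].
have Cm : colon x V `<=` dlt comp m by have := colon_dlt n_ge2 f_unit gg syz Vm.
have [u2 [w [CCu Mw u2w]]] := colon_mulX Cu.
have u2u := IH _ _ _ Cm Cu CCu u0.
have wv : (w <= v)%N.
  apply: (has_dim_leq Mw Vv) => _ [b Cb ->].
  by apply: subsp_sum => [|i]; [exact: has_dim_subsp Vv | exact: Cb].
rewrite (leq_trans _ wv) // -(ltn_add2l u2) u2w.
rewrite (@leq_trans (2 * u)) ?leq_mul2r ?n_ge2 ?orbT //.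
by rewrite mul2n -addnn -addSn leq_add2r.
Qed.

(* The degree m part of the ideal of leading forms of J. *)
Definition lead (J : set A) m : set A :=
  [set a | gdeg comp m a /\ exists2 b, J b & dlt comp m (b - a)].

Lemma leadP (J : set A) b m : J b -> dlt comp m.+1 b -> lead J m (comp m b).
Proof.
move=> Jb bm; split; first exact: (gdeg_homog gg).
by exists b => //; exact: (dlt_sub_comp gg).
Qed.

Lemma right_ideal_subsp (J : set A) : right_ideal J -> subsp J.
Proof.
move=> [J0 JD JM]; split=> // c a b Ja Jb; apply: JD => //.
by rewrite -[a]mulr1 scalerAr; exact: JM.
Qed.

Lemma lead_subsp (J : set A) m : right_ideal J -> subsp (lead J m).
Proof.
move=> rJ; have [J0 JD JM] := rJ; split.
  by split; [rewrite /gdeg /= linear0 | exists 0; rewrite // subrr; exact: dlt0].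
move=> c a b [ha [a' Ja' da]] [hb [b' Jb' db]]; split; first exact: gdeg_sub.
exists (c *: a' + b'); first by case: (right_ideal_subsp rJ) => _; apply.
by rewrite opprD addrACA -scalerBr; exact: dltP.
Qed.

Lemma mulX_lead (J : set A) m : right_ideal J ->
  mulX x (lead J m) `<=` lead J m.+1.
Proof.
move=> rJ _ [a la ->]; have [J0 JD JM] := rJ.
apply: subsp_sum => [|i]; first exact: lead_subsp.
have [ha [b Jb db]] := la i; split; first by rewrite /gdeg /= (compXr gg) ha.
exists (b * x i); first exact: JM.
by rewrite -mulrBl => -[//|d] md; rewrite (compXr gg) db // mul0r.
Qed.

(* Since dim (V A_1) > dim V for 0 <> V <= A_m and dim A_m = m + 1, the
   codimension of the leading forms of J in A_m is eventually constant, and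
   then they are generated in lower degree. *)
Lemma quad_right_noetherian : n = 2%N -> right_noetherian A.
Proof.
move=> n2; apply/right_noetherianP => J rJ.
have hA m : hilbA 2 m = m.+1.
  suff [] : hilbA 2 m = m.+1 /\ hilbA 2 m.+1 = m.+2 by [].
  elim: m => [//|m [E1 E2]]; split=> //.
  by rewrite hilbA_SS E1 E2 mul2n -addnn addSnnS addKn.
have /choice[l lP] m : exists l, has_dim (lead J m) l.
  apply: (has_dim_sub (has_dim_gdegA n_ge2 f_unit gg lrow_x syz m)) => [|a []//].
  exact: lead_subsp.
have lm m : (l m <= m.+1)%N.
  rewrite -hA -n2.
  by apply: (has_dim_leq (lP m) (has_dim_gdegA n_ge2 f_unit gg lrow_x syz m)) => a [].
case: (pselect (exists b, J b /\ b != 0)) => [[b [Jb b0]]|Jz]; last first.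
  exists [::] => // K [K0 _ _] _ a Ja.
  suff -> : a = 0 by [].
  by apply/eqP/negPn/negP => a0; apply: Jz; exists a.
have [p [bp pb]] := graded_top gg b0.
(* For [n = 2] the exact sequence reads [u + w = 2 l m]; since [u < l m], multiplying the leading
   forms by [A_1] strictly increases their dimension. *)
have lS m : (0 < l m)%N -> exists w, [/\ has_dim (mulX x (lead J m)) w,
    (l m < w)%N & (w <= l m.+1)%N].
  move=> l0; have [u [w [Cu Mw uw]]] := colon_mulX (lP m).
  exists w; split=> //; last exact: (has_dim_leq Mw (lP m.+1) (mulX_lead rJ)).
  have ul : (u < l m)%N.
    apply: (colon_lt _ (lP m) Cu l0 (m := m.+1)) => a [ha _].
    exact: (gdeg_dlt gg ha).
  by move: uw; rewrite n2 mul2n -addnn -(ltn_add2l u) => ->; rewrite ltn_add2r.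
have lp m : (p <= m)%N -> (0 < l m)%N.
  move=> pm; rewrite -(subnKC pm); elim: (m - p)%N => [|d IH].
    rewrite addn0; apply: (has_dim_gt0 (lP p)) pb; exact: leadP.
  by have [w [_ lw wl]] := lS _ IH; rewrite addnS (leq_trans _ wl) // (leq_trans _ lw).
(* These are the codimensions of the leading forms in [A_m]. They do not increase, so they are
   constant from the place [m0] where the least one occurs. *)
pose P c := `[< exists2 m, (p <= m)%N & c = (m.+1 - l m)%N >].
have P0 : exists c, P c by exists (p.+1 - l p)%N; apply/asboolP; exists p.
case: (ex_minnP P0) => c /asboolP[m0 pm0 cE] c_min.
have const m : (m0 <= m)%N -> (m.+1 - l m)%N = c.
  move=> mm; rewrite -(subnKC mm); elim: (m - m0)%N => [|d IH]; first by rewrite addn0 cE.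
  apply/eqP; rewrite eqn_leq addnS c_min ?andbT; last first.
    by apply/asboolP; exists (m0 + d).+1; rewrite // ltnW // ltnS (leq_trans pm0) ?leq_addr.
  have [|w [_ lw wl]] := lS (m0 + d)%N; first by apply: lp; rewrite (leq_trans pm0) ?leq_addr.
  rewrite -IH -[X in (_ <= X)%N]subSS; apply: leq_sub2l.
  exact: leq_trans lw wl.
(* Constant codimension means [l m.+1 = l m + 1], and [mulX x (lead J m)] already has dimension
   greater than [l m]. *)
have lead_gen m : (m0 <= m)%N -> lead J m.+1 `<=` mulX x (lead J m).
  move=> mm; have [|w [Mw lw wl]] := lS m; first by apply: lp; exact: leq_trans mm.
  suff wE : w = l m.+1 by rewrite wE in Mw; exact: has_dim_eq Mw (lP m.+1) (mulX_lead rJ).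
  apply/eqP; rewrite eqn_leq wl /=; apply: leq_trans lw.
  have e1 := const _ mm; have e2 := const _ (leqW mm).
  rewrite -(subKn (lm m.+1)) e2 -(subKn (lm m)) e1 subSn // -e1 leq_subr.
  by [].
(* The lift [b] must be in [J] as well as in [K]: the descent below goes on with the difference,
   which has to stay in [J]. *)
have /choice[s sP] m : exists s : seq A, (forall a, a \in s -> J a) /\
    forall K, right_ideal K -> (forall a, a \in s -> K a) ->
    forall a, lead J m a -> exists b, [/\ K b, J b & dlt comp m (b - a)].
  have [e [eE _]] := lP m.
  have /choice[t tP] i : exists t, J t /\ dlt comp m (t - e i).
    suff [_ [u Ju du]] : lead J m (e i) by exists u.
    apply/eE; exists (fun j => (j == i)%:R).
    rewrite (bigD1 i) //= eqxx scale1r big1 ?addr0 // => j /negPf ->.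
    by rewrite scale0r.
  exists [seq t i | i <- enum 'I_(l m)].
  split=> [a /mapP[i _ ->]|K rK tK a /eE[c' ->]]; first by case: (tP i).
  have sub S : right_ideal S -> (forall i, S (t i)) -> S (\sum_i c' i *: t i).
    move=> rS St; apply: subsp_sum => [|i]; first exact: right_ideal_subsp.
    by apply: subspZ => //; exact: right_ideal_subsp.
  exists (\sum_i c' i *: t i); split.
  - by apply: sub => // i; apply/tK/map_f; rewrite mem_enum.
  - by apply: sub => // i; case: (tP i).
  rewrite -sumrB; apply: dlt_sumr => i; rewrite -scalerBr.
  by apply: dltZ; case: (tP i).
exists (flatten [seq s m | m <- iota 0 m0.+1]).
  by move=> a /flatten_mapP[m _]; case: (sP m) => + _; apply.
move=> K rK sK a Ja; have [m] := dlt_exists gg a.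
have [K0 KD KM] := rK; have [J0 JD JM] := rJ.
have KB a' b' : K b' -> K (a' - b') -> K a'.
  by move=> Kb' Kab; rewrite -[a'](subrK b'); exact: KD.
have dltB m' a' b' : dlt comp m'.+1 a' -> dlt comp m' (b' - comp m' a') ->
    dlt comp m' (a' - b').
  move=> a'm b'm; rewrite -(subrK (comp m' a') b') opprD addrCA.
  by rewrite -scaleN1r; apply: dltP => //; exact: (dlt_sub_comp gg).
elim: m a Ja => [|m IH] a Ja am; first by rewrite (dlt0_eq0 gg am).
case: (leqP m m0) => [mm|mm].
  have [_ /(_ K rK)] := sP m; move=> /(_ _ _ (leadP Ja am))[|b' [Kb' Jb' db']].
    move=> b' b's; apply/sK/flatten_mapP; exists m => //.
    by rewrite mem_iota.
  apply: (KB _ b') => //; apply: IH; first exact: right_idealB.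
  exact: dltB.
(* Above [m0] the leading form is a sum of [a'_i x_i] with [a'_i] leading forms of elements [b'_i]
   of [J] of smaller degree; these are in [K] by induction, so no new generators are called for. *)
case: m mm IH am => // m mm IH am.
have [a' la' aE] := lead_gen m mm _ (leadP Ja am).
have /choice[b' b'P] i : exists b', J b' /\ dlt comp m (b' - a' i).
  by have [_ [b' Jb' db']] := la' i; exists b'.
have b'm i : dlt comp m.+1 (b' i).
  have [ha' _] := la' i; rewrite -[b' i](subrK (a' i)); apply: dltD.
    by apply: dlt_leq (b'P i).2.
  exact: (gdeg_dlt gg ha').
apply: (KB _ (\sum_i b' i * x i)).
  by apply: right_ideal_sum => // i; apply/KM/IH; [case: (b'P i) | exact: b'm].
apply: IH.
  by apply: right_idealB => //; apply: right_ideal_sum => // i; apply: JM; case: (b'P i).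
apply: dltB => //; rewrite aE -sumrB; apply: dlt_sumr => i.
rewrite -mulrBl => -[//|d] md; rewrite (compXr gg).
by rewrite (b'P i).2 // mul0r.
Qed.

End QuadraticNoetherian.

(** * Skew polynomial rings described by their coefficient maps *)

Lemma zX_iota (A B : nzRingType) (iota : A -> B) (sigma : A -> A) (z : B) :
  (forall a, z * iota a = iota (sigma a) * z) ->
  forall p a, z ^+ p * iota a = iota (iter p sigma a) * z ^+ p.
Proof.
move=> z_iota; elim=> [|p IH] a; first by rewrite !expr0 mulr1 mul1r.
by rewrite {1}exprSr -mulrA z_iota mulrA IH -iterSr -mulrA -exprSr.
Qed.

Section SkewPolynomials.
Local Open Scope classical_set_scope.
Variables (k : fieldType) (A B : algType k).
Variables (iota : {lrmorphism A -> B}) (sigma : {lrmorphism A -> A}) (z : B).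
Variable coef : nat -> {linear B -> A}.

(* coef p is the coefficient of z^p for an expansion B = A[z; sigma]. *)
Definition skew_coef : Prop :=
  [/\ bijective sigma /\ (forall a, z * iota a = iota (sigma a) * z),
      (forall p, coef p 1 = if p == 0%N then 1 else 0) /\
      (forall p a b, coef p (iota a * b) = a * coef p b),
      forall p a b, coef p (b * iota a) = coef p b * iter p sigma a,
      forall b, coef 0 (b * z) = 0 /\ forall p, coef p.+1 (b * z) = coef p b &
      forall b, exists N, forall M, (N <= M)%N ->
        b = \sum_(p < M) iota (coef p b) * z ^+ p /\
        forall p, (M <= p)%N -> coef p b = 0].

Hypothesis sc : skew_coef.

Lemma sigma_bij : bijective sigma. Proof. by case: sc => -[]. Qed.

Lemma z_iota a : z * iota a = iota (sigma a) * z. Proof. by case: sc => -[]. Qed.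

Lemma coef_iotal p a b : coef p (iota a * b) = a * coef p b.
Proof. by case: sc => _ []. Qed.

Lemma coef1 p : coef p 1 = if p == 0%N then 1 else 0.
Proof. by case: sc => _ []. Qed.

Lemma coef_iotar p a b : coef p (b * iota a) = coef p b * iter p sigma a.
Proof. by case: sc. Qed.

Lemma coef_zr0 b : coef 0 (b * z) = 0. Proof. by case: sc => _ _ _ /(_ b)[]. Qed.

Lemma coef_zr p b : coef p.+1 (b * z) = coef p b.
Proof. by case: sc => _ _ _ /(_ b)[]. Qed.

Lemma coef_iota p a : coef p (iota a) = if p == 0%N then a else 0.
Proof.
by rewrite -[iota a]mulr1 coef_iotal coef1; case: eqP; rewrite ?mulr1 ?mulr0.
Qed.

Definition zlt m b := forall p, (m <= p)%N -> coef p b = 0.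

Lemma zlt_exists b : exists m, zlt m b.
Proof. by case: sc => _ _ _ _ /(_ b)[m /(_ m (leqnn m))[]]; exists m. Qed.

Lemma zlt_sum m b : zlt m b -> b = \sum_(p < m) iota (coef p b) * z ^+ p.
Proof.
move=> b0; have [_ _ _ _ /(_ b)[N /(_ _ (leq_maxl N m))[bE _]]] := sc.
rewrite {1}bE -!(big_mkord xpredT (fun p => iota (coef p b) * z ^+ p)).
rewrite (big_cat_nat (leq0n m) (leq_maxr N m)) /= [X in _ + X]big_nat_cond.
rewrite [X in _ + X]big1 ?addr0 // => p /andP[/andP[mp _] _].
by rewrite b0 // linear0 mul0r.
Qed.

Lemma zlt0_eq0 b : zlt 0 b -> b = 0.
Proof. by move/zlt_sum; rewrite big_ord0. Qed.

Lemma coef_eq0 b : (forall p, coef p b = 0) -> b = 0.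
Proof. by move=> b0; apply: zlt0_eq0 => p _. Qed.

Lemma iota_inj : injective iota.
Proof.
move=> a b /(congr1 (coef 0)); by rewrite !coef_iota.
Qed.

Lemma coef_zXr p q b : coef p (b * z ^+ q) = if (q <= p)%N then coef (p - q) b else 0.
Proof.
elim: q p b => [|q IH] p b; first by rewrite expr0 mulr1 subn0.
rewrite exprSr mulrA; case: p => [|p]; first by rewrite coef_zr0.
by rewrite coef_zr IH ltnS subSS.
Qed.

Lemma zr_eq0 b : b * z = 0 -> b = 0.
Proof. by move=> bz; apply: coef_eq0 => p; rewrite -coef_zr bz linear0. Qed.

(** The kernel of [coef 0] being [B z], this map plays the part of reduction modulo [z]. *)
Lemma coef0_eq0P b : coef 0 b = 0 <-> exists b', b = b' * z.
Proof.
split=> [b0|[b' ->]]; last exact: coef_zr0.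
have [m bm] := zlt_exists b.
have bm1 : zlt m.+1 b by move=> p mp; apply: bm; exact: ltnW.
exists (\sum_(p < m) iota (coef p.+1 b) * z ^+ p).
rewrite {1}(zlt_sum bm1) big_ord_recl b0 linear0 mul0r add0r mulr_suml.
by apply: eq_bigr => p _; rewrite -mulrA -exprSr.
Qed.

Lemma skew_poly : skew_polynomial iota sigma z.
Proof.
split; first exact: sigma_bij.
- exact: z_iota.
- move=> b; have [m /zlt_sum bE] := zlt_exists b.
  by exists m, (fun p => coef p b).
move=> m c c0 i; have := congr1 (coef i) c0; rewrite linear0 linear_sum.
rewrite (bigD1 i) //= coef_zXr leqnn subnn coef_iota /= big1 ?addr0 // => j ji.
rewrite coef_zXr coef_iota; case: (leqP j i) => // le; rewrite subn_eq0.
by rewrite leqNgt ltn_neqAle le andbT -val_eqE /= in ji *; rewrite ji.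
Qed.

Lemma z_normal : normal z.
Proof.
have [sigma' sigmaK sigma'K] := sigma_bij.
apply/seteqP; split=> [_ [b _ <-]|_ [b _ <-]];
  have [m /zlt_sum ->] := zlt_exists b.
  exists (\sum_(p < m) iota (sigma' (coef p b)) * z ^+ p) => //.
  rewrite mulr_sumr mulr_suml; apply: eq_bigr => p _.
  by rewrite mulrA z_iota sigma'K -!mulrA -exprS exprSr.
exists (\sum_(p < m) iota (sigma (coef p b)) * z ^+ p) => //.
rewrite mulr_sumr mulr_suml; apply: eq_bigr => p _.
by rewrite mulrA z_iota -!mulrA -exprS exprSr.
Qed.

Lemma iter_sigma0 p a : iter p sigma a = 0 -> a = 0.
Proof.
elim: p => // p IH /= s0; apply/IH/(bij_inj sigma_bij).
by rewrite s0 linear0.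
Qed.

Lemma coefM_top p q b c : zlt p.+1 b -> zlt q.+1 c ->
  coef (p + q) (b * c) = coef p b * iter p sigma (coef q c).
Proof.
move=> b0 c0; rewrite {1}(zlt_sum c0) mulr_sumr linear_sum (bigD1 ord_max) //=.
rewrite mulrA coef_zXr leq_addl addnK coef_iotar big1 ?addr0 // => j.
rewrite -val_eqE /= => ji; have {ji}jq : (j < q)%N by rewrite ltn_neqAle ji -ltnS ltn_ord.
rewrite mulrA coef_zXr coef_iotar; case: ifP => // _.
by rewrite b0 ?mul0r // ltn_subRL addnC ltn_add2l.
Qed.

Lemma coef_top b : b != 0 -> exists p, zlt p.+1 b /\ coef p b != 0.
Proof.
move=> b0; have [m bm] := zlt_exists b.
elim: m bm => [/zlt0_eq0|m IH bm]; first by move/eqP; rewrite (negPf b0).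
have [cm|] := eqVneq (coef m b) 0; last by exists m.
by apply: IH => d; rewrite leq_eqVlt => /predU1P[<-//|]; exact: bm.
Qed.

Lemma skew_domain : (forall a b : A, a * b = 0 -> a = 0 \/ b = 0) ->
  forall b c : B, b * c = 0 -> b = 0 \/ c = 0.
Proof.
move=> domA b c bc0; case: (eqVneq b 0) => [|/coef_top[p [bp pb]]]; first by left.
case: (eqVneq c 0) => [|/coef_top[q [cq qc]]]; first by right.
have := coefM_top bp cq; rewrite bc0 linear0 => /esym/domA[|/iter_sigma0]/eqP.
  by rewrite (negPf pb).
by rewrite (negPf qc).
Qed.

(** Hilbert's argument on leading coefficients. Right multiplication by [iota c] multiplies a
    leading coefficient in degree [p] by [sigma^p c], so it is the surjectivity of [sigma] that
    makes the sets [L K p] right ideals. *)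
Lemma skew_right_noetherian : right_noetherian A -> right_noetherian B.
Proof.
move=> /right_noetherianP nA; apply/right_noetherianP => J rJ.
have [sigma' sigmaK sigma'K] := sigma_bij.
have iter_surj p c : exists c', iter p sigma c' = c.
  elim: p c => [|p IH] c; first by exists c.
  by have [c' cE] := IH (sigma' c); exists c'; rewrite /= cE sigma'K.
pose L (K : set B) p : set A :=
  [set a | exists b, [/\ K b, zlt p.+1 b & coef p b = a]].
have L_right K p : right_ideal K -> right_ideal (L K p).
  move=> [K0 KD KM]; split.
  - by exists 0; split=> [||]; rewrite ?linear0 // => q _; rewrite linear0.
  - move=> _ _ [b [Kb bp <-]] [c [Kc cp <-]]; exists (b + c); split=> [||].
    + exact: KD.
    + by move=> q pq; rewrite linearD /= bp // cp // addr0.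
    by rewrite linearD.
  move=> u _ [b [Kb bp <-]]; have [c cE] := iter_surj p u.
  exists (b * iota c); split=> [||]; first exact: KM.
    by move=> q pq; rewrite coef_iotar bp // mul0r.
  by rewrite coef_iotar cE.
have LS K p q : right_ideal K -> (p <= q)%N -> L K p `<=` L K q.
  move=> [K0 KD KM] pq _ [b [Kb bp <-]]; exists (b * z ^+ (q - p)).
  split; first exact: KM.
    move=> r qr; rewrite coef_zXr; case: ifP => // le; apply: bp.
    by rewrite leq_subRL ?(leq_trans (leq_subr _ _) (ltnW qr)) // addnS subnK.
  by rewrite coef_zXr leq_subr subKn.
have U_right : right_ideal [set a | exists p, L J p a].
  split; first by exists 0%N; case: (L_right J 0%N rJ).
    move=> a b [p La] [q Lb]; exists (maxn p q).
    have [_ + _] := L_right J (maxn p q) rJ; apply.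
      by apply: LS La => //; exact: leq_maxl.
    by apply: LS Lb => //; exact: leq_maxr.
  by move=> u a [p La]; exists p; have [_ _] := L_right J p rJ; apply.
have [sU sUL UsU] := nA _ U_right.
have [P PsU] : exists P, forall a, a \in sU -> L J P a.
  elim: sU sUL {UsU} => [|a s IH] sL; first by exists 0%N.
  have [|P PL] := IH; first by move=> b bs; apply: sL; rewrite inE bs orbT.
  have [p pL] := sL a (mem_head a s).
  exists (maxn p P) => b; rewrite inE => /predU1P[->|bs].
    by apply: LS pL => //; exact: leq_maxl.
  by apply: LS (PL _ bs) => //; exact: leq_maxr.
(* The union of the increasing [L J m] is generated by elements that all occur in [L J P], so the
   chain is stationary from [P] on. *)
have LP m : L J m `<=` L J (minn m P).
  case: (leqP m P) => [mP|/ltnW Pm] a La; first by [].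
  apply: (UsU (L J P)) => //; first exact: L_right.
  by exists m.
have /choice[t tP] p : exists t : seq B, (forall b, b \in t -> J b) /\
    forall K, right_ideal K -> (forall b, b \in t -> K b) -> L J p `<=` L K p.
  have [s sL Ls] := nA _ (L_right J p rJ).
  have /choice[l lP] a : exists b, a \in s -> [/\ J b, zlt p.+1 b & coef p b = a].
    case: (boolP (a \in s)) => [/sL[b bP]|_]; last by exists 0.
    by exists b.
  exists [seq l a | a <- s]; split=> [_ /mapP[a /lP[Jl _ _] ->] //|K rK tK].
  apply: Ls => [|a as_]; first exact: L_right.
  have [_ lp <-] := lP a as_; exists (l a); split=> //; apply: tK; exact: map_f.
exists (flatten [seq t p | p <- seq.iota 0 P.+1]).
  by move=> b /flatten_mapP[p _]; case: (tP p) => + _; apply.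
move=> K rK tK; have [K0 KD KM] := rK; have [J0 JD JM] := rJ.
have JK_right : right_ideal (J `&` K).
  by split=> // [a b [Ja Ka] [Jb Kb]|u a [Ja Ka]]; split; auto.
move=> b; have [m] := zlt_exists b.
elim: m b => [|m IH] b bm Jb; first by rewrite (zlt0_eq0 bm).
(* Leading coefficients are matched inside the intersection of [J] and [K], so that [c] is in [K]
   while [b - c] is still in [J]. *)
have : L (J `&` K) m (coef m b).
  apply: (LS _ (minn m P) m) => //; first exact: geq_minl.
  have [tJ] := tP (minn m P); apply => //; last by apply: LP; exists b.
  move=> c ct; split; first exact: tJ.
  apply/tK/flatten_mapP; exists (minn m P) => //.
  by rewrite mem_iota ltnS geq_minr.
move=> [c [[Jc Kc] cm cE]]; rewrite -[b](subrK c); apply: KD => //.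
apply: IH; last exact: right_idealB.
move=> p; rewrite leq_eqVlt linearB /= => /predU1P[<-|mp].
  by rewrite cE subrr.
by rewrite bm // cm // subrr.
Qed.

End SkewPolynomials.

(** * Construction of B as a skew polynomial ring over A *)

Section QuadraticForms.
Local Open Scope classical_set_scope.
Variables (k : fieldType) (n : nat).
Implicit Types f P : 'M[k]_n.

Lemma rmorph_qform f (R S : algType k) (phi : {lrmorphism R -> S}) (y : 'I_n -> R) :
  phi (qform f y) = qform f (fun i => phi (y i)).
Proof.
rewrite /qform linear_sum; apply: eq_bigr => i _.
rewrite linear_sum; apply: eq_bigr => j _.
by rewrite linearZ /= rmorphM.
Qed.

Lemma feval_qform f (I : choiceType) (R : algType k) (y : 'I_n -> I) (g : I -> R) :
  feval g (qform f (fun i => fgen (y i))) = qform f (fun i => g (y i)).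
Proof.
rewrite [LHS](rmorph_qform f (feval g)); congr (qform f _).
by apply/funext => i; exact: feval_gen.
Qed.

Lemma qform_mulmx f P (R : algType k) (y : 'I_n -> R) :
  qform f (fun i => \sum_j P i j *: y j) = qform (P^T *m f *m P) y.
Proof.
pose F i j a b := (P i a * f i j * P j b) *: (y a * y b).
transitivity (\sum_i \sum_j \sum_a \sum_b F i j a b).
  apply: eq_bigr => i _; apply: eq_bigr => j _.
  rewrite mulr_suml scaler_sumr; apply: eq_bigr => a _.
  rewrite mulr_sumr scaler_sumr; apply: eq_bigr => b _.
  by rewrite -scalerAl -scalerAr !scalerA [f i j * _]mulrC.
transitivity (\sum_a \sum_b \sum_j \sum_i F i j a b).
  under eq_bigr => i _ do rewrite exchange_big.
  rewrite exchange_big; apply: eq_bigr => a _ /=.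
  under eq_bigr => i _ do rewrite exchange_big.
  rewrite exchange_big; apply: eq_bigr => b _ /=.
  by rewrite exchange_big.
apply: eq_bigr => a _; apply: eq_bigr => b _.
rewrite mxE scaler_suml; apply: eq_bigr => j _.
rewrite mxE mulr_suml scaler_suml; apply: eq_bigr => i _.
by rewrite mxE.
Qed.

Definition twist f : 'M[k]_n := - (invmx f^T *m f).

Lemma twist_form f : f \in unitmx -> (twist f)^T *m f *m twist f = f.
Proof.
move=> fu; rewrite /twist [(- _)^T]linearN [X in - X]trmx_mul trmx_inv trmxK.
rewrite mulNmx mulmxN mulNmx opprK mulmxA mulmxKV //.
by rewrite mulmxV ?unitmx_tr // mul1mx.
Qed.

Lemma twist_unit f : f \in unitmx -> twist f \in unitmx.
Proof.
by move=> fu; rewrite /twist -scaleN1r unitmxZ ?unitrN1 // unitmx_mul unitmx_inv unitmx_tr fu.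
Qed.

Lemma form_invmx f P : P \in unitmx -> P^T *m f *m P = f ->
  (invmx P)^T *m f *m invmx P = f.
Proof.
move=> Pu {1}<-; rewrite trmx_inv !mulmxA mulVmx ?unitmx_tr // mul1mx.
by rewrite mulmxK.
Qed.

End QuadraticForms.

Section SkewConstruction.
Local Open Scope classical_set_scope.
Variables (k : fieldType) (n : nat) (f : 'M[k]_n) (A B : algType k).
Variable pA : {lrmorphism freealg k (xvar n) -> A}.
Variable pB : {lrmorphism freealg k (xzvar n) -> B}.
Hypotheses (f_unit : f \in unitmx) (presA : presents [set quad_rel f] pA).
Hypothesis presB : presents (jacobi_rel (potential f)) pB.

Let x (i : 'I_n) : A := pA (@fgen k (xvar n) i).
Let X (i : 'I_n) : B := pB (@fgen k (xzvar n) (Some i)).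
Let z : B := pB (@fgen k (xzvar n) None).

Lemma quad_ind (P : A -> Prop) : P 0 ->
  (forall c a b, P a -> P b -> P (c *: a + b)) ->
  P 1 -> (forall a i, P a -> P (a * x i)) -> forall a, P a.
Proof. exact: (@presented_ind k 'I_n _ A pA presA). Qed.

Lemma pot_ind (P : B -> Prop) : P 0 ->
  (forall c a b, P a -> P b -> P (c *: a + b)) ->
  P 1 -> (forall a i, P a -> P (a * X i)) -> (forall a, P a -> P (a * z)) ->
  forall a, P a.
Proof.
move=> P0 PD P1 PX Pz; apply: (@presented_ind k (option 'I_n) _ B pB presB) => //.
by move=> a [i|]; [exact: PX | exact: Pz].
Qed.

Lemma quad_rel0 : qform f x = 0.
Proof.
rewrite -(rmorph_qform f pA (@fgen k (xvar n))).
by have [_ ker] := presA; apply/ker => J [_]; exact.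
Qed.

Lemma pot_relz : qform f X = 0.
Proof.
rewrite -(rmorph_qform f pB (fun i => @fgen k (xzvar n) (Some i))).
rewrite -cder_potential_z.
by have [_ ker] := presB; apply/ker => J [_]; apply; exists None.
Qed.

Lemma pot_relx i : \sum_j (f i j *: (X j * z) + f j i *: (z * X j)) = 0.
Proof.
have [_ ker] := presB; have := cder_potential_x f i; set r := cder _ _ => rE.
have : pB r = 0 by apply/ker => J [_]; apply; exists (Some i).
rewrite rE rmorph_sum => r0; rewrite -[RHS]r0; apply: eq_bigr => j _.
by rewrite rmorphD /= !linearZ /= !rmorphM.
Qed.

Lemma quad_auto P : P^T *m f *m P = f ->
  exists s : {lrmorphism A -> A}, forall i, s (x i) = \sum_j P i j *: x j.
Proof.
move=> Pf; have [|s sE] := @presents_lrmorphism k _ A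
    (fun i : xvar n => \sum_j P i j *: x j) _ A pA presA; last by exists s.
move=> _ ->; rewrite [LHS](feval_qform f (fun i => i : xvar n)).
by rewrite qform_mulmx Pf quad_rel0.
Qed.

Lemma quad_morph_eq (S : algType k) (s t : {lrmorphism A -> S}) :
  (forall i, s (x i) = t (x i)) -> s =1 t.
Proof.
move=> st; elim/quad_ind => [|c a b Ea Eb||a i Ea]; rewrite ?linear0 ?rmorph1 //.
  by rewrite !linearP /= Ea Eb.
by rewrite !rmorphM /= Ea st.
Qed.

Lemma twist_auto : exists2 s : {lrmorphism A -> A}, bijective s &
  forall i, s (x i) = \sum_j twist f i j *: x j.
Proof.
have [s sE] := quad_auto (twist_form f_unit).
have [t tE] := quad_auto (form_invmx (twist_unit f_unit) (twist_form f_unit)).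
have comp_lin (P Q : 'M[k]_n) i :
    \sum_j P i j *: (\sum_l Q j l *: x l) = \sum_l (P *m Q) i l *: x l.
  under eq_bigr => j _ do rewrite scaler_sumr.
  rewrite exchange_big; apply: eq_bigr => l _ /=.
  by rewrite mxE scaler_suml; apply: eq_bigr => j _; rewrite scalerA.
have id_lin i : \sum_l (1%:M : 'M[k]_n) i l *: x l = x i.
  rewrite (bigD1 i) //= mxE eqxx scale1r big1 ?addr0 // => j.
  by rewrite eq_sym mxE => /negPf ->; rewrite scale0r.
exists s => //; exists t => a.
  apply: (quad_morph_eq (s := t \o s) (t := idfun)) => i /=.
  rewrite sE linear_sum; under eq_bigr => j _ do rewrite linearZ /= tE.
  by rewrite comp_lin mulmxV ?twist_unit.
apply: (quad_morph_eq (s := s \o t) (t := idfun)) => i /=.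
rewrite tE linear_sum; under eq_bigr => j _ do rewrite linearZ /= sE.
by rewrite comp_lin mulVmx ?twist_unit.
Qed.

Lemma quad_to_pot : exists io : {lrmorphism A -> B}, forall i, io (x i) = X i.
Proof.
have [|io ioE] := @presents_lrmorphism k _ B (X : xvar n -> B) _ A pA presA; last by exists io.
move=> _ ->; rewrite [LHS](feval_qform f (fun i => i : xvar n)).
exact: pot_relz.
Qed.

(** The relations say [sum_j f_ji z x_j = - sum_j f_ij x_j z]; the inverse of [f^T] solves them for
    [z x_i]. *)
Lemma zX_twist i : z * X i = \sum_j twist f i j *: (X j * z).
Proof.
have E i' : \sum_j f^T i' j *: (z * X j) = - \sum_j f i' j *: (X j * z).
  apply/eqP; rewrite -addr_eq0 addrC -big_split /= -[X in _ == X](pot_relx i').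
  by apply/eqP; apply: eq_bigr => j _; rewrite mxE.
have -> : z * X i = \sum_j (\sum_l invmx f^T i l * f^T l j) *: (z * X j).
  rewrite (bigD1 i) //=; have /matrixP/(_ i) E1 : invmx f^T *m f^T = 1%:M.
    by rewrite mulVmx ?unitmx_tr.
  have := E1 i; rewrite !mxE eqxx => ->; rewrite scale1r big1 ?addr0 // => j.
  by move=> /negPf ji; have := E1 j; rewrite !mxE eq_sym ji => ->; rewrite scale0r.
under eq_bigr => j _ do rewrite scaler_suml.
rewrite exchange_big /=.
under eq_bigr => l _ do under eq_bigr => j _ do rewrite -scalerA.
under eq_bigr => l _ do rewrite -scaler_sumr E scalerN scaler_sumr -sumrN.
rewrite exchange_big /=; apply: eq_bigr => j _.
rewrite !mxE -sumrN scaler_suml; apply: eq_bigr => l _.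
by rewrite scalerA scaleNr.
Qed.

(* A word w equals (wc w) z^(nz w) in B, with wc w as in the next proof. *)
Let nz (w : seq (xzvar n)) : nat := count (fun s : option 'I_n => s == None) w.

(** Instead of building [A[z; sigma]] and mapping [B] to it, the would-be coefficients are defined
    on words, shown to vanish on the ideal of relations, and thus descend to [B]. Freeness over [A]
    is then a property of these maps. *)
Lemma pot_skew (sigma : {lrmorphism A -> A}) (io : {lrmorphism A -> B}) :
  bijective sigma -> (forall i, sigma (x i) = \sum_j twist f i j *: x j) ->
  (forall i, io (x i) = X i) -> exists coef, skew_coef io sigma z coef.
Proof.
move=> sbij sE ioE.
pose wc (w : seq (xzvar n)) : A := foldr (fun (s : option 'I_n) a =>
  if s is Some i then x i * a else sigma a) 1 w.
have iterD p a b : iter p sigma (a + b) = iter p sigma a + iter p sigma b.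
  by elim: p => //= p ->; rewrite linearD.
have iterZ p c a : iter p sigma (c *: a) = c *: iter p sigma a.
  by elim: p => //= p ->; rewrite linearZ.
have iterM p a b : iter p sigma (a * b) = iter p sigma a * iter p sigma b.
  by elim: p => //= p ->; rewrite rmorphM.
have iter1 p : iter p sigma 1 = 1 by elim: p => //= p ->; rewrite rmorph1.
have iter0 p : iter p sigma 0 = 0 by elim: p => //= p ->; rewrite linear0.
have wc_cat u v : wc (u ++ v) = wc u * iter (nz u) sigma (wc v).
  rewrite /wc foldr_cat; elim: u => [|[i|] u IH] /=; first by rewrite mul1r.
    by rewrite IH mulrA.
  by rewrite IH rmorphM.
have nz_cat u v : nz (u ++ v) = (nz u + nz v)%N by exact: count_cat.
pose h p w := if nz w == p then wc w else 0.
have [C Cw] : exists C : nat -> {linear freealg k (xzvar n) -> A},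
    forall p w, C p (fword k w) = h p w.
  by exists (fun p => flin (h p)) => p w; exact: flin_word.
(* [Cl] and [Cr] express [C p] of a product with a word through values of [C] on the other factor.
   Hence vanishing of all [C p] is stable under both multiplications. *)
have Cl p w b : C p (fword k w * b) =
    if (nz w <= p)%N then wc w * iter (nz w) sigma (C (p - nz w)%N b) else 0.
  elim/freealg_ind: b => [|c b b' Eb Eb'|v].
  - by rewrite mulr0 !linear0 iter0 mulr0 if_same.
  - rewrite mulrDr -scalerAr !linearP Eb Eb'; case: ifP => _; rewrite ?scaler0 ?addr0 //.
    by rewrite iterD iterZ mulrDr -scalerAr.
  rewrite fwordM !Cw /h nz_cat wc_cat; case: leqP => [le|lt].
    by rewrite -{1}(subnKC le) eqn_add2l; case: eqP => _ //; rewrite iter0 mulr0.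
  by rewrite gtn_eqF // (leq_trans lt) // leq_addr.
have Cr p w b : C p (b * fword k w) =
    if (nz w <= p)%N then C (p - nz w)%N b * iter (p - nz w) sigma (wc w) else 0.
  elim/freealg_ind: b => [|c b b' Eb Eb'|v].
  - by rewrite mul0r !linear0 mul0r if_same.
  - rewrite mulrDl -scalerAl !linearP Eb Eb'; case: ifP => _; rewrite ?scaler0 ?addr0 //.
    by rewrite mulrDl -scalerAl.
  rewrite fwordM !Cw /h nz_cat wc_cat; case: leqP => [le|lt].
    rewrite -{1}(subnK le) eqn_add2r; case: eqP => [->|_]; last by rewrite mul0r.
    by [].
  by rewrite gtn_eqF // (leq_trans lt) // leq_addl.
have C0 a : ideal_gen (jacobi_rel (potential f)) a -> forall p, C p a = 0.
  elim/ideal_gen_ind.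
  - by move=> p; rewrite linear0.
  - by move=> c b b' Eb Eb' p; rewrite linearP /= Eb Eb' scaler0 addr0.
  - by move=> w b Eb p; rewrite Cl Eb iter0 mulr0 if_same.
  - by move=> w b Eb p; rewrite Cr Eb mul0r if_same.
  move=> _ [[i|] _ <-] p; last first.
    rewrite cder_potential_z /qform linear_sum.
    under eq_bigr => i _ do rewrite linear_sum.
    under eq_bigr => i _ do under eq_bigr => j _ do
      rewrite linearZ /= fwordM Cw /h /= mulr1.
    case: eqP => _; first exact: quad_rel0.
    by rewrite big1 // => i _; rewrite big1 // => j _; rewrite scaler0.
  rewrite cder_potential_x linear_sum.
  under eq_bigr => j _ do rewrite linearD !linearZ /= !fwordM !Cw /h /= rmorph1 !mulr1.
  case: eqP => _; last by rewrite big1 // => j _; rewrite !scaler0 addr0.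
  rewrite big_split /=; under [X in _ + X]eq_bigr => j _ do rewrite sE scaler_sumr.
  rewrite [X in _ + X]exchange_big -big_split /=.
  rewrite big1 // => j _; under eq_bigr => l _ do rewrite scalerA.
  rewrite -scaler_suml -scalerDl (_ : _ + _ = 0) ?scale0r //.
  (* The coefficient of [z] in the relation is [sum_j (f_ij x_j + f_ji sigma(x_j))]; this identity,
     which characterizes [twist f], makes it vanish. *)
  have : f^T *m twist f = - f.
    by rewrite mulmxN mulmxA mulmxV ?unitmx_tr // mul1mx.
  move/matrixP/(_ i j); rewrite mxE [RHS]mxE => E; rewrite -[f i j]opprK -E addrC.
  by rewrite -sumrB big1 // => l _; rewrite [f^T i l]mxE subrr.
have /choice[coef coefE] p : exists q : {linear B -> A}, forall a, q (pB a) = C p a.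
  apply: (@presents_desc _ _ _ _ _ pB (C p) presB) => a /C0; exact.
exists coef; have [p_surj _] := presB.
have coef_X p i b : coef p (X i * b) = x i * coef p b.
  have [b' <-] := p_surj b; rewrite /X -rmorphM !coefE Cl /= subn0.
  by rewrite /wc /= mulr1.
have coef_Xr p i b : coef p (b * X i) = coef p b * iter p sigma (x i).
  have [b' <-] := p_surj b; rewrite /X -rmorphM !coefE Cr /= subn0.
  by rewrite /wc /= mulr1.
have coef_zr b : coef 0 (b * z) = 0 /\ forall p, coef p.+1 (b * z) = coef p b.
  have [b' <-] := p_surj b; split=> [|p]; rewrite /z -rmorphM !coefE Cr //=.
  by rewrite /nz /= subSS subn0 rmorph1 iter1 mulr1.
have coef1 p : coef p 1 = if p == 0%N then 1 else 0.
  by rewrite -(rmorph1 pB) coefE -fword0 Cw /h /= eq_sym.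
have z_io a : z * io a = io (sigma a) * z.
  elim/quad_ind: a => [|c a b Ea Eb||a i Ea].
  - by rewrite !linear0 mulr0 mul0r.
  - by rewrite !linearP /= mulrDr -scalerAr Ea Eb mulrDl -scalerAl.
  - by rewrite !rmorph1 mulr1 mul1r.
  rewrite !rmorphM /= mulrA Ea -!mulrA ioE zX_twist sE linear_sum mulr_suml.
  by congr (_ * _); apply: eq_bigr => j _; rewrite linearZ /= ioE scalerAl.
split=> //; [split=> // p a b | move=> p a b | move=> b].
- elim/quad_ind: a b => [|c a a' Ea Ea'||a i Ea] b.
  + by rewrite linear0 !mul0r linear0.
  + by rewrite linearP !mulrDl -!scalerAl !linearP /= Ea Ea'.
  + by rewrite rmorph1 !mul1r.
  by rewrite rmorphM /= ioE -!mulrA Ea coef_X.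
- elim/quad_ind: a b => [|c a a' Ea Ea'||a i Ea] b.
  + by rewrite linear0 !mulr0 linear0 iter0 mulr0.
  + by rewrite linearP !mulrDr -!scalerAr !linearP /= Ea Ea' iterD iterZ mulrDr -scalerAr.
  + by rewrite rmorph1 !mulr1 iter1 mulr1.
  by rewrite rmorphM /= ioE mulrA coef_Xr Ea iterM mulrA.
have zX_io := zX_iota z_io.
elim/pot_ind: b => [|c b b' [N EN] [N' EN']||b i [N EN]|b [N EN]].
- exists 0%N => M _; split=> [|p _]; last exact: linear0.
  by rewrite big1 // => p _; rewrite !linear0 mul0r.
- exists (maxn N N') => M; rewrite geq_max => /andP[/EN[bE b0] /EN'[b'E b'0]].
  split=> [|p Mp]; last by rewrite linearP b0 // b'0 // scaler0 addr0.
  rewrite {1}bE {1}b'E scaler_sumr -big_split; apply: eq_bigr => p _ /=.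
  by rewrite !linearP /= mulrDl -scalerAl.
- exists 1%N => -[//|M] _; split=> [|[//|p] _]; last by rewrite coef1.
  rewrite big_ord_recl coef1 /= rmorph1 mul1r expr0 big1 ?addr0 // => p _.
  by rewrite coef1 linear0 mul0r.
- exists N => M /EN[bE b0]; split=> [|p Mp]; last by rewrite coef_Xr b0 // mul0r.
  rewrite {1}bE mulr_suml; apply: eq_bigr => p _.
  by rewrite coef_Xr rmorphM /= -mulrA -ioE zX_io mulrA.
exists N.+1 => -[//|M]; rewrite ltnS => /EN[bE b0]; split; last first.
  by move=> [//|p] Mp; rewrite (coef_zr b).2 b0.
rewrite big_ord_recl (coef_zr b).1 linear0 mul0r add0r {1}bE mulr_suml.
by apply: eq_bigr => p _; rewrite (coef_zr b).2 exprSr mulrA.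
Qed.

End SkewConstruction.

Section PresentedGrading.
Local Open Scope classical_set_scope.
Variables (k : fieldType) (I : finType) (G : set (freealg k I)).
Variables (R : algType k) (p : {lrmorphism freealg k I -> R}).
Hypothesis p_pres : presents G p.

Lemma homogeneous_lin d c (a b : freealg k I) :
  homogeneous d a -> homogeneous d b -> homogeneous d (c *: a + b).
Proof.
move=> ha hb w; rewrite -mcoeff_neq0 fcoeffD fcoeffZ => ab0.
case: (boolP (w \in msupp a)) => [/ha//|/mcoeff_outdom a0].
by apply: hb; rewrite -mcoeff_neq0; move: ab0; rewrite a0 mulr0 add0r.
Qed.

Lemma homogeneous0 d : homogeneous d (0 : freealg k I).
Proof. by move=> w; rewrite -mcoeff_neq0 fcoeff0 eqxx. Qed.

Lemma homogeneous_word (w : seq I) : homogeneous (size w) (fword k w).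
Proof.
move=> v; rewrite fword.unlock => /(fsubsetP msuppU_le).
by rewrite inE => /eqP ->.
Qed.

Lemma homogeneous_sum d (J : finType) (E : J -> freealg k I) :
  (forall j, homogeneous d (E j)) -> homogeneous d (\sum_j E j).
Proof.
move=> hE; elim/big_ind: _ => // [|a b ha hb]; first exact: homogeneous0.
by rewrite -[a]scale1r; exact: homogeneous_lin.
Qed.

Hypothesis G_hom : forall r, G r -> exists e, homogeneous e r.

Lemma presented_graded_gen : exists comp,
  graded_gen (fun i => p (fgen i)) comp /\
  forall d, gdeg comp d = p @` homogeneous d.
Proof.
have [comp compE] := presented_grading p_pres G_hom.
have [p_surj _] := p_pres.
exists comp; split; first split.
- exact: (presented_ind p_pres).
- by move=> d; rewrite -(rmorph1 p) -fword0 compE eq_sym.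
- move=> i r; have [a <-] := p_surj r.
  elim/freealg_ind: a => [|c a b [Ea Ea'] [Eb Eb']|w].
  + by rewrite linear0 mul0r linear0; split=> // d; rewrite !linear0 mul0r.
  + rewrite linearP mulrDl -scalerAl; split=> [|d]; rewrite !linearP /=.
      by rewrite Ea Eb scaler0 addr0.
    by rewrite Ea' Eb' mulrDl -scalerAl.
  rewrite -rmorphM -fword_rcons compE size_rcons; split=> // d.
  rewrite !compE size_rcons eqSS; case: eqP => _; last by rewrite mul0r.
  by rewrite fword_rcons rmorphM.
move=> d; apply/seteqP; split=> [r hr|_ [a ha <-]].
  have [a aE] := p_surj r.
  have [a' ha' a'E] : exists2 a', homogeneous d a' & p a' = comp d (p a).
    elim/freealg_ind: (a) => [|c b b' [u hu uE] [u' hu' u'E]|w].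
    - by exists 0; rewrite ?linear0 //; exact: homogeneous0.
    - exists (c *: u + u'); first exact: homogeneous_lin.
      by rewrite !linearP /= uE u'E.
    rewrite compE; case: eqP => [<-|_]; last first.
      by exists 0; rewrite ?linear0 //; exact: homogeneous0.
    by exists (fword k w) => //; exact: homogeneous_word.
  by exists a' => //; rewrite a'E aE; exact: hr.
rewrite /gdeg /= -(flin_fword a) /flin !linear_sum /= !big_seq.
by apply: eq_bigr => w wa; rewrite !linearZ /= compE ha // eqxx.
Qed.

End PresentedGrading.

(** * The algebra B: Koszul syzygies, Hilbert function, centrality of z *)

Section PotentialAlgebra.
Local Open Scope classical_set_scope.
Variables (k : fieldType) (n : nat) (f : 'M[k]_n) (A B : algType k).
Variables (x : 'I_n -> A) (X : 'I_n -> B) (z : B).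
Variables (compA : nat -> {linear A -> A}) (compB : nat -> {linear B -> B}).
Variables (io : {lrmorphism A -> B}) (sigma : {lrmorphism A -> A}).
Variable coef : nat -> {linear B -> A}.
Hypotheses (n_ge2 : (2 <= n)%N) (f_unit : f \in unitmx).

Definition xz (s : option 'I_n) : B := if s is Some i then X i else z.

(* The cyclically invariant tensor of the potential, w = sum_abc w_abc abc up to
   cyclic permutation. *)
Definition wt (a b c : option 'I_n) : k :=
  match a, b, c with
  | Some i, Some j, None | None, Some i, Some j | Some j, None, Some i => f i j
  | _, _, _ => 0
  end.

Lemma wt_cyc a b c : wt a b c = wt b c a.
Proof. by case: a b c => [?|] [?|] [?|]. Qed.

(** The noncommutative Hessian of the potential: row [a] holds the left coefficients of the relation
    obtained by differentiating with respect to [a]. *)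
Definition hess (a b : option 'I_n) : B := \sum_c wt a c b *: xz c.

Hypothesis ggA : graded_gen x compA.
Hypothesis lrow_x : \sum_i lrow f x i * x i = 0.
Hypothesis syzA : forall a : 'I_n -> A, \sum_i a i * x i = 0 ->
  exists u, forall i, a i = u * lrow f x i.
Hypothesis ggB : graded_gen xz compB.
Hypothesis sc : skew_coef io sigma z coef.
Hypothesis ioE : forall i, io (x i) = X i.
Hypothesis hess_xz : forall a, \sum_b hess a b * xz b = 0.
Hypothesis syzB : forall a : option 'I_n -> B, \sum_s a s * xz s = 0 ->
  exists u : option 'I_n -> B, forall t, a t = \sum_s u s * hess s t.
Hypothesis zX : forall i, z * X i = \sum_j twist f i j *: (X j * z).

(** Cyclic invariance lets the relation of index [b] be split at its first letter as well as at its
    last one. *)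
Lemma xz_hess b : \sum_a xz a * hess a b = 0.
Proof.
rewrite -[RHS](hess_xz b); under eq_bigr => a _ do rewrite mulr_sumr.
under [RHS]eq_bigr => a _ do rewrite mulr_suml.
rewrite [RHS]exchange_big; apply: eq_bigr => a _; apply: eq_bigr => c _.
by rewrite -scalerAl -scalerAr (wt_cyc b a).
Qed.

Lemma big_option (V : nmodType) (F : option 'I_n -> V) :
  \sum_s F s = F None + \sum_i F (Some i).
Proof.
rewrite (bigD1 None) //=; congr (_ + _).
rewrite (reindex_omap Some id) //=; last by case.
by apply: eq_bigl => i; rewrite eqxx.
Qed.

Lemma hess_SS i j : hess (Some i) (Some j) = f j i *: z.
Proof.
rewrite /hess big_option /= big1 ?addr0 // => c _; exact: scale0r.
Qed.

Lemma hess_NS j : hess None (Some j) = \sum_i f i j *: X i.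
Proof. by rewrite /hess big_option /= scale0r add0r. Qed.

Lemma f_scale_eq0 (u : 'I_n -> B) : (forall j, \sum_i f j i *: u i = 0) ->
  forall i, u i = 0.
Proof.
move=> fu0 i.
have : \sum_j invmx f i j *: \sum_l f j l *: u l = 0.
  by rewrite big1 // => j _; rewrite fu0 scaler0.
under eq_bigr => j _ do rewrite scaler_sumr.
rewrite exchange_big /= => <-; rewrite (bigD1 i) //=.
have E l : \sum_j invmx f i j *: (f j l *: u l) = (invmx f *m f) i l *: u l.
  by rewrite mxE scaler_suml; apply: eq_bigr => j _; rewrite scalerA.
rewrite E mulVmx // mxE eqxx scale1r big1 ?addr0 // => l li.
by rewrite E mulVmx // mxE eq_sym (negPf li) scale0r.
Qed.

Lemma koszul_inj v : (forall s, v * xz s = 0) -> v = 0.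
Proof. by move/(_ None) => /(zr_eq0 sc). Qed.

(* Modulo z, the column of index (Some j) reads u_z (sum_i f_ij x_i) = 0, so
   that u_z = v z; and u - v X has vanishing z-component. *)
Lemma koszul_middle (u : option 'I_n -> B) :
  (forall t, \sum_s u s * hess s t = 0) -> exists v, forall s, u s = v * xz s.
Proof.
move=> u0; have n0 : (0 < n)%N by exact: ltnW.
have [v vE] : exists v, u None = v * z.
  apply/(coef0_eq0P sc); pose j := Ordinal n0.
  have := congr1 (coef 0) (u0 (Some j)); rewrite big_option hess_NS linearD.
  under [X in _ + _ X]eq_bigr => i _ do rewrite hess_SS -scalerAr scalerAl.
  rewrite -mulr_suml (coef_zr0 sc) addr0 linear0.
  have -> : \sum_i f i j *: X i = io (lform x (col j f)^T).
    rewrite linear_sum; apply: eq_bigr => i _.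
    by rewrite linearZ /= ioE !mxE.
  rewrite (coef_iotar sc) /= => /(lform_rreg n_ge2 f_unit ggA syzA); apply.
  apply/eqP => /rowP c0.
  have : row j (f^T *m invmx f^T) = 0.
    by rewrite row_mul (_ : row j f^T = 0) ?mul0mx //; apply/rowP => i; have := c0 i; rewrite !mxE.
  rewrite mulmxV ?unitmx_tr // => /rowP/(_ j)/eqP.
  by rewrite !mxE eqxx oner_eq0.
exists v => s; apply/eqP; rewrite -subr_eq0; apply/eqP.
pose u' s := u s - v * xz s.
have u'0 t : \sum_s u' s * hess s t = 0.
  under eq_bigr => s' _ do rewrite mulrBl -mulrA.
  by rewrite sumrB u0 -mulr_sumr xz_hess mulr0 subrr.
have u'N : u' None = 0 by rewrite /u' vE subrr.
rewrite -/(u' s); case: s => [i|//].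
apply: (f_scale_eq0 (u := fun i => u' (Some i))) => j.
apply: (zr_eq0 sc); rewrite -[RHS](u'0 (Some j)) big_option u'N mul0r add0r.
rewrite mulr_suml; apply: eq_bigr => l _.
by rewrite hess_SS -scalerAr scalerAl.
Qed.

Lemma comp_io d a : compB d (io a) = io (compA d a).
Proof.
have [ind _ _] := ggA; elim/ind: a d => [|c a b Ea Eb||a i Ea] d.
- by rewrite !linear0.
- by rewrite !linearP /= Ea Eb.
- by rewrite rmorph1 (comp1 ggA) (comp1 ggB); case: eqP; rewrite ?rmorph1 ?linear0.
rewrite rmorphM /= ioE -[X i]/(xz (Some i)); case: d => [|d].
  by rewrite (compXr0 ggB) (compXr0 ggA) linear0.
by rewrite (compXr ggB) (compXr ggA) Ea rmorphM /= ioE.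
Qed.

Definition hilbB d := (\sum_(i < d.+1) hilbA n i)%N.

(** [B_(d+1)] is the direct sum of [A_(d+1)] and [B_d z]: the first summand is the value of
    [coef 0], the second its kernel. *)
Lemma has_dim_gdegB d : has_dim (gdeg compB d) (hilbB d).
Proof.
have dimA := has_dim_gdegA n_ge2 f_unit ggA lrow_x syzA.
have dim_io e : has_dim (io @` gdeg compA e) (hilbA n e).
  apply: has_dim_image (dimA e) _ => a _ a0.
  by apply: (iota_inj sc); rewrite a0 linear0.
elim: d => [|d IH].
  rewrite /hilbB big_ord1; have := dim_io 0%N; congr has_dim.
  rewrite (gdeg0E ggB) (gdeg0E ggA); apply/seteqP; split=> [_ [_ [c _ <-] <-]|_ [c _ <-]].
    by exists c; rewrite // linearZ /= rmorph1.
  by exists (c%:A); [exists c | rewrite linearZ /= rmorph1].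
have z_lin : linear (fun b : B => b * z) by move=> c u v; rewrite mulrDl -scalerAl.
pose Z : {linear B -> B} := HB.pack (fun b : B => b * z)
  (GRing.isLinear.Build _ _ _ _ _ z_lin).
have dim_z : has_dim (Z @` gdeg compB d) (hilbB d).
  by apply: has_dim_image IH _ => b _; exact: (zr_eq0 sc).
rewrite /hilbB big_ord_recr /= addnC.
have -> : gdeg compB d.+1 = [set v | exists s t,
    [/\ (io @` gdeg compA d.+1) s, (Z @` gdeg compB d) t & v = s + t]].
  apply/seteqP; split=> [b hb|_ [_ [_ [[a ha <-] [b hb <-] ->]]]]; last first.
    rewrite /gdeg /= linearD /= comp_io ha -[z]/(xz None) (compXr ggB).
    by rewrite [compB d b]hb.
  have [b' b'E] : exists b', b - io (coef 0 b) = b' * z.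
    by apply/(coef0_eq0P sc); rewrite linearB /= (coef_iota sc) subrr.
  exists (io (compA d.+1 (coef 0 b))), (compB d b' * z); split.
  - by exists (compA d.+1 (coef 0 b)) => //; exact: (gdeg_homog ggA).
  - by exists (compB d b') => //; exact: (gdeg_homog ggB).
  rewrite -comp_io -[z]/(xz None) -(compXr ggB) -linearD /= -b'E addrC subrK.
  exact/esym/hb.
apply: has_dim_add (dim_io d.+1) dim_z _ => _ [a _ <-] [b _ /= bE].
by have := coef_iota sc 0 a; rewrite -bE /= (coef_zr0 sc) bE => <-; rewrite linear0.
Qed.

Lemma twist1P : twist f = 1%:M <-> f^T = - f.
Proof.
rewrite /twist; split=> [tf|fT].
  by rewrite -[f^T]mulmx1 -tf mulmxN mulmxA mulmxV ?unitmx_tr // mul1mx.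
by rewrite fT -mulmxN -fT mulVmx // unitmx_tr.
Qed.

(** Linear forms are independent in [A] and [z] is regular, so [z] commutes with [X i] exactly when
    row [i] of [twist f] is that of the identity. *)
Lemma z_central : central z <-> f^T = - f.
Proof.
have dz (i : 'I_n) : \sum_j (1%:M : 'M[k]_n) i j *: (X j * z) = X i * z.
  rewrite (bigD1 i) //= mxE eqxx scale1r big1 ?addr0 // => j.
  by rewrite mxE eq_sym => /negPf ->; rewrite scale0r.
rewrite -twist1P; split=> [cz|t1 b].
  apply/row_matrixP => i; apply/eqP; rewrite -subr_eq0; apply/eqP.
  apply: (lform_eq0 n_ge2 f_unit ggA syzA (x := x)).
  apply: (iota_inj sc); rewrite linear0; apply: (zr_eq0 sc).
  rewrite linearB /= linearB mulrBl /lform !linear_sum !mulr_suml.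
  rewrite [X in X - _](_ : _ = z * X i); last first.
    rewrite zX; apply: eq_bigr => j _.
    by rewrite linearZ /= ioE mxE scalerAl.
  rewrite -cz -[X in X * z - _]/(X i) -(dz i).
  rewrite -sumrB big1 // => j _; rewrite linearZ /= ioE.
  by rewrite [row i _ 0 j]mxE scalerAl subrr.
have [ind _ _] := ggB; elim/ind: b => [|c a b Ea Eb||a s Ea].
- by rewrite mul0r mulr0.
- by rewrite mulrDl mulrDr -scalerAl -scalerAr Ea Eb.
- by rewrite mul1r mulr1.
rewrite mulrA -Ea -!mulrA; congr (_ * _); case: s => [i|//] /=.
by rewrite zX t1 dz.
Qed.

Lemma alternating_antisym : alternating f -> f^T = - f.
Proof. by move=> [_ fN]; apply/matrixP => i j; rewrite !mxE fN. Qed.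

Lemma antisym_alternating : 2%N \notin [pchar k] -> f^T = - f -> alternating f.
Proof.
move=> c2 /matrixP fT.
have fN i j : f i j = - f j i by have := fT j i; rewrite !mxE.
split=> // i; apply/eqP; move: (fN i i) => /eqP.
rewrite -addr_eq0 -mulr2n -mulr_natl mulf_eq0 => /orP[two0|//].
by rewrite inE /= two0 in c2.
Qed.

End PotentialAlgebra.

(** * The enveloping algebra as a tensor product *)

Section Enveloping.
Local Open Scope classical_set_scope.
Variables (k : fieldType) (B : algType k).
Local Notation E := (env B).

Lemma env_presents : presents (@env_rel k B) (qpi (@env_rel k B)).
Proof. exact: qalg_presents. Qed.

Lemma env_rel0 r : @env_rel k B r -> qpi (@env_rel k B) r = 0.
Proof.
by move=> Gr; have [_ ker] := env_presents; apply/ker => J [_]; exact.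
Qed.

Lemma qpi_linear : linear (qpi (@env_rel k B)).
Proof. by move=> c a b; rewrite raddfD; congr (_ + _); exact: qpiZ. Qed.

Lemma tens_linl b : linear (fun a : B => tens a b : E).
Proof.
move=> c a a'; apply/eqP; rewrite -subr_eq0; apply/eqP.
rewrite /tens -qpi_linear -raddfB; apply: env_rel0.
by left; left; left; exists c, a, a', b.
Qed.

Lemma tens_linr a : linear (fun b : B => tens a b : E).
Proof.
move=> c b b'; apply/eqP; rewrite -subr_eq0; apply/eqP.
rewrite /tens -qpi_linear -raddfB; apply: env_rel0.
by left; left; right; exists c, a, b, b'.
Qed.

Lemma tensM a b a' b' : (tens a b : E) * tens a' b' = tens (a * a') (b' * b).
Proof.
apply/eqP; rewrite -subr_eq0; apply/eqP.
rewrite /tens -qpiM -raddfB; apply: env_rel0.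
by left; right; exists a, b, a', b'.
Qed.

Lemma tens11 : (tens 1 1 : E) = 1.
Proof.
apply/eqP; rewrite -subr_eq0; apply/eqP.
rewrite /tens -qpi1 -raddfB; apply: env_rel0; by right.
Qed.

Let tl b : {linear B -> E} := HB.pack (fun a : B => tens a b : E)
  (GRing.isLinear.Build _ _ _ _ _ (tens_linl b)).
Let tr a : {linear B -> E} := HB.pack (fun b : B => tens a b : E)
  (GRing.isLinear.Build _ _ _ _ _ (tens_linr a)).

Lemma tens0l b : (tens 0 b : E) = 0.
Proof. exact: (linear0 (tl b)). Qed.
Lemma tens0r a : (tens a 0 : E) = 0.
Proof. exact: (linear0 (tr a)). Qed.
Lemma tensNl a b : (tens (- a) b : E) = - tens a b.
Proof. exact: (linearN (tl b)). Qed.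
Lemma tensNr a b : (tens a (- b) : E) = - tens a b.
Proof. exact: (linearN (tr a)). Qed.
Lemma tensZl c a b : (tens (c *: a) b : E) = c *: tens a b.
Proof. exact: (linearZ_LR (tl b)). Qed.
Lemma tensZr c a b : (tens a (c *: b) : E) = c *: tens a b.
Proof. exact: (linearZ_LR (tr a)). Qed.
Lemma tens_suml (J : finType) (F : J -> B) b :
  (tens (\sum_j F j) b : E) = \sum_j tens (F j) b.
Proof. exact: (linear_sum (tl b)). Qed.
Lemma tens_sumr (J : finType) a (F : J -> B) :
  (tens a (\sum_j F j) : E) = \sum_j tens a (F j).
Proof. exact: (linear_sum (tr a)). Qed.

Lemma env_scaleAl (c : k) (u v : E) : c *: (u * v) = (c *: u) * v.
Proof. exact: qalg_scaleAl. Qed.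

Lemma env_scaleAr (c : k) (u v : E) : c *: (u * v) = u * (c *: v).
Proof. exact: qalg_scaleAr. Qed.

Lemma env_ind (P : E -> Prop) : P 0 ->
  (forall c u v, P u -> P v -> P (c *: u + v)) ->
  (forall a b, P (tens a b)) -> forall u, P u.
Proof.
move=> P0 PD Pt u; have [p_surj _] := env_presents; have [a <-] := p_surj u.
elim/freealg_ind: a => [|c a b Pa Pb|w]; first by rewrite raddf0.
  by rewrite qpi_linear; exact: PD.
suff [a [b ->]] : exists a b, qpi (@env_rel k B) (fword k w) = tens a b :> E by [].
elim: w => [|[a b] w [a' [b' IH]]].
  by exists 1, 1; rewrite fword0 qpi1 tens11.
by exists (a * a'), (b' * b); rewrite fword_cons qpiM IH -tensM.
Qed.

(** The universal property of the tensor product. A word in the symbols [a (x) b] is sent to [h] of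
    the product of first entries and of the reversed product of second entries, as multiplication in
    [B^e] prescribes. *)
Lemma env_lift (M : lmodType k) (h : B -> B -> M) :
  (forall b, linear (h^~ b)) -> (forall a, linear (h a)) ->
  exists H : {linear E -> M}, forall a b, H (tens a b) = h a b.
Proof.
move=> hl hr.
pose p1 (w : seq (B * B)) : B := \prod_(s <- w) s.1.
pose p2 (w : seq (B * B)) : B := \prod_(s <- rev w) s.2.
have p1_cat u v : p1 (u ++ v) = p1 u * p1 v by exact: big_cat.
have p2_cat u v : p2 (u ++ v) = p2 v * p2 u by rewrite /p2 rev_cat big_cat.
have p1_1 s : p1 [:: s] = s.1 by rewrite /p1 big_seq1.
have p2_1 s : p2 [:: s] = s.2 by rewrite /p2 big_seq1.
pose HF h' : {linear freealg k (env_gen B) -> M} := flin (fun w => h' (p1 w) (p2 w)).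
have HFw h' w : HF h' (fword k w) = h' (p1 w) (p2 w) by exact: flin_word.
pose bil (h' : B -> B -> M) :=
  (forall b, linear (h'^~ b)) /\ (forall a, linear (h' a)).
(* Multiplying by a word replaces [h'] by another bilinear map, so the induction has to quantify
   over all of them. *)
have HF0 a : ideal_gen (@env_rel k B) a -> forall h', bil h' -> HF h' a = 0.
  elim/ideal_gen_ind.
  - by move=> h' _; rewrite linear0.
  - by move=> c b b' Eb Eb' h' bh; rewrite linearP /= Eb // Eb' // scaler0 addr0.
  - move=> w b Eb h' [hl' hr'].
    have -> : HF h' (fword k w * b) = HF (fun a c => h' (p1 w * a) (c * p2 w)) b.
      elim/freealg_ind: b {Eb} => [|c b b' Eb Eb'|v].
      + by rewrite mulr0 !linear0.
      + by rewrite mulrDr -scalerAr !linearP Eb Eb'.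
      by rewrite fwordM !HFw p1_cat p2_cat.
    apply: Eb; split=> [b1|a1] c u v /=.
      by rewrite mulrDr -scalerAr hl'.
    by rewrite mulrDl -scalerAl hr'.
  - move=> w b Eb h' [hl' hr'].
    have -> : HF h' (b * fword k w) = HF (fun a c => h' (a * p1 w) (p2 w * c)) b.
      elim/freealg_ind: b {Eb} => [|c b b' Eb Eb'|v].
      + by rewrite mul0r !linear0.
      + by rewrite mulrDl -scalerAl !linearP Eb Eb'.
      by rewrite fwordM !HFw p1_cat p2_cat.
    apply: Eb; split=> [b1|a1] c u v /=.
      by rewrite mulrDl -scalerAl hl'.
    by rewrite mulrDr -scalerAr hr'.
  move=> _ [[[[c [a' [a'' [b ->]]]]|[c [a' [b [b' ->]]]]]|[a' [b [a'' [b' ->]]]]]|->] h' [hl' hr'].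
  - by rewrite linearB linearP /= !HFw !p1_1 !p2_1 /= hl' subrr.
  - by rewrite linearB linearP /= !HFw !p1_1 !p2_1 /= hr' subrr.
  - by rewrite linearB fwordM !HFw p1_cat p2_cat !p1_1 !p2_1 subrr.
  - rewrite linearB -fword0 /= !HFw !p1_1 !p2_1 /p1 /p2 !big_nil subrr.
    by [].
have [|H HE] := @presents_desc _ _ _ _ _ (HB.pack (qpi (@env_rel k B))
  (GRing.isLinear.Build _ _ _ _ _ qpi_linear) : {linear freealg k (env_gen B) -> E})
  (HF h) env_presents.
  by move=> a /HF0; apply.
exists H => a b; transitivity (HF h (@fgen k (env_gen B) (a, b))).
  exact: HE.
by rewrite HFw p1_1 p2_1.
Qed.

Lemma env_flip : exists tau : {linear E -> E},
  [/\ forall a b, tau (tens a b) = tens b a, forall u v, tau (u * v) = tau v * tau u &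
    forall u, tau (tau u) = u].
Proof.
have [tau tauE] := @env_lift E (fun a b => tens b a) tens_linr tens_linl.
exists tau; split=> [//|u v|u].
  elim/env_ind: u => [|c u u' Eu Eu'|a b].
  - by rewrite mul0r linear0 mulr0.
  - by rewrite mulrDl -env_scaleAl !linearP /= Eu Eu' mulrDr env_scaleAr.
  elim/env_ind: v => [|c v v' Ev Ev'|a' b'].
  - by rewrite mulr0 linear0 mul0r.
  - by rewrite mulrDr -env_scaleAr !linearP /= Ev Ev' mulrDl env_scaleAl.
  by rewrite tensM !tauE tensM.
elim/env_ind: u => [|c u u' Eu Eu'|a b]; first by rewrite !linear0.
  by rewrite !linearP /= Eu Eu'.
by rewrite !tauE.
Qed.

Lemma env_mult : exists eps : {linear E -> B},
  [/\ forall a b, eps (tens a b) = a * b &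
    forall a b u, eps (tens a b * u) = a * eps u * b].
Proof.
have [||eps epsE] := @env_lift B (fun a b => a * b).
- by move=> b c a a'; rewrite mulrDl -scalerAl.
- by move=> a c b b'; rewrite mulrDr -scalerAr.
exists eps; split=> // a b; elim/env_ind => [|c u u' Eu Eu'|a' b'].
- by rewrite mulr0 !linear0 mulr0 mul0r.
- rewrite mulrDr -env_scaleAr !linearP /= Eu Eu'.
  by rewrite mulrDr mulrDl -scalerAr -scalerAl.
by rewrite tensM !epsE !mulrA.
Qed.

(** Applying coordinate forms to the second factor detects elements of [B^e] without a basis of the
    tensor product. *)
Lemma env_slice (l : {linear B -> k^o}) : exists S : {linear E -> B},
  forall a b, S (tens a b) = (l b : k) *: a.
Proof.
apply: env_lift => [b c a a'|a c b b'].
  by rewrite scalerDr !scalerA mulrC.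
by rewrite linearP scalerDl scalerA.
Qed.

End Enveloping.

(** * Exactness of bimodule complexes from exactness of one-sided ones *)

Section GradedBasis.
Local Open Scope classical_set_scope.
Variables (k : fieldType) (I : finType) (B : algType k) (X : I -> B).
Variable comp : nat -> {linear B -> B}.
Hypothesis gg : graded_gen X comp.

(** Basis and coordinate forms are indexed by all of [nat], with value 0 from [D] on; their type is
    then independent of [d], and [choice] can collect them. *)
Lemma graded_basis d D : has_dim (gdeg comp d) D ->
  exists el : (nat -> B) * (nat -> {linear B -> k^o}),
  [/\ forall i, (i < D)%N -> gdeg comp d (el.1 i),
      forall b, comp d b = \sum_(i < D) (el.2 i b : k) *: el.1 i,
      forall i b, el.2 i (comp d b) = el.2 i b &
      forall i j, (i < D)%N -> (j < D)%N -> el.2 i (el.1 j) = (i == j)%:R].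
Proof.
move=> /has_dimP[phi phi_inj phiE].
have /choice[c cE] b : exists x, phi x = comp d b.
  by have /phiE[x ->] := gdeg_homog gg d b; exists x.
have c_lin : linear c.
  by move=> a u v; apply: phi_inj; rewrite linearP !cE linearP.
have cphi x : c (phi x) = x.
  by apply: phi_inj; rewrite cE; apply/phiE; exists x.
have l_lin (i : 'I_D) : linear (fun b => c b 0 i : k^o).
  by move=> a u v; rewrite c_lin !mxE.
pose L (i : 'I_D) : {linear B -> k^o} := HB.pack (fun b => c b 0 i : k^o)
  (GRing.isLinear.Build _ _ _ _ _ (l_lin i)).
pose e i : B := if insub i is Some i' then phi (delta_mx 0 i') else 0.
pose l i : {linear B -> k^o} := if insub i is Some i' then L i' else \0.
have eE (i : 'I_D) : e i = phi (delta_mx 0 i) by rewrite /e valK.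
have lE (i : 'I_D) : l i = L i by rewrite /l valK.
exists (e, l); split=> /= [i iD|b|i b|i j iD jD].
- by rewrite -[i]/(val (Ordinal iD)) eE; apply/phiE; eexists.
- rewrite -cE [c b]row_sum_delta linear_sum; apply: eq_bigr => i _.
  by rewrite linearZ /= eE lE.
- rewrite /l; case: insubP => //= i' _ _.
  suff -> : c (comp d b) = c b by [].
  by apply: phi_inj; rewrite !cE (comp_id gg).
rewrite -[i]/(val (Ordinal iD)) -[j]/(val (Ordinal jD)) eE lE /= cphi mxE eqxx /=.
by [].
Qed.

End GradedBasis.

Section Lifting.
Local Open Scope classical_set_scope.
Variables (k : fieldType) (I : finType) (B : algType k) (X : I -> B).
Variable comp : nat -> {linear B -> B}.
Hypothesis gg : graded_gen X comp.
Variables (D : nat -> nat) (e : nat -> nat -> B) (l : nat -> nat -> {linear B -> k^o}).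
Hypotheses (e_deg : forall d i, (i < D d)%N -> gdeg comp d (e d i))
  (comp_e : forall d b, comp d b = \sum_(i < D d) (l d i b : k) *: e d i)
  (l_comp : forall d i b, l d i (comp d b) = l d i b)
  (l_e : forall d i j, (i < D d)%N -> (j < D d)%N -> l d i (e d j) = (i == j)%:R).
Local Notation E := (env B).
Variable S : nat -> nat -> {linear E -> B}.
Hypothesis S_tens : forall d i a b, S d i (tens a b) = (l d i b : k) *: a.

Lemma l_deg d d' i b : d != d' -> gdeg comp d' b -> l d i b = 0.
Proof.
by move=> dd hb; rewrite -l_comp -hb (comp_comp gg) (negPf dd) linear0.
Qed.

Lemma slice_expand u : exists N, forall M, (N <= M)%N ->
  u = \sum_(d < M) \sum_(i < D d) tens (S d i u) (e d i).
Proof.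
elim/env_ind: u => [|c u v [N uN] [N' vN']|a b].
- exists 0%N => M _; rewrite big1 // => d _; rewrite big1 // => i _.
  by rewrite linear0 tens0l.
- exists (maxn N N') => M; rewrite geq_max => /andP[/uN uE /vN' vE].
  rewrite {1}uE {1}vE scaler_sumr -big_split; apply: eq_bigr => d _ /=.
  rewrite scaler_sumr -big_split; apply: eq_bigr => i _ /=.
  by rewrite linearP /= tens_linl.
have [N bN] := dlt_bound gg b; exists N => M /bN[bE _].
rewrite {1}bE tens_sumr; apply: eq_bigr => d _.
rewrite comp_e tens_sumr; apply: eq_bigr => i _.
by rewrite S_tens tensZl tensZr.
Qed.

Lemma slice_eq0 u : (forall d i, (i < D d)%N -> S d i u = 0) -> u = 0.
Proof.
move=> u0; have [N /(_ N (leqnn N)) ->] := slice_expand u.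
by rewrite big1 // => d _; rewrite big1 // => i _; rewrite u0 // tens0l.
Qed.

(** A bound on the total degree: the first factor has degree less than [r - d] where the second has
    degree [d]. *)
Lemma slice_bound u : exists r, forall d i, dlt comp (r - d) (S d i u).
Proof.
elim/env_ind: u => [|c u v [r ur] [r' vr]|a b].
- by exists 0%N => d i; rewrite linear0; exact: dlt0.
- exists (maxn r r') => d i; rewrite linearP; apply: dltP.
    by apply: dlt_leq (ur d i); rewrite leq_sub2r // leq_maxl.
  by apply: dlt_leq (vr d i); rewrite leq_sub2r // leq_maxr.
have [m am] := dlt_exists gg a; have [m' bm] := dlt_exists gg b.
exists (m + m')%N => d i; rewrite S_tens; case: (ltnP d m') => [dm|md].
  apply: dltZ; apply: dlt_leq am; rewrite -addnBA ?leq_addr //; exact: ltnW.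
by rewrite -l_comp bm // linear0 scale0r; exact: dlt0.
Qed.

Lemma slice_mull d i u c : S d i (u * tens c 1) = S d i u * c.
Proof.
elim/env_ind: u => [|x u v Eu Ev|a b]; first by rewrite mul0r !linear0 mul0r.
  by rewrite mulrDl -env_scaleAl !linearP /= Eu Ev mulrDl -scalerAl.
by rewrite tensM mul1r !S_tens scalerAl.
Qed.

(* Right multiplication by 1 (x) c raises the degree of the second factor. *)
Lemma slice_mulr d i u c : gdeg comp 1 c ->
  (forall d' j, (d' < d)%N -> (j < D d')%N -> S d' j u = 0) ->
  S d i (u * tens 1 c) = 0.
Proof.
move=> hc u0; have [N /(_ N (leqnn N)) ->] := slice_expand u.
rewrite mulr_suml linear_sum big1 // => d' _.
rewrite mulr_suml linear_sum big1 // => j _.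
case: (ltnP d' d) => [dd|dd]; first by rewrite u0 // tens0l mul0r linear0.
rewrite tensM mulr1 S_tens (l_deg (d' := d'.+1)) ?scale0r //.
  by rewrite neq_ltn ltnS dd.
by have := gdegM gg hc (e_deg (ltn_ord j)); rewrite add1n.
Qed.

Lemma truncM1 r b c : gdeg comp 1 c ->
  trunc comp r.+1 (b * c) = trunc comp r b * c.
Proof.
move=> hc; rewrite /trunc mulr_suml big_ord_recl.
have cE d : comp d c = if d == 1%N then c else 0.
  by rewrite -[X in comp _ X]hc (comp_comp gg); case: eqP => [->|]; rewrite ?hc.
have hM d : comp d (b * c) = if d is d'.+1 then comp d' b * c else 0.
  rewrite (compM gg); case: d => [|d].
    by rewrite big_ord1 cE mulr0.
  rewrite big_ord_recr big_ord_recr /= subnn subSnn !cE /= mulr0 addr0.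
  rewrite big1 ?add0r // => i _.
  rewrite cE (_ : (_ == _) = false) ?mulr0 //=.
  by rewrite subSn 1?ltnW // eqSS subn_eq0 leqNgt ltn_ord.
by rewrite hM add0r; apply: eq_bigr => d _; rewrite hM.
Qed.

Variables T1 T2 T3 : finType.
Variables (M N : T2 -> T3 -> B) (M' N' : T1 -> T2 -> B).
Let Dif s t : E := tens (M s t) 1 + tens 1 (N s t).
Let Dif' a s : E := tens (M' a s) 1 + tens 1 (N' a s).
Hypotheses (N_deg : forall s t, gdeg comp 1 (N s t))
  (M'_deg : forall s t, gdeg comp 1 (M' s t))
  (N'_deg : forall s t, gdeg comp 1 (N' s t)).
Hypothesis Dif0 : forall a t, \sum_s Dif' a s * Dif s t = 0.
Hypothesis exactM : forall u : T2 -> B, (forall t, \sum_s u s * M s t = 0) ->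
  exists v : T1 -> B, forall s, u s = \sum_a v a * M' a s.

(* The component of lowest degree in the second factor of a cycle u for
   M (x) 1 + 1 (x) N is a cycle for M (x) 1, hence can be removed by subtracting
   a boundary; the total degree being bounded, this terminates. *)
Lemma exact_lift (u : T2 -> E) : (forall t, \sum_s u s * Dif s t = 0) ->
  exists v : T1 -> E, forall s, u s = \sum_a v a * Dif' a s.
Proof.
move=> u0; have /choice[b bP] s := slice_bound (u s).
have [r ur] : exists r, forall s d i, (i < D d)%N ->
    dlt comp (0 + r - d) (S d i (u s)).
  exists (\max_s b s) => s d i _.
  by apply: dlt_leq (bP s d i); rewrite add0n leq_sub2r //; exact: leq_bigmax.
have ulow s d i : (d < 0)%N -> (i < D d)%N -> S d i (u s) = 0 by [].
(* The total degree stays below [d + r], and the second factor has degree at least [d]. Each step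
   trades one unit of [r] for one of [d], until nothing is left. *)
elim: r 0%N u u0 ur ulow {b bP} => [|r IH] d u u0 ur ulow.
  exists (fun=> 0) => s; rewrite big1 => [|a _]; last by rewrite mul0r.
  apply: slice_eq0 => d' i iD; case: (ltnP d' d) => [dd|dd]; first exact: ulow.
  apply: (dlt0_eq0 gg); have := ur s d' i iD.
  by rewrite addn0 (eqP (_ : (d - d')%N == 0%N)) // subn_eq0.
have /choice[v vP] i : exists v : T1 -> B, (i < D d)%N ->
    (forall s, S d i (u s) = \sum_a v a * M' a s) /\ forall a, dlt comp r (v a).
  case: (ltnP i (D d)) => [iD|]; last by exists (fun=> 0).
  have [|v vE] := exactM (u := fun s => S d i (u s)).
    move=> t; have := congr1 (S d i) (u0 t); rewrite linear0 linear_sum => Su0; rewrite -[RHS]Su0.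
    apply: eq_bigr => s _; rewrite mulrDr linearD /= slice_mull.
    by rewrite slice_mulr ?addr0 // => d' j dd jD; exact: ulow.
  (* Truncation keeps the total degree bounded. The equation survives it because [M'] is homogeneous
     of degree 1 and [S d i (u s)] has degree at most [r]. *)
  exists (fun a => trunc comp r (v a)) => _; split=> [s|a]; last exact: (dlt_trunc gg).
  have := ur s d i iD; rewrite addnC addnK => /(trunc_id gg) <-.
  by rewrite vE linear_sum; apply: eq_bigr => a _; exact: truncM1.
(* In the boundary of [w] the [M'] part lies in slice [d], where it equals [u], and the [N'] part in
   slice [d + 1]; subtracting it empties slice [d] and leaves the lower ones empty. *)
pose w a : E := \sum_(i < D d) tens (v i a) (e d i).
pose u' s := u s - \sum_a w a * Dif' a s.
have SwD d' j a s : S d' j (w a * Dif' a s) = \sum_(i < D d)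
    ((l d' j (e d i) : k) *: (v i a * M' a s) + (l d' j (N' a s * e d i) : k) *: v i a).
  rewrite mulr_suml linear_sum; apply: eq_bigr => i _.
  by rewrite mulrDr linearD /= !tensM mul1r mulr1 !S_tens.
have le0 d' j i : d' != d -> (i < D d)%N -> l d' j (e d i) = 0 :> k.
  by move=> dd iD; apply: (l_deg j dd); exact: e_deg.
have lN0 d' j i a s : d' != d.+1 -> (i < D d)%N -> l d' j (N' a s * e d i) = 0 :> k.
  move=> dd iD; apply: (l_deg j dd).
  by have := gdegM gg (N'_deg a s) (e_deg iD); rewrite add1n.
have SwD_low d' j a s : (d' < d)%N -> S d' j (w a * Dif' a s) = 0.
  move=> dd; have dd1 : (d' < d.+1)%N by exact: ltnW.
  by rewrite SwD big1 // => i _; rewrite le0 ?ltn_eqF // lN0 ?ltn_eqF // !scale0r addr0.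
have SwD_eq (j : 'I_(D d)) a s : S d j (w a * Dif' a s) = v j a * M' a s.
  have lN (i : 'I_(D d)) : l d j (N' a s * e d i) = 0 :> k by rewrite lN0 // ltn_eqF.
  rewrite SwD (bigD1 j) //= l_e // eqxx lN scale1r scale0r addr0 big1 ?addr0 // => i ij.
  by rewrite l_e // lN eq_sym (negPf ij : (i == j :> nat) = false) !scale0r addr0.
have [|s d' i iD|s d' i dd iD|v' v'E] := IH d.+1 u'.
- move=> t; under eq_bigr => s _ do rewrite mulrBl mulr_suml.
  rewrite sumrB u0 exchange_big /= big1 ?subr0 // => a _.
  under eq_bigr => s _ do rewrite -mulrA.
  by rewrite -mulr_sumr Dif0 mulr0.
- rewrite linearB linear_sum addSnnS -scaleN1r addrC; apply: dltP; last exact: ur.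
  apply: dlt_sumr => a; case: (ltngtP d' d) => [id|di|dd].
  + by rewrite SwD_low //; exact: dlt0.
  + rewrite SwD; apply: dlt_sumr => j.
    rewrite le0 ?gtn_eqF // scale0r add0r.
    have [->|id] := eqVneq d' d.+1; last by rewrite lN0 // scale0r; exact: dlt0.
    apply: dltZ; rewrite addnS subSS addKn.
    by have [_] := vP j (ltn_ord j); apply.
  rewrite dd in iD *; rewrite -[i]/(val (Ordinal iD)) SwD_eq addKn -addn1.
  have [_ va] := vP i iD.
  exact: (dltM gg (va a) (gdeg_dlt gg (M'_deg a s))).
- rewrite linearB linear_sum; move: dd; rewrite ltnS leq_eqVlt => /predU1P[dd|dd].
    rewrite dd in iD *; have [-> _] := vP i iD; apply/eqP; rewrite subr_eq0.
    apply/eqP; apply: eq_bigr => a _.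
    by rewrite -[i in RHS]/(val (Ordinal iD)) SwD_eq.
  by rewrite ulow // sub0r big1 ?oppr0 // => a _; exact: SwD_low.
exists (fun a => v' a + w a) => s.
under eq_bigr => a _ do rewrite mulrDl.
by rewrite big_split /= -v'E subrK.
Qed.

End Lifting.

(** * The Koszul resolution, its bimodule version and self-duality *)

Section KoszulCalabiYau.
Local Open Scope classical_set_scope.
Variables (k : fieldType) (N : nat) (B : algType k) (X : 'I_N -> B).
Variable comp : nat -> {linear B -> B}.
Variables (w : 'I_N -> 'I_N -> 'I_N -> k) (m : 'I_N -> 'I_N -> B).
Hypothesis gg : graded_gen X comp.
Hypothesis w_cyc : forall a b c, w a b c = w b c a.
Hypothesis mE : forall a b, m a b = \sum_c w a c b *: X c.
Hypothesis m_X : forall a, \sum_b m a b * X b = 0.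
Hypothesis X_m : forall b, \sum_a X a * m a b = 0.
Hypothesis exact0 : forall a : 'I_N -> B, \sum_s a s * X s = 0 ->
  exists u : 'I_N -> B, forall t, a t = \sum_s u s * m s t.
Hypothesis exact1 : forall u : 'I_N -> B, (forall t, \sum_s u s * m s t = 0) ->
  exists v, forall s, u s = v * X s.
Hypothesis exact2 : forall v : B, (forall s, v * X s = 0) -> v = 0.
Hypothesis fin_dim : forall d, exists D, has_dim (gdeg comp d) D.

Definition krank (i : nat) : nat :=
  match i with 0 => 1 | 1 => N | 2 => N | 3 => 1 | _ => 0 end.

Definition kcol : 'M[B]_(N, 1) := \matrix_(i, j) X i.
Definition khess : 'M[B]_N := \matrix_(i, j) m i j.
Definition krow : 'M[B]_(1, N) := \matrix_(i, j) X j.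

Definition kmx (i : nat) : 'M[B]_(krank i.+1, krank i) :=
  match i return 'M[B]_(krank i.+1, krank i) with
  | 0 => kcol | 1 => khess | 2 => krow | _ => 0
  end.

Lemma m_deg a b : gdeg comp 1 (m a b).
Proof.
rewrite /gdeg /= mE linear_sum; apply: eq_bigr => c _.
by rewrite linearZ /= (gdegX gg c).
Qed.

Lemma kmx_deg i p q : gdeg comp 1 (kmx i p q).
Proof.
case: i p q => [|[|[|i]]] p q; rewrite /= mxE.
- exact: (gdegX gg).
- exact: m_deg.
- exact: (gdegX gg).
exact: linear0.
Qed.

Lemma khess_col : khess *m kcol = 0.
Proof.
apply/matrixP => i j; rewrite !mxE -[RHS](m_X i).
by apply: eq_bigr => l _; rewrite !mxE.
Qed.

Lemma krow_hess : krow *m khess = 0.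
Proof.
apply/matrixP => i j; rewrite !mxE -[RHS](X_m j).
by apply: eq_bigr => l _; rewrite !mxE.
Qed.

Lemma kcol_exact (u : 'rV[B]_N) : u *m kcol = 0 -> exists v, u = v *m khess.
Proof.
move=> /matrixP/(_ 0 0); rewrite !mxE => u0.
have [|v vE] := exact0 (a := u 0).
  by rewrite -[RHS]u0; apply: eq_bigr => s _; rewrite mxE.
exists (\row_s v s); apply/rowP => t; rewrite vE mxE.
by apply: eq_bigr => s _; rewrite !mxE.
Qed.

Lemma khess_exact (u : 'rV[B]_N) : u *m khess = 0 -> exists v, u = v *m krow.
Proof.
move=> /matrixP u0; have [t|v vE] := exact1 (u := u 0).
  have := u0 0 t; rewrite !mxE => u0t; rewrite -[RHS]u0t.
  by apply: eq_bigr => s _; rewrite mxE.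
exists (const_mx v); apply/rowP => t; rewrite vE mxE big_ord1 !mxE.
by [].
Qed.

Lemma krow_exact (u : 'rV[B]_1) : u *m krow = 0 -> exists v, u = v *m (0 : 'M[B]_(0, 1)).
Proof.
move=> /matrixP u0; exists 0; rewrite mulmx0; apply/rowP => j; rewrite ord1 mxE.
apply: exact2 => s; have := u0 0 s; rewrite !mxE big_ord1 mxE; exact.
Qed.

Lemma rV0_eq (R : nmodType) (u v : 'rV[R]_0) : u = v.
Proof. by apply/rowP => -[]. Qed.

Lemma kmx_exact i (u : 'rV[B]_(krank i.+1)) :
  u *m kmx i = 0 <-> exists v, u = v *m kmx i.+1.
Proof.
split.
  case: i u => [|[|[|i]]] u /=; [exact: kcol_exact | exact: khess_exact |
    exact: krow_exact | by move=> _; exists 0; exact: rV0_eq].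
case=> v ->; rewrite -mulmxA; case: i v {u} => [|[|[|i]]] v /=.
- by rewrite khess_col mulmx0.
- by rewrite krow_hess mulmx0.
- by rewrite mul0mx mulmx0.
- by rewrite mulmx0 mulmx0.
Qed.

Lemma koszul_gdeg : koszul (gdeg comp).
Proof.
split; [exact: (gdeg_connected gg) | exact: fin_dim |].
exists krank, kmx; split=> //; [exact: kmx_deg | move=> u | exact: kmx_exact].
split=> [/(_ 0)/(augmentation_idealE gg)[v vE]|[v ->] q].
  exists (\row_s v s); apply/rowP => j; rewrite [j]ord1 vE mxE.
  by apply: eq_bigr => s _; rewrite !mxE.
apply/(augmentation_idealE gg); exists (v 0); rewrite mxE.
by apply: eq_bigr => s _; rewrite mxE.
Qed.

Local Notation E := (env B).

(* The bimodule Koszul complex: M (x) 1 + 1 (x) M'. *)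
Definition bimx r s (M M' : 'M[B]_(r, s)) : 'M[E]_(r, s) :=
  \matrix_(i, j) (tens (M i j) 1 + tens 1 (M' i j)).

Definition bcol := bimx kcol (- kcol).
Definition bhess := bimx khess khess^T.
Definition brow := bimx krow (- krow).

Definition bmx (i : nat) : 'M[E]_(krank i.+1, krank i) :=
  match i return 'M[E]_(krank i.+1, krank i) with
  | 0 => bcol | 1 => bhess | 2 => brow | _ => 0
  end.

(** Both sides are the sum over [b] and [c] of [w_acb X_c (x) X_b], by cyclic invariance. This
    identity and the next cancel the mixed terms of consecutive differentials. *)
Lemma tens_m_Xr a :
  \sum_b (tens (m a b) (X b) : E) = \sum_b tens (X b) (m b a).
Proof.
under eq_bigr => b _ do rewrite mE tens_suml.
rewrite exchange_big; apply: eq_bigr => b _ /=.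
rewrite mE tens_sumr; apply: eq_bigr => c _.
by rewrite tensZl tensZr w_cyc.
Qed.

Lemma tens_m_Xl b :
  \sum_a (tens (m a b) (X a) : E) = \sum_a tens (X a) (m b a).
Proof.
under eq_bigr => a _ do rewrite mE tens_suml.
rewrite exchange_big; apply: eq_bigr => a _ /=.
rewrite mE tens_sumr; apply: eq_bigr => c _.
by rewrite tensZl tensZr w_cyc w_cyc.
Qed.

Lemma bhess_col : bhess *m bcol = 0.
Proof.
apply/matrixP => a j; rewrite !mxE.
have E1 b : bhess a b * bcol b j = (tens (m a b * X b) 1 - tens (m a b) (X b)) +
    (tens (X b) (m b a) - tens 1 (X b * m b a)).
  by rewrite !mxE mulrDl !mulrDr !tensM !mulr1 !mul1r mulNr !tensNr.
under eq_bigr => b _ do rewrite E1.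
rewrite big_split /= !sumrB -tens_suml -tens_sumr m_X X_m tens0l tens0r.
by rewrite tens_m_Xr sub0r subr0 addNr.
Qed.

Lemma brow_hess : brow *m bhess = 0.
Proof.
apply/matrixP => j b; rewrite !mxE.
have E1 a : brow j a * bhess a b = (tens (X a * m a b) 1 - tens (m a b) (X a)) +
    (tens (X a) (m b a) - tens 1 (m b a * X a)).
  rewrite !mxE mulrDl !mulrDr !tensM !mulr1 !mul1r mulrN !tensNr.
  by rewrite addrACA.
under eq_bigr => a _ do rewrite E1.
rewrite big_split /= !sumrB -tens_suml -tens_sumr m_X X_m tens0l tens0r.
by rewrite tens_m_Xl sub0r subr0 addNr.
Qed.

Variable D : nat -> nat.
Variables (e : nat -> nat -> B) (l : nat -> nat -> {linear B -> k^o}).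
Hypotheses (e_deg : forall d i, (i < D d)%N -> gdeg comp d (e d i))
  (comp_e : forall d b, comp d b = \sum_(i < D d) (l d i b : k) *: e d i)
  (l_comp : forall d i b, l d i (comp d b) = l d i b)
  (l_e : forall d i j, (i < D d)%N -> (j < D d)%N -> l d i (e d j) = (i == j)%:R).
Variable S : nat -> nat -> {linear E -> B}.
Hypothesis S_tens : forall d i a b, S d i (tens a b) = (l d i b : k) *: a.

Lemma bimx_exact r1 r2 r3 (M N' : 'M[B]_(r2, r3)) (M' N'' : 'M[B]_(r1, r2)) :
  (forall i j, gdeg comp 1 (N' i j)) -> (forall i j, gdeg comp 1 (M' i j)) ->
  (forall i j, gdeg comp 1 (N'' i j)) ->
  bimx M' N'' *m bimx M N' = 0 ->
  (forall u : 'rV_r2, u *m M = 0 -> exists v, u = v *m M') ->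
  forall u : 'rV[E]_r2, u *m bimx M N' = 0 -> exists v, u = v *m bimx M' N''.
Proof.
move=> N'_deg M'_deg N''_deg /matrixP D0 exM u /matrixP u0.
have D0' a t : \sum_s (tens (M' a s) 1 + tens 1 (N'' a s)) *
    (tens (M s t) 1 + tens 1 (N' s t)) = 0 :> E.
  have := D0 a t; rewrite !mxE => D0at; rewrite -[RHS]D0at.
  by apply: eq_bigr => s _; rewrite !mxE.
have exM' u' : (forall t, \sum_s u' s * M s t = 0) ->
    exists v : 'I_r1 -> B, forall s, u' s = \sum_a v a * M' a s.
  move=> u'0; have [|v vE] := exM (\row_s u' s).
    apply/rowP => t; rewrite !mxE -[RHS](u'0 t).
    by apply: eq_bigr => s _; rewrite mxE.
  exists (v 0) => s; have /rowP/(_ s) := vE; rewrite !mxE; exact.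
have u0' t : \sum_s u 0 s * (tens (M s t) 1 + tens 1 (N' s t)) = 0.
  have := u0 0 t; rewrite !mxE => u0t; rewrite -[RHS]u0t.
  by apply: eq_bigr => s _; rewrite !mxE.
have [v vE] := exact_lift gg e_deg comp_e l_comp l_e S_tens
  N'_deg M'_deg N''_deg D0' exM' u0'.
exists (\row_a v a); apply/rowP => s; rewrite vE mxE.
by apply: eq_bigr => a _; rewrite !mxE.
Qed.

Lemma gdegN d b : gdeg comp d b -> gdeg comp d (- b).
Proof. by rewrite /gdeg /= linearN => ->. Qed.

Lemma bcol_exact (u : 'rV[E]_N) : u *m bcol = 0 -> exists v, u = v *m bhess.
Proof.
apply: (bimx_exact _ _ _ bhess_col kcol_exact) => i j; rewrite !mxE.
- by apply: gdegN; exact: (gdegX gg).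
- exact: m_deg.
exact: m_deg.
Qed.

Lemma bhess_exact (u : 'rV[E]_N) : u *m bhess = 0 -> exists v, u = v *m brow.
Proof.
apply: (bimx_exact _ _ _ brow_hess khess_exact) => i j; rewrite !mxE.
- exact: m_deg.
- exact: (gdegX gg).
by apply: gdegN; exact: (gdegX gg).
Qed.

Lemma brow_exact (u : 'rV[E]_1) : u *m brow = 0 -> u = 0.
Proof.
(* Injectivity is exactness with a matrix without rows as the preceding differential. *)
move=> u0; have [||||v ->] := bimx_exact (M := krow) (N' := - krow)
  (M' := 0 : 'M_(0, 1)) (N'' := 0) _ _ _ _ krow_exact u0.
- by move=> i j; rewrite !mxE; apply: gdegN; exact: (gdegX gg).
- by move=> [].
- by move=> [].
- by apply/matrixP => -[].
by apply/rowP => j; rewrite !mxE big_ord0.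
Qed.

Variable eps : {linear E -> B}.
Hypothesis eps_tens : forall a b, eps (tens a b) = a * b.
Hypothesis eps_bimod : forall a b u, eps (tens a b * u) = a * eps u * b.

Lemma eps_bcol (v : 'rV[E]_N) : eps ((v *m bcol) 0 0) = 0.
Proof.
rewrite mxE linear_sum big1 // => s _; rewrite !mxE.
elim/env_ind: (v 0 s) => [|c u u' Eu Eu'|a b]; first by rewrite mul0r linear0.
  by rewrite mulrDl -env_scaleAl linearP /= Eu Eu' scaler0 addr0.
rewrite tensNr mulrBr linearB !tensM !eps_tens !mulr1 mul1r mulrA.
by rewrite subrr.
Qed.

(* Modulo the left ideal generated by the X (x) 1 - 1 (x) X, every a (x) b is
   congruent to ab (x) 1. *)
Lemma eps_exact (u : 'rV[E]_1) : eps (u 0 0) = 0 -> exists v, u = v *m bcol.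
Proof.
pose J : set E := [set u | exists v : 'rV[E]_N, (v *m bcol) 0 0 = u].
have J0 : J 0 by exists 0; rewrite mul0mx mxE.
have JD a b : J a -> J b -> J (a + b).
  by move=> [v <-] [v' <-]; exists (v + v'); rewrite mulmxDl mxE.
have JM a b : J b -> J (a * b).
  by move=> [v <-]; exists (a *: v); rewrite -scalemxAl mxE.
have JZ c b : J b -> J (c *: b).
  by move=> Jb; rewrite -[b]mul1r env_scaleAl; exact: JM.
have JX s : J (tens (X s) 1 - tens 1 (X s)).
  exists (delta_mx 0 s); rewrite mxE (bigD1 s) //= !mxE !eqxx mul1r tensNr.
  by rewrite big1 ?addr0 // => t /negPf ts; rewrite mxE ts mul0r.
have J1 b : J (tens b 1 - tens 1 b).
  have [ind _ _] := gg; elim/ind: b => [|c a b Ja Jb||b s Jb].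
  - by rewrite tens0l tens0r subrr.
  - rewrite tens_linl tens_linr opprD addrACA -scalerBr.
    by apply: JD => //; exact: JZ.
  - by rewrite subrr.
  (* The difference telescopes along the letters, each term being a left multiple of an element of
     [J]. *)
  have -> : tens (b * X s) 1 - tens 1 (b * X s) =
      tens b 1 * (tens (X s) 1 - tens 1 (X s)) +
      tens 1 (X s) * (tens b 1 - tens 1 b) :> E.
    by rewrite !mulrBr !tensM !mulr1 !mul1r addrA subrK.
  by apply: JD; exact: JM.
have Jeps v : J (v - tens (eps v) 1).
  elim/env_ind: v => [|c a b Ja Jb|a b].
  - by rewrite linear0 tens0l subrr.
  - rewrite linearP tens_linl opprD addrACA -scalerBr.
    by apply: JD => //; exact: JZ.
  have -> : tens a b - tens (eps (tens a b)) 1 =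
      - 1 * (tens a 1 * (tens b 1 - tens 1 b)) :> E.
    by rewrite mulrBr !tensM !mulr1 eps_tens mulN1r opprB.
  exact/JM/JM/J1.
move=> u0; have := Jeps (u 0 0); rewrite u0 tens0l subr0 => -[v vE].
by exists v; apply/rowP => j; rewrite [j]ord1 vE.
Qed.

Variable tau : {linear E -> E}.
Hypothesis tau_tens : forall a b, tau (tens a b) = tens b a.
Hypothesis tauM : forall u v, tau (u * v) = tau v * tau u.
Hypothesis tauK : forall u, tau (tau u) = u.

(** Over the noncommutative ring [E] transposition alone does not reverse products; composed with
    the antimorphism [tau] it does, and it exchanges exactness on rows with exactness on columns. *)
Definition flipmx r s (M : 'M[E]_(r, s)) : 'M[E]_(s, r) := \matrix_(i, j) tau (M j i).

Lemma flipmxK r s (M : 'M[E]_(r, s)) : flipmx (flipmx M) = M.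
Proof. by apply/matrixP => i j; rewrite !mxE tauK. Qed.

Lemma flipmxM r s t (M : 'M[E]_(r, s)) (M' : 'M[E]_(s, t)) :
  flipmx (M *m M') = flipmx M' *m flipmx M.
Proof.
apply/matrixP => i j; rewrite !mxE linear_sum; apply: eq_bigr => a _.
by rewrite !mxE tauM.
Qed.

Lemma flipmx0 r s : flipmx (0 : 'M_(r, s)) = 0.
Proof. by apply/matrixP => i j; rewrite !mxE linear0. Qed.

Lemma flip_bimx r s (M M' : 'M[B]_(r, s)) : flipmx (bimx M M') = bimx M'^T M^T.
Proof. by apply/matrixP => i j; rewrite !mxE linearD /= !tau_tens addrC. Qed.

Lemma flip_bhess : flipmx bhess = bhess.
Proof. by rewrite flip_bimx trmxK. Qed.

Lemma flip_bcol : flipmx bcol = - brow.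
Proof.
apply/matrixP => i j; rewrite !mxE linearD /= !tau_tens !tensNr tensNl.
by rewrite opprD opprK [LHS]addrC.
Qed.

Lemma flip_brow : flipmx brow = - bcol.
Proof.
apply/matrixP => i j; rewrite !mxE linearD /= !tau_tens !tensNr tensNl.
by rewrite opprD opprK [LHS]addrC.
Qed.

Lemma bcol_coexact (c : 'cV[E]_1) : bcol *m c = 0 -> c = 0.
Proof.
move=> /(congr1 (@flipmx _ _)); rewrite flipmxM flip_bcol flipmx0 mulmxN.
move=> /eqP; rewrite oppr_eq0 => /eqP /brow_exact c0.
by rewrite -[c]flipmxK c0 flipmx0.
Qed.

Lemma bhess_coexact (c : 'cV[E]_N) : bhess *m c = 0 -> exists v, c = bcol *m v.
Proof.
move=> /(congr1 (@flipmx _ _)); rewrite flipmxM flip_bhess flipmx0.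
move=> /bhess_exact[v vE]; exists (- flipmx v).
by rewrite -[c]flipmxK vE flipmxM flip_brow mulmxN mulNmx.
Qed.

Lemma brow_coexact (c : 'cV[E]_N) : brow *m c = 0 -> exists v, c = bhess *m v.
Proof.
move=> /(congr1 (@flipmx _ _)); rewrite flipmxM flip_brow flipmx0 mulmxN.
move=> /eqP; rewrite oppr_eq0 => /eqP /bcol_exact[v vE]; exists (flipmx v).
by rewrite -[c]flipmxK vE flipmxM flip_bhess.
Qed.

Lemma bmx_exact i (u : 'rV[E]_(krank i.+1)) :
  u *m bmx i = 0 <-> exists v, u = v *m bmx i.+1.
Proof.
split.
  case: i u => [|[|[|i]]] u /=; [exact: bcol_exact | exact: bhess_exact | |
    by move=> _; exists 0; exact: rV0_eq].
  by move/brow_exact => ->; exists 0; rewrite mul0mx.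
case=> v ->; rewrite -mulmxA; case: i v {u} => [|[|[|i]]] v /=.
- by rewrite bhess_col mulmx0.
- by rewrite brow_hess mulmx0.
- by rewrite mul0mx mulmx0.
- by rewrite mulmx0 mulmx0.
Qed.

Let P (i : nat) : lmodType E := 'rV[E]_(krank i).

Let d (i : nat) : {linear P i.+1 -> P i} := mulmxr (bmx i).

Lemma eps0_additive : zmod_morphism (fun p : P 0%N => eps (p 0 0)).
Proof. by move=> p q; rewrite !mxE linearB. Qed.

Let eps0 : {additive P 0%N -> B} := HB.pack (fun p : P 0%N => eps (p 0 0))
  (GRing.isZmodMorphism.Build _ _ _ eps0_additive).

Lemma bimodule_resolution : finite_fgp_resolution d eps0.
Proof.
split.
- split=> [i|]; first by exists (krank i), idfun, idfun.
  by exists 4 => -[|[|[|[|i]]]] // _ p; exact: rV0_eq.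
- by move=> a b p; rewrite /= !mxE eps_bimod.
- by move=> b; exists (const_mx (tens b 1)); rewrite /= mxE eps_tens mulr1.
- move=> p; split=> [/eps_exact//|[q ->]]; exact: eps_bcol.
by move=> i p; exact: bmx_exact.
Qed.

Lemma hom_envE i (phi : P i -> env B) : hom_env phi ->
  forall p, phi p = (p *m (\col_j phi (delta_mx 0 j))) 0 0.
Proof.
move=> phi_lin p.
have phi0 : phi 0 = 0.
  by have := phi_lin (-1) 0 0; rewrite scaleN1r oppr0 addr0 mulN1r addNr.
have phiD u v : phi (u + v) = phi u + phi v.
  by rewrite -[u]scale1r phi_lin mul1r scale1r.
have phiZ a u : phi (a *: u) = a * phi u.
  by rewrite -[_ *: _]addr0 phi_lin phi0 addr0.
rewrite {1}[p]row_sum_delta mxE.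
elim/big_ind2: _ => [|u v u' v' <- <-|j _]; rewrite ?phi0 ?phiD //.
by rewrite phiZ mxE.
Qed.

Lemma hom_env_mul i (c : 'cV[E]_(krank i)) :
  hom_env (fun p : P i => (p *m c) 0 0).
Proof. by move=> a p q; rewrite mulmxDl -scalemxAl !mxE. Qed.

Lemma cocycleE i (phi : P i -> env B) : cocycle d phi ->
  bmx i *m (\col_j phi (delta_mx 0 j)) = 0.
Proof.
move=> [phi_lin phi0]; apply/row_matrixP => j; rewrite row0 rowE mulmxA.
apply/rowP => t; rewrite [t]ord1 -hom_envE // mxE; exact: phi0.
Qed.

Lemma bmx_ext_zero i : i <> 3 -> ext_zero d i.
Proof.
move=> i3 phi cphi; have [phi_lin phi0] := cphi; have c0 := cocycleE cphi.
have phiE := hom_envE phi_lin.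
case: i i3 phi cphi phi_lin phi0 c0 phiE => [|[|[|[//|i]]]] _ phi cphi phi_lin phi0 c0 phiE.
- apply/funext => p; rewrite phiE (bcol_coexact c0) mulmx0 mxE; by [].
- have [v vE] := bhess_coexact c0; exists (fun p => (p *m v) 0 0).
    exact: (@hom_env_mul 0).
  by apply/funext => p /=; rewrite phiE vE mulmxA.
- have [v vE] := brow_coexact c0; exists (fun p => (p *m v) 0 0).
    exact: (@hom_env_mul 1).
  by apply/funext => p /=; rewrite phiE vE mulmxA.
exists (fun=> 0) => [a p q|]; first by rewrite mulr0 addr0.
apply/funext => p /=; rewrite (_ : p = 0); last exact: rV0_eq.
by rewrite phiE mul0mx mxE.
Qed.

(** Every morphism from [P 3] is a cocycle, given by its value at [one], and the coboundaries are
    those with value in the right ideal generated by the entries of [brow]. The flip turns this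
    ideal into the left ideal of the entries of [bcol], which is the kernel of [eps]. *)
Lemma bmx_ext_iso : ext_iso d 3.
Proof.
pose one : P 3 := 1%:M.
have oneE (p : P 3) : p = p 0 0 *: one.
  by apply/rowP => j; rewrite [j]ord1 !mxE mulr1.
have cocyc (phi : P 3 -> env B) : hom_env phi -> cocycle d phi.
  by move=> phi_lin; split=> // p; rewrite hom_envE //= mulmx0 mul0mx mxE.
exists (fun phi => eps (tau (phi one))); split.
- by move=> phi psi _ _; rewrite !linearD.
- by move=> a b phi _; rewrite tauM tau_tens eps_bimod.
- move=> b; exists (fun p : P 3 => p 0 0 * tens 1 b).
    by apply: cocyc => a p q; rewrite !mxE mulrDl mulrA.
  by rewrite mxE mul1r tau_tens eps_tens mulr1.
move=> phi [phi_lin phi0]; split=> [e0|[psi psi_lin <-]].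
  have [|v vE] := @eps_exact (const_mx (tau (phi one))); first by rewrite mxE.
  exists (fun p => (p *m (- flipmx v)) 0 0); first exact: (@hom_env_mul 2).
  apply/funext => p /=; rewrite [p in RHS]oneE.
  have phiZ a : phi (a *: one) = a * phi one.
    have phiz : phi 0 = 0.
      by have := phi_lin (-1) 0 0; rewrite scaleN1r oppr0 addr0 mulN1r addNr.
    by rewrite -[_ *: _]addr0 phi_lin phiz addr0.
  rewrite phiZ -[phi one]tauK (_ : tau (phi one) = (v *m bcol) 0 0); last first.
    by rewrite -vE mxE.
  have -> : tau ((v *m bcol) 0 0) = flipmx (v *m bcol) 0 0 by rewrite [RHS]mxE.
  rewrite flipmxM flip_bcol.
  by rewrite -mulmxA mxE big_ord1 mulmxN mulNmx.
rewrite /= hom_envE //; set c := \col_j _.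
have -> : tau ((one *m bmx 2 *m c) 0 0) = - (flipmx c *m bcol) 0 0.
  have -> : tau ((one *m bmx 2 *m c) 0 0) = flipmx (brow *m c) 0 0.
    by rewrite /= mul1mx [RHS]mxE.
  by rewrite flipmxM flip_brow mulmxN mxE.
by rewrite linearN /= eps_bcol oppr0.
Qed.

Lemma bmx_calabi_yau : calabi_yau B 3.
Proof.
exists P, d, eps0; split; [exact: bimodule_resolution | exact: bmx_ext_zero |
  exact: bmx_ext_iso].
Qed.

End KoszulCalabiYau.

(** * Growth and the Gelfand-Kirillov dimension *)

Section LimSup.
Local Open Scope classical_set_scope.
Variable R : realType.
Implicit Types (u : nat -> \bar R) (a c : R).

Lemma limn_esup_ge u a : (forall N, exists2 m, (N <= m)%N & (a%:E <= u m)%E) ->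
  (a%:E <= limn_esup u)%E.
Proof.
move=> ua; rewrite /limn_esup limf_esupE; apply: le_ereal_inf_tmp => _ [V [N _ NV] <-].
have [m Nm um] := ua N; apply: le_trans um _; apply: ereal_sup_ubound.
by exists m => //; exact: NV.
Qed.

Lemma limn_esup_le u c :
  (forall e, 0 < e -> exists N, forall m, (N <= m)%N -> (u m <= (c + e)%:E)%E) ->
  (limn_esup u <= c%:E)%E.
Proof.
move=> uc; apply/lee_addgt0Pr => e e0; have [N Nu] := uc e e0.
rewrite /limn_esup limf_esupE; apply: (@le_trans _ _ (ereal_sup (u @` [set m | (N <= m)%N]))).
  apply: ereal_inf_lbound; exists [set m | (N <= m)%N] => //.
  by exists N.
by apply: ge_ereal_sup => _ [m Nm <-]; rewrite -EFinD; exact: Nu.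
Qed.

Lemma ln_nat_unbounded a : exists N, forall m, (N <= m)%N -> (1 < m)%N /\ a <= ln m%:R :> R.
Proof.
exists (maxn 2 (Num.truncn (expR a)).+1) => m; rewrite geq_max => /andP[m2 ma].
split=> //; rewrite -[a]expRK ler_ln ?posrE ?expR_gt0 ?ltr0n ?(ltnW m2) //.
rewrite (le_trans (ltW (truncnS_gt _))) // ler_nat.
exact: ma.
Qed.

End LimSup.

Section Growth.
Local Open Scope classical_set_scope.
Variables (R : realType) (k : fieldType) (I : finType) (B : algType k) (X : I -> B).
Variables (comp : nat -> {linear B -> B}) (D : nat -> nat).
Hypotheses (gg : graded_gen X comp) (dimD : forall d, has_dim (gdeg comp d) (D d)).

(** The grading is specified through right multiplication, so splitting off a first letter takes an
    induction of its own. *)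
Lemma compSPl d a : exists b : I -> B,
  (forall i, gdeg comp d (b i)) /\ comp d.+1 a = \sum_i X i * b i.
Proof.
have [ind _ _] := gg; elim/ind: a d => [|c a b Ea Eb||a i Ea] d.
- exists (fun=> 0); split=> [i|]; first exact: linear0.
  by rewrite linear0 big1 // => i _; rewrite mulr0.
- have [x [hx Ex]] := Ea d; have [y [hy Ey]] := Eb d.
  exists (fun i => c *: x i + y i); split=> [i|]; first exact: gdeg_sub.
  rewrite linearP Ex Ey scaler_sumr -big_split.
  by apply: eq_bigr => i _; rewrite /= mulrDr scalerAr.
- exists (fun=> 0); split=> [i|]; first exact: linear0.
  by rewrite (comp1 gg) big1 // => i _; rewrite mulr0.
rewrite (compXr gg); case: d => [|d].
  have [c ->] := comp0_scalar gg a.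
  exists (fun j => if j == i then c%:A else 0); split=> [j|].
    case: eqP => _; last exact: linear0.
    by rewrite /gdeg /= linearZ /= (comp1 gg).
  rewrite (bigD1 i) //= eqxx big1 ?addr0 => [|j /negPf ->]; last by rewrite mulr0.
  by rewrite -scalerAl mul1r -scalerAr mulr1.
have [b [hb ->]] := Ea d; exists (fun j => b j * X i); split=> [j|].
  by have := gdegM gg (hb j) (gdegX gg i); rewrite addn1.
by rewrite mulr_suml; apply: eq_bigr => j _; rewrite mulrA.
Qed.

Lemma has_dim_dlt m : has_dim [set b | dlt comp m b] (\sum_(d < m) D d).
Proof.
elim: m => [|m IH].
  rewrite big_ord0 (_ : [set b | _] = [set 0]); first exact: has_dim0.
  by apply/seteqP; split=> [b /(dlt0_eq0 gg)|_ ->] //; exact: dlt0.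
rewrite big_ord_recr /= (_ : [set b | _] = [set v | exists s t,
    [/\ [set b | dlt comp m b] s, gdeg comp m t & v = s + t]]).
  apply: has_dim_add IH (dimD m) _ => b bm hb.
  by rewrite -hb bm.
apply/seteqP; split=> [b bm|_ [b [c [bm hc ->]]]].
  exists (b - comp m b), (comp m b); split; last by rewrite subrK.
    exact: (dlt_sub_comp gg).
  exact: (gdeg_homog gg).
apply: dltD; last exact: (gdeg_dlt gg).
by apply: dlt_leq bm.
Qed.

Lemma kspan_min (T : set B) s : subsp T -> (forall b, b \in s -> T b) ->
  kspan s `<=` T.
Proof.
move=> sT sTs _ [c ->]; apply: subsp_sum => // i; apply: subspZ => //.
by apply: sTs; exact: mem_nth.
Qed.

Lemma kspan_mem s (b : B) : b \in s -> kspan s b.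
Proof.
move=> bs; have bi : (index b s < size s)%N by rewrite index_mem.
exists (fun i => (i == Ordinal bi)%:R); rewrite (bigD1 (Ordinal bi)) //= eqxx.
rewrite scale1r nth_index // big1 ?addr0 // => i /negPf ->.
by rewrite scale0r.
Qed.

Lemma kspan_subsp (s : seq B) : subsp (kspan s).
Proof. by have [d /has_dim_subsp] := has_dim_kspan s. Qed.

Lemma dimk_leq (s : seq B) (T : set B) d : has_dim T d -> kspan s `<=` T ->
  (dimk (kspan s) <= d)%N.
Proof.
move=> Td sT; have [c sc] := has_dim_kspan s.
by rewrite (dimkE sc); exact: (has_dim_leq sc Td).
Qed.

Lemma dimk_geq (s : seq B) (T : set B) d : has_dim T d -> T `<=` kspan s ->
  (d <= dimk (kspan s))%N.
Proof.
move=> Td sT; have [c sc] := has_dim_kspan s.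
by rewrite (dimkE sc); exact: (has_dim_leq Td sc).
Qed.

Lemma products_dlt s K m : (forall b, b \in s -> dlt comp K.+1 b) ->
  forall b, b \in products (1 :: s) m -> dlt comp (K * m).+1 b.
Proof.
move=> sK; have {}sK b : b \in 1 :: s -> dlt comp K.+1 b.
  rewrite inE => /predU1P[->|/sK//]; case=> // d _; exact: (comp1 gg).
elim: m => [|m IH] b.
  by rewrite inE => /eqP ->; rewrite muln0 => -[//|d] _; exact: (comp1 gg).
rewrite [products _ _](_ : _ = [seq a * c | a <- 1 :: s, c <- products (1 :: s) m]) //.
case/allpairsP=> -[a c] /= [/sK aK /IH cm ->].
by rewrite mulnS -addSn; exact: (dltM gg).
Qed.

Lemma dlt_products m :
  [set b | dlt comp m.+1 b] `<=` kspan (products (1 :: [seq X i | i <- enum I]) m).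
Proof.
set s := 1 :: _; have mulV a n b : a \in s -> kspan (products s n) b ->
    kspan (products s n.+1) (a * b).
  move=> as_ [c ->]; rewrite mulr_sumr; apply: subsp_sum => [|i].
    exact: kspan_subsp.
  rewrite -scalerAr; apply: subspZ; first exact: kspan_subsp.
  apply: kspan_mem; apply: (allpairs_f (fun a b : B => a * b)) => //.
  exact: mem_nth.
have homog n d : (d <= n)%N -> gdeg comp d `<=` kspan (products s n).
  elim: n d => [|n IH] d dn b hb.
    move: dn hb; rewrite leqn0 => /eqP ->; rewrite (gdeg0E gg) => -[c _ <-].
    by apply: subspZ; [exact: kspan_subsp | apply: kspan_mem; rewrite inE].
  case: d dn hb => [|d] dn hb.
    by rewrite -[b]mul1r; apply: mulV; [rewrite inE eqxx | exact: (IH 0%N)].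
  have [c [hc bE]] := compSPl d b; rewrite -hb bE.
  apply: subsp_sum => [|i]; first exact: kspan_subsp.
  apply: mulV; last by apply: (IH d).
  by rewrite inE map_f ?orbT // mem_enum.
move=> b /(dlt_sum gg) ->; apply: subsp_sum => [|d]; first exact: kspan_subsp.
by apply: (homog m d) (gdeg_homog gg _ _); rewrite -ltnS.
Qed.

Lemma seq_dlt (s : seq B) : exists K, forall b, b \in s -> dlt comp K.+1 b.
Proof.
elim: s => [|a s [K sK]]; first by exists 0%N.
have [m am] := dlt_exists gg a; exists (maxn m K) => b.
rewrite inE => /predU1P[->|/sK bK]; [apply: dlt_leq am | apply: dlt_leq bK].
  by rewrite leqW // leq_maxl.
by rewrite ltnS leq_maxr.
Qed.

(** Test space: the span of 1 and the generators, whose [m]-th power contains everything of degree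
    at most [m]. For a limit superior, arbitrarily large [m] suffice. *)
Lemma GKdim_lower (a : R) : (forall N, exists m, [/\ (N <= m)%N, (1 < m)%N &
    a * ln m%:R <= ln (\sum_(d < m.+1) D d)%:R]) -> (a%:E <= GKdim R B)%E.
Proof.
move=> aD; pose s := [seq X i | i <- enum I].
apply: (@le_trans _ _ (limn_esup (fun m =>
    (ln (dimk (kspan (products (1 :: s) m)))%:R / ln m%:R)%:E))); last first.
  by apply: ereal_sup_ubound; exists s.
apply: limn_esup_ge => N; have [m [Nm m1 am]] := aD N; exists m => //.
have lnm : 0 < ln m%:R :> R by rewrite ln_gt0 // ltr1n.
rewrite lee_fin ler_pdivlMr //; apply: le_trans am _.
have le := dimk_geq (has_dim_dlt m.+1) (@dlt_products m).
have D0 : (0 < \sum_(d < m.+1) D d)%N.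
  apply: (has_dim_gt0 (has_dim_dlt m.+1) (v := 1)); last exact: oner_neq0.
  by move=> -[//|d] _; exact: (comp1 gg).
by rewrite ler_ln ?posrE ?ltr0n ?(leq_trans D0) // ler_nat.
Qed.

(** A space in degrees at most [K] has its [m]-th power in degrees at most [K m], hence of dimension
    at most [((K + 1) m)^c]; the factor [(K + 1)^c] disappears after division by [ln m]. *)
Lemma GKdim_upper (c : nat) : (forall M, (\sum_(d < M) D d <= M ^ c)%N) ->
  (GKdim R B <= (c%:R : R)%:E)%E.
Proof.
move=> Dc; apply: ge_ereal_sup => _ [s _ <-].
have [K sK] := seq_dlt s; apply: limn_esup_le => e e0.
(* Beyond this threshold [c ln (K + 1) <= e ln m]. *)
have [N lnN] := @ln_nat_unbounded R (c%:R * ln K.+1%:R / e).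
exists N => m /lnN[m1 lnm]; rewrite lee_fin.
have lnm0 : 0 < ln m%:R :> R by rewrite ln_gt0 // ltr1n.
rewrite ler_pdivrMr //.
have le : (dimk (kspan (products (1%R :: s) m)) <= (K.+1 * m) ^ c)%N.
  apply: (@leq_trans ((K * m).+1 ^ c)).
    apply: leq_trans (Dc _); apply: (dimk_leq (has_dim_dlt _)).
    by apply: kspan_min; [exact: has_dim_subsp (has_dim_dlt _) | exact: products_dlt].
  case: (c) => // c'; rewrite leq_exp2r // mulSn -add1n leq_add2r.
  exact: ltnW.
have [->|d0] := posnP (dimk (kspan (products (1 :: s) m))).
  by rewrite ln0 // mulr_ge0 ?addr_ge0 ?ler0n // ltW.
have KS : 0 < K.+1%:R :> R by rewrite ltr0n.
have m0 : 0 < m%:R :> R by rewrite ltr0n ltnW.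
apply: (@le_trans _ _ (ln ((K.+1 * m) ^ c)%:R)).
  by rewrite ler_ln ?posrE ?ltr0n ?ler_nat // expn_gt0 muln_gt0 /= ltnW.
rewrite natrX natrM lnXn ?mulr_gt0 // lnM ?posrE // -[leLHS]mulr_natl mulrDr mulrDl addrC.
by rewrite lerD2l [e * _]mulrC -ler_pdivrMr.
Qed.

End Growth.

(** * Failure of noetherianity, and its transfer along antimorphisms *)

Section NoetherianTransfer.
Local Open Scope classical_set_scope.

(* The left ideals R y x^i form an infinite direct sum. *)
Lemma not_left_noetherian (R : nzRingType) (x y : R) :
  (forall a b : R, a * x + b * y = 0 -> a = 0 /\ b = 0) -> ~ left_noetherian R.
Proof.
move=> indep nR.
pose S m (a : R) := exists c : nat -> R, a = \sum_(i < m) c i * (y * x ^+ i).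
have S_mono m m' a : (m <= m')%N -> S m a -> S m' a.
  move=> mm' [c ->]; exists (fun i => if (i < m)%N then c i else 0).
  rewrite -(big_mkord xpredT (fun i => (if (i < m)%N then c i else 0) * (y * x ^+ i))).
  rewrite (big_cat_nat (leq0n m) mm') /= big_mkord [X in _ + X]big_nat_cond.
  rewrite [X in _ + X]big1 ?addr0 => [|i /andP[/andP[mi _] _]]; last first.
    by rewrite ltnNge mi mul0r.
  by apply: eq_bigr => i _; rewrite ltn_ord.
have S_add m a b : S m a -> S m b -> S m (a + b).
  move=> [c ->] [c' ->]; exists (fun i => c i + c' i).
  by rewrite -big_split; apply: eq_bigr => i _; rewrite mulrDl.
have S_mul m u a : S m a -> S m (u * a).
  move=> [c ->]; exists (fun i => u * c i).
  by rewrite mulr_sumr; apply: eq_bigr => i _; rewrite mulrA.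
have S0 m : S m 0 by exists (fun=> 0); rewrite big1 // => i _; rewrite mul0r.
have S_free m (c : nat -> R) : \sum_(i < m) c i * (y * x ^+ i) = 0 ->
    forall i, (i < m)%N -> c i = 0.
  elim: m c => [//|m IH] c.
  (* The sum is [c_0 y] plus a multiple of [x] on the right; [indep] kills [c_0] and leaves a
     shorter relation of the same shape. *)
  rewrite big_ord_recl expr0 mulr1.
  under eq_bigr => i _ do rewrite /= exprSr !mulrA.
  rewrite -mulr_suml addrC => /indep[+ c0] => c1 [//|i]; rewrite ltnS => im.
  apply: (IH (fun i => c i.+1)) => //; rewrite -[RHS]c1.
  by apply: eq_bigr => j _; rewrite mulrA.
have [|s sE] := nR [set a | exists m, S m a].
  split; first by exists 0%N.
    move=> a b [m Sa] [m' Sb]; exists (maxn m m'); apply: S_add.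
      by apply: S_mono Sa; exact: leq_maxl.
    by apply: S_mono Sb; exact: leq_maxr.
  by move=> u a [m Sa]; exists m; exact: S_mul.
have [m Sm] : exists m, forall i : 'I_(size s), S m s`_i.
  have /choice[m mE] (i : 'I_(size s)) : exists m, S m s`_i.
    apply/(sE s`_i); exists (fun j => (j == i)%:R).
    rewrite (bigD1 i) //= eqxx mul1r big1 ?addr0 // => j /negPf ->.
    by rewrite mul0r.
  by exists (\max_i m i) => i; apply: S_mono (mE i); exact: leq_bigmax.
have [c cE] : S m (y * x ^+ m).
  have /sE[c ->] : exists m', S m' (y * x ^+ m).
    exists m.+1, (fun i => (i == m)%:R); rewrite big_ord_recr /= eqxx mul1r.
    by rewrite big1 ?add0r // => i _; rewrite ltn_eqF ?mul0r.
  by elim/big_ind: _ => // [a b|i _]; [exact: S_add | exact/S_mul/Sm].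
(* If [y x^m] were a combination of the lower [y x^i], this would be a relation with coefficient
   -1. *)
pose c' i := if (i < m)%N then c i else -1.
have c'0 : \sum_(i < m.+1) c' i * (y * x ^+ i) = 0.
  rewrite big_ord_recr /= {2}/c' ltnn mulN1r cE; apply/eqP; rewrite subr_eq0.
  by apply/eqP; apply: eq_bigr => i _; rewrite /c' ltn_ord.
have /eqP := S_free m.+1 c' c'0 m (ltnSn m).
by rewrite /c' ltnn oppr_eq0 oner_eq0.
Qed.

Lemma antimorphism_noetherian (k : fieldType) (R S : algType k) (q : {linear R -> S}) :
  (forall b, exists a, q a = b) -> (forall a b, q (a * b) = q b * q a) ->
  right_noetherian R -> left_noetherian S.
Proof.
move=> q_surj qM nR J [J0 JD JM].
have [|s sE] := nR [set a | J (q a)].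
  split=> [|a b /= Ja Jb|u a /= Ja]; first by rewrite /= linear0.
    by rewrite linearD; exact: JD.
  by rewrite qM; exact: JM.
have Js i : (i < size s)%N -> J (q s`_i).
  move=> il; apply/(sE s`_i); exists (fun j => (j == Ordinal il)%:R).
  rewrite (bigD1 (Ordinal il)) //= eqxx mulr1 big1 ?addr0 // => j /negPf ->.
  by rewrite mulr0.
exists [seq q a | a <- s]; rewrite size_map => b; split=> [|[c ->]]; last first.
  elim/big_ind: _ => // i _; apply: JM; rewrite (nth_map 0) //; exact: Js.
have [a <-] := q_surj b => /(sE a)[c ->]; exists (fun i => q (c i)).
by rewrite linear_sum; apply: eq_bigr => i _; rewrite qM (nth_map 0).
Qed.

End NoetherianTransfer.

(** * Numerical facts on the Hilbert series *)

Section HilbertSeries.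
Local Open Scope classical_set_scope.
Variable n : nat.

Lemma hilbB0 : hilbB n 0 = 1%N. Proof. by rewrite /hilbB big_ord1. Qed.

Lemma hilbBS d : hilbB n d.+1 = (hilbB n d + hilbA n d.+1)%N.
Proof. by rewrite /hilbB big_ord_recr. Qed.

(** The polynomial is [(1 - t) (1 - n t + t^2)]: the second factor encodes the recurrence of
    [hilbA], the first its summation to [hilbB]. The coefficients of degree less than 3 are computed
    separately, the recurrence not being available in full. *)
Lemma hilbB_series : (2 <= n)%N -> forall m, ps_mul (ps_of_poly
  (1 - (n.+1)%:R *: 'X + (n.+1)%:R *: 'X^2 - 'X^3)) (fun d => (hilbB n d)%:Z) m = ps_one m.
Proof.
move=> n2; set p := (1 - _ + _ - _).
have pE i : p`_i = match i with 0 => 1 | 1 => - n.+1%:Z | 2 => n.+1%:Z | 3 => -1 | _ => 0 end.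
  rewrite /p !coefE; case: i => [|[|[|[|i]]]] /=;
    rewrite ?mulr0 ?mulr1 ?addr0 ?subr0 ?add0r ?sub0r ?oppr0 ?natz //.
have hE d : ((hilbB n d.+1)%:Z = (hilbB n d)%:Z + (hilbA n d.+1)%:Z)%R.
  by rewrite hilbBS PoszD.
have aE d : ((hilbA n d.+2)%:Z = n%:Z * (hilbA n d.+1)%:Z - (hilbA n d)%:Z)%R.
  by rewrite -PoszM -hilbA_add // PoszD addrK.
move=> m; rewrite /ps_mul /ps_of_poly /ps_one.
case: m => [|[|[|m]]].
- by rewrite big_ord1 pE hilbB0.
- rewrite !big_ord_recl big_ord0 !pE /= !hE hilbB0 /= -[n.+1]addn1 PoszD.
  ring.
- rewrite !big_ord_recl big_ord0 !pE /= !hE aE hilbB0 /= -[n.+1]addn1 PoszD.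
  ring.
rewrite !big_ord_recl big1 => [|i _]; last by rewrite pE /= mul0r.
rewrite !pE /= !subSS !subn0 /= !hE !aE -[n.+1]addn1 PoszD.
ring.
Qed.

End HilbertSeries.

Section HilbertGrowth.
Local Open Scope classical_set_scope.

Lemma hilbA2 m : hilbA 2 m = m.+1.
Proof.
suff [] : hilbA 2 m = m.+1 /\ hilbA 2 m.+1 = m.+2 by [].
elim: m => [//|m [E1 E2]]; split=> //.
by rewrite hilbA_SS E1 E2 mul2n -addnn addSnnS addKn.
Qed.

(** For [n = 2] the Hilbert function of [B] is that of a polynomial ring in three variables. *)
Lemma sum_hilbB2 M : (6 * \sum_(d < M) hilbB 2 d = M * M.+1 * M.+2)%N.
Proof.
have h2 d : (2 * hilbB 2 d = d.+1 * d.+2)%N.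
  by elim: d => [|d IH]; [rewrite hilbB0 | rewrite hilbBS hilbA2 mulnDr IH; lia].
elim: M => [|M IH]; first by rewrite big_ord0.
by rewrite big_ord_recr /= mulnDr IH; have := h2 M; lia.
Qed.

Lemma sum_hilbB2_leq M : (\sum_(d < M) hilbB 2 d <= M ^ 3)%N.
Proof.
have := sum_hilbB2 M; case: M => [|M]; first by rewrite big_ord0.
by rewrite !expnS expn0; nia.
Qed.

Lemma hilbA_exp n m : (3 <= n)%N -> (2 ^ m <= hilbA n m)%N.
Proof.
move=> n3; elim: m => [//|m IH].
rewrite expnS (leq_trans _ (hilbA_growth (ltnW n3) m)) // leq_mul //.
by rewrite leq_subRL // ltnW // ltnW.
Qed.

Variable R : realType.

Lemma ln_hilb2 (e : R) N : 0 < e -> exists m, [/\ (N <= m)%N, (1 < m)%N &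
  (3 - e) * ln m%:R <= ln (\sum_(d < m.+1) hilbB 2 d)%:R].
Proof.
move=> e0; have [N' N'P] := @ln_nat_unbounded R (ln 6 / e).
(* The sum is at least [m^3 / 6], and from [N'] on [ln 6 <= e ln m]. *)
exists (maxn N N'); have [m1 lnm] := N'P _ (leq_maxr N N').
set m := maxn N N' in m1 lnm *; split=> //; first exact: leq_maxl.
have m0 : 0 < m%:R :> R by rewrite ltr0n ltnW.
have := sum_hilbB2 m.+1; set S := (\sum_(d < m.+1) _)%N => SE.
have S6 : (m ^ 3 <= 6 * S)%N by rewrite SE !expnS expn0; nia.
have S0 : (0 < S)%N by nia.
have : ln (m ^ 3)%:R <= ln (6 * S)%:R :> R.
  by rewrite ler_ln ?posrE ?ltr0n ?ler_nat ?expn_gt0 ?muln_gt0 ?S0 // (ltnW m1).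
rewrite natrX lnXn // natrM lnM ?posrE ?ltr0n // => le.
rewrite ler_pdivrMr // in lnm.
rewrite mulrBl; move: le lnm; rewrite -[_ *+ 3]mulr_natl [_ * e]mulrC.
set a := ln m%:R; set b := ln S%:R; set c := ln 6; lra.
Qed.

(** Along [m = 2^j] the sum is at least [2^m], with logarithm [2^j ln 2 >= j^2 ln 2], while
    [a ln m = a j ln 2]. Thus [j >= a] suffices; [j >= 4] ensures [j^2 <= 2^j]. *)
Lemma ln_hilb3 n (a : R) N : (3 <= n)%N -> exists m, [/\ (N <= m)%N, (1 < m)%N &
  a * ln m%:R <= ln (\sum_(d < m.+1) hilbB n d)%:R].
Proof.
move=> n3; pose j := maxn 4 (maxn N (Num.truncn a).+1).
have j4 : (4 <= j)%N by exact: leq_maxl.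
have jN : (N <= j)%N by rewrite !leq_max leqnn orbT.
have ja : a <= j%:R.
  by rewrite (le_trans (ltW (truncnS_gt a))) // ler_nat !leq_max leqnn !orbT.
have jj : (j * j <= 2 ^ j)%N.
  rewrite -(subnK j4); elim: (j - 4)%N => [//|i IH].
  by rewrite addSn expnS; nia.
exists (2 ^ j)%N; split.
- by rewrite (leq_trans jN) // ltnW // ltn_expl.
- by rewrite -{1}(expn0 2) ltn_exp2l // (leq_trans _ j4).
have ln2 : 0 <= ln 2 :> R by rewrite ln_ge0 // ler1n.
apply: (@le_trans _ _ ((2 ^ j)%:R * ln 2)).
  rewrite natrX lnXn // -[ln 2 *+ j]mulr_natl mulrA ler_wpM2r // -natrX.
  apply: (@le_trans _ _ (j%:R * j%:R)); first by rewrite ler_wpM2r.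
  by rewrite -natrM ler_nat.
rewrite mulr_natl -lnXn // -natrX ler_ln ?posrE ?ltr0n ?expn_gt0 //.
  rewrite ler_nat big_ord_recr /= (leq_trans _ (leq_addl _ _)) //.
  rewrite /hilbB big_ord_recr /= (leq_trans _ (leq_addl _ _)) //.
  exact: hilbA_exp.
rewrite big_ord_recr /= addn_gt0 /hilbB big_ord_recr /= addn_gt0.
by rewrite (leq_trans _ (hilbA_exp _ n3)) ?expn_gt0 ?orbT.
Qed.

End HilbertGrowth.

(** * Assembly for presented algebras *)

Section RelationTensor.
Local Open Scope classical_set_scope.
Variables (k : fieldType) (n : nat) (f : 'M[k]_n).

(** Stated for arbitrary [y], so as to apply in the free algebra, in [B], and in the target of the
    antimorphism. *)
Lemma wt_relation (R : algType k) (y : option 'I_n -> R) (a : option 'I_n) :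
  \sum_b (\sum_c wt f a c b *: y c) * y b =
  if a is Some i then
    \sum_j (f i j *: (y (Some j) * y None) + f j i *: (y None * y (Some j)))
  else qform f (fun i => y (Some i)).
Proof.
rewrite big_option; case: a => [i|].
  have E j : \sum_c wt f (Some i) c (Some j) *: y c = f j i *: y None.
    by rewrite big_option big1 ?addr0 // => l _; exact: scale0r.
  under [X in _ + X]eq_bigr => j _ do rewrite E.
  rewrite big_option scale0r add0r mulr_suml -big_split.
  by apply: eq_bigr => j _ /=; rewrite -!scalerAl.
rewrite [X in X * _]big1 ?mul0r ?add0r => [|[c|] _]; try exact: scale0r.
rewrite /qform [RHS]exchange_big; apply: eq_bigr => j _ /=.
rewrite big_option scale0r add0r mulr_suml.
by apply: eq_bigr => i _; rewrite -scalerAl.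
Qed.

End RelationTensor.

Section Main.
Local Open Scope classical_set_scope.
Variables (k : fieldType) (n : nat) (f : 'M[k]_n) (A B : algType k).
Variable pA : {lrmorphism freealg k (xvar n) -> A}.
Variable pB : {lrmorphism freealg k (xzvar n) -> B}.
Hypotheses (n_ge2 : (2 <= n)%N) (f_unit : f \in unitmx).
Hypotheses (presA : presents [set quad_rel f] pA)
  (presB : presents (jacobi_rel (potential f)) pB).

Let x (i : 'I_n) : A := pA (@fgen k (xvar n) i).
Let X (i : 'I_n) : B := pB (@fgen k (xzvar n) (Some i)).
Let z : B := pB (@fgen k (xzvar n) None).

Lemma quad_rel_rows : quad_rel f =
  \sum_i (\sum_j f j i *: @fgen k (xvar n) j) * @fgen k (xvar n) i.
Proof.
rewrite /quad_rel /qform exchange_big; apply: eq_bigr => i _ /=.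
by rewrite mulr_suml; apply: eq_bigr => j _; rewrite -scalerAl.
Qed.

Lemma jacobi_rows (s : option 'I_n) : @cder k (xzvar n) s (potential f) =
  \sum_t (\sum_c wt f s c t *: @fgen k (xzvar n) c) * @fgen k (xzvar n) t.
Proof.
rewrite [RHS](wt_relation f (@fgen k (xzvar n))).
by case: s => [i|]; rewrite ?cder_potential_x ?cder_potential_z.
Qed.

Lemma lrowE i : lrow f x i = \sum_j f j i *: x j.
Proof. by apply: eq_bigr => j _; rewrite !mxE. Qed.

Lemma quad_lrow_x : \sum_i lrow f x i * x i = 0.
Proof.
rewrite -[RHS](quad_rel0 presA) /qform exchange_big; apply: eq_bigr => i _ /=.
by rewrite lrowE mulr_suml; apply: eq_bigr => j _; rewrite -scalerAl.
Qed.

Lemma quad_syz (a : 'I_n -> A) : \sum_i a i * x i = 0 ->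
  exists u, forall i, a i = u * lrow f x i.
Proof.
pose rd (_ : unit) (i : 'I_n) := \sum_j f j i *: @fgen k (xvar n) j.
move=> a0; have [|u uE] := @presented_syzygy k 'I_n _ A pA presA _ rd _ a a0.
  move=> r; split=> [->|[s ->]]; last exact/esym/quad_rel_rows.
  by exists tt; exact: quad_rel_rows.
exists (u tt) => i; rewrite uE (bigD1 tt) //= big1 ?addr0 => [|[]//].
congr (_ * _); rewrite lrowE /rd linear_sum; apply: eq_bigr => j _.
by rewrite linearZ.
Qed.

Lemma pB_xz : xz X z = (fun s => pB (@fgen k (xzvar n) s)).
Proof. by apply/funext => -[]. Qed.

Lemma pot_hess_xz a : \sum_b hess f X z a b * xz X z b = 0.
Proof.
rewrite [LHS](wt_relation f (xz X z)); case: a => [i|] /=.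
  exact: (pot_relx presB).
exact: (pot_relz presB).
Qed.

Lemma pot_syz (a : option 'I_n -> B) : \sum_s a s * xz X z s = 0 ->
  exists u : option 'I_n -> B, forall t, a t = \sum_s u s * hess f X z s t.
Proof.
pose rd (s t : option 'I_n) := \sum_c wt f s c t *: @fgen k (xzvar n) c.
rewrite pB_xz => a0.
have [|u uE] := @presented_syzygy k (option 'I_n) _ B pB presB _ rd _ a a0.
  move=> r; split=> [[s _ <-]|[s ->]]; first by exists s; exact: jacobi_rows.
  by exists s; rewrite // jacobi_rows.
exists u => t; rewrite uE; apply: eq_bigr => s _; congr (_ * _).
rewrite /rd /hess pB_xz linear_sum; apply: eq_bigr => c _.
by rewrite linearZ.
Qed.

Lemma homogeneous_gen2 (I : finType) c (i j : I) :
  homogeneous 2 (c *: (fgen i * fgen j) : freealg k I).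
Proof.
rewrite -[_ *: _]addr0; apply: homogeneous_lin; last exact: homogeneous0.
by rewrite fwordM; exact: homogeneous_word.
Qed.

Lemma quad_homogeneous r : [set quad_rel f] r -> exists e, homogeneous e r.
Proof.
move=> ->; exists 2; apply: (@homogeneous_sum k 'I_n) => i.
apply: (@homogeneous_sum k 'I_n) => j; exact: (@homogeneous_gen2 'I_n).
Qed.

Lemma pot_homogeneous r : jacobi_rel (potential f) r -> exists e, homogeneous e r.
Proof.
move=> [s _ <-]; exists 2; rewrite jacobi_rows.
apply: (@homogeneous_sum k (option 'I_n)) => t.
rewrite mulr_suml; apply: (@homogeneous_sum k (option 'I_n)) => c.
rewrite -scalerAl; exact: (@homogeneous_gen2 (option 'I_n)).
Qed.

(** The Koszul complexes are made of matrices, whose indices are ordinals, whereas the generators of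
    [B] are indexed by [option 'I_n]. *)
Lemma graded_gen_reindex (T : finType) (y : T -> B) comp : graded_gen y comp ->
  graded_gen (fun i : 'I_#|T| => y (enum_val i)) comp.
Proof.
move=> [ind h1 hr]; split=> [P P0 PD P1 PX||i a]; [|exact: h1|exact: hr].
by apply: ind => // a s Pa; rewrite -[s]enum_rankK; exact: PX.
Qed.

Lemma big_enum_rank (V : nmodType) (T : finType) (F : T -> V) :
  \sum_s F s = \sum_(i < #|T|) F (enum_val i).
Proof.
rewrite (reindex (@enum_val T T)) //.
exists enum_rank => i _; [exact: enum_valK | exact: enum_rankK].
Qed.

Let deg (d : nat) : set B := pB @` homogeneous d.

(** For each [n] only one side of the noetherian question is settled here; the other side is
    obtained from the algebra of [f^T]. *)
Lemma potential_algebra_main (R : realType) :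
  (exists (sigma : {lrmorphism A -> A}) (iota : {lrmorphism A -> B}),
      (forall i, iota (x i) = X i) /\ skew_polynomial iota sigma z) /\
  normal z /\
  ((alternating f -> central z) /\
   (2%N \notin [pchar k] -> central z -> alternating f)) /\
  (koszul deg /\ calabi_yau B 3 /\ is_domain B) /\
  is_hilbert_series deg (fun d => (hilbB n d)%:Z) /\
  ((n = 2%N -> GKdim R B = 3%:E) /\ ((2 < n)%N -> GKdim R B = +oo%E)) /\
  ((n = 2%N -> right_noetherian B) /\ ((2 < n)%N -> ~ left_noetherian B)).
Proof.
have [compA [ggA _]] := @presented_graded_gen k 'I_n _ A pA presA quad_homogeneous.
have [compB [ggB degB]] :=
  @presented_graded_gen k (option 'I_n) _ B pB presB pot_homogeneous.
have {degB} degE : deg = gdeg compB by apply/funext => d; rewrite degB.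
rewrite -pB_xz in ggB.
have lrow_x := quad_lrow_x; have syzA := quad_syz.
have [sigma sbij sE] := twist_auto f_unit presA.
have [io ioE] := quad_to_pot presA presB.
have [coef sc] := pot_skew f_unit presA presB sbij sE ioE.
have zX := zX_twist f_unit presB.
have zc := z_central n_ge2 f_unit ggA syzA ggB sc ioE zX.
have dimB := has_dim_gdegB n_ge2 f_unit ggA lrow_x syzA ggB sc ioE.
have domA := quad_domain n_ge2 f_unit ggA lrow_x syzA.
have domB := skew_domain sc domA.
split; first by exists sigma, io; split=> //; exact: skew_poly sc.
split; first exact: z_normal sc.
split.
  split=> [alt|c2 cz]; first exact/zc/alternating_antisym.
  by apply: antisym_alternating => //; exact/zc.
have gg' := graded_gen_reindex ggB.
pose T := option 'I_n; pose ev (i : 'I_#|{: T}|) : T := enum_val i.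
pose w' i j l := wt f (ev i) (ev j) (ev l); pose m' i j := hess f X z (ev i) (ev j).
have w'_cyc a b c : w' a b c = w' b c a by exact: wt_cyc.
have m'E a b : m' a b = \sum_c w' a c b *: xz X z (ev c).
  exact: (big_enum_rank (fun c => wt f (ev a) c (ev b) *: xz X z c)).
have m'X a : \sum_b m' a b * xz X z (ev b) = 0.
  rewrite -[RHS](pot_hess_xz (ev a)); exact/esym/(big_enum_rank _).
have Xm' b : \sum_a xz X z (ev a) * m' a b = 0.
  rewrite -[RHS](xz_hess pot_hess_xz (ev b)); exact/esym/(big_enum_rank _).
have ex0 (a : 'I_#|{: T}| -> B) : \sum_s a s * xz X z (ev s) = 0 ->
    exists u : 'I_#|{: T}| -> B, forall t, a t = \sum_s u s * m' s t.
  move=> a0; have [|u uE] := pot_syz (a := fun s => a (enum_rank s)).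
    rewrite big_enum_rank -[RHS]a0; apply: eq_bigr => i _.
    by rewrite enum_valK.
  exists (fun i => u (ev i)) => t; rewrite -[t in LHS]enum_valK uE.
  exact: big_enum_rank.
have ex1 (u : 'I_#|{: T}| -> B) : (forall t, \sum_s u s * m' s t = 0) ->
    exists v, forall s, u s = v * xz X z (ev s).
  move=> u0; have [|v vE] := koszul_middle n_ge2 f_unit ggA syzA sc ioE pot_hess_xz
    (u := fun s => u (enum_rank s)).
    move=> t; rewrite big_enum_rank -[RHS](u0 (enum_rank t)); apply: eq_bigr => i _.
    by rewrite enum_valK /m' /ev enum_rankK.
  by exists v => s; rewrite -[s in LHS]enum_valK vE.
have ex2 v : (forall s, v * xz X z (ev s) = 0) -> v = 0.
  move=> v0; apply: (koszul_inj (X := X) sc) => s.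
  by rewrite -[s]enum_rankK; exact: v0.
have fin_dim d : exists D, has_dim (gdeg compB d) D by exists (hilbB n d).
have [el elP] := choice (fun d => graded_basis ggB (dimB d)).
have [S SE] := choice (fun di : nat * nat => env_slice ((el di.1).2 di.2)).
have [eps [eps_tens eps_bimod]] := env_mult B.
have [tau [tau_tens tauM tauK]] := env_flip B.
split.
  rewrite degE; split; first exact: (koszul_gdeg gg' m'E m'X Xm' ex0 ex1 ex2 fin_dim).
  split; last by split; [exact: oner_neq0 | exact: domB].
  apply: (bmx_calabi_yau gg' w'_cyc m'E m'X Xm' ex0 ex1 ex2
    (D := hilbB n) (e := fun d => (el d).1) (l := fun d => (el d).2)
    (S := fun d i => S (d, i)) _ _ _ _ _ eps_tens eps_bimod tau_tens tauM tauK).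
  - by move=> d i iD; have [+ _ _ _] := elP d; apply.
  - by move=> d b; have [_ + _ _] := elP d; apply.
  - by move=> d i b; have [_ _ + _] := elP d; apply.
  - by move=> d i j iD jD; have [_ _ _ +] := elP d; apply.
  - by move=> d i a b; exact: (SE (d, i)).
split; first by move=> d; exists (hilbB n d); rewrite degE.
split.
  split=> [n2|n3].
    apply/le_anti/andP; split.
      by apply: (GKdim_upper R ggB dimB (c := 3)) => M; rewrite n2 sum_hilbB2_leq.
    apply/lee_subgt0Pr => e e0; rewrite -EFinB.
    by apply: (GKdim_lower ggB dimB) => N; rewrite n2; exact: ln_hilb2.
  by apply: eq_infty => a; apply: (GKdim_lower ggB dimB) => N; exact: ln_hilb3.
split=> [n2|n3].
  apply: (skew_right_noetherian sc).
  exact: (quad_right_noetherian n_ge2 f_unit ggA lrow_x syzA).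
pose i0 : 'I_n := Ordinal (ltnW (ltnW n3)).
pose i1 : 'I_n := Ordinal (ltnW n3).
pose i2 : 'I_n := Ordinal n3.
apply: (@not_left_noetherian _ (X i0) (X i1)) => a b ab0.
have [sigma' sigmaK sigma'K] := sbij.
have iter_surj p c : exists c', iter p sigma c' = c.
  elim: p c => [|p IH] c; first by exists c.
  by have [c' cE] := IH (sigma' c); exists c'; rewrite /= cE sigma'K.
(* The coefficient of [z^p] in [a X_0 + b X_1] involves [sigma^p x_0] and [sigma^p x_1]. Writing the
   coefficients of [a] and [b] as images under [sigma^p] brings the equation back to [A]. *)
have ab p : coef p a = 0 /\ coef p b = 0.
  have [a' a'E] := iter_surj p (coef p a); have [b' b'E] := iter_surj p (coef p b).
  have : iter p sigma (a' * x i0 + b' * x i1) = 0.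
    have iterD u v : iter p sigma (u + v) = iter p sigma u + iter p sigma v.
      by elim: (p) => //= q ->; rewrite linearD.
    have iterM u v : iter p sigma (u * v) = iter p sigma u * iter p sigma v.
      by elim: (p) => //= q ->; rewrite rmorphM.
    rewrite iterD !iterM a'E b'E -!(coef_iotar sc) !ioE -linearD ab0.
    exact: linear0.
  move=> /(iter_sigma0 sc)/(x0x1_independent n_ge2 f_unit ggA syzA).
  move=> /(_ i2 isT isT isT)[a'0 b'0].
  have iter0 : iter p sigma 0 = 0 by elim: (p) => //= q ->; rewrite linear0.
  by rewrite -a'E -b'E a'0 b'0 iter0.
by split; apply: (coef_eq0 sc) => p; case: (ab p).
Qed.

End Main.

(** Reversal of words sends the relations of [f] to those of [f^T], because
    [wt f s c t = wt f^T s t c]. The equation [g = f^T] is a hypothesis so that the lemma can be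
    used from [f] to [f^T] and back. *)
Lemma pot_antimorphism (k : fieldType) (n : nat) (f g : 'M[k]_n) (B C : algType k)
    (pB : {lrmorphism freealg k (xzvar n) -> B})
    (pC : {lrmorphism freealg k (xzvar n) -> C}) :
  presents (jacobi_rel (potential f)) pB -> presents (jacobi_rel (potential g)) pC ->
  g = f^T -> right_noetherian B -> left_noetherian C.
Proof.
move=> presB presC gE.
pose y (s : option 'I_n) : C := pC (@fgen k (xzvar n) s).
have [|q [q1 qM qE]] := @presents_antimorphism k (xzvar n) C y _ B pB presB.
  move=> _ [s _ <-]; rewrite jacobi_rows.
  have -> : feval_rev y (\sum_t (\sum_c wt f s c t *: @fgen k (xzvar n) c) *
      @fgen k (xzvar n) t) = \sum_t (\sum_c wt g s c t *: y c) * y t.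
    rewrite linear_sum /=.
    under eq_bigr => t _ do rewrite feval_revM feval_rev_gen linear_sum mulr_sumr.
    rewrite exchange_big; apply: eq_bigr => c _ /=; rewrite mulr_suml.
    apply: eq_bigr => t _; rewrite linearZ /= feval_rev_gen -scalerAr -scalerAl.
    congr (_ *: _); rewrite gE.
    by case: s t c => [?|] [?|] [?|] //=; rewrite mxE.
  rewrite wt_relation; case: s => [i|]; first exact: (pot_relx presC).
  exact: (pot_relz presC).
apply: (antimorphism_noetherian (q := q) _ qM) => b.
elim/(pot_ind presC): b => [|c b b' [a <-] [a' <-]||b i [a <-]|b [a <-]].
- by exists 0; rewrite linear0.
- by exists (c *: a + a'); rewrite linearP.
- by exists 1.
- by exists (pB (@fgen k (xzvar n) (Some i)) * a); rewrite qM qE.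
- by exists (pB (@fgen k (xzvar n) None) * a); rewrite qM qE.
Qed.

Section QuotientPresentations.
Variables (k : fieldType) (n : nat) (f : 'M[k]_n).

Let quad_pi : freealg k (xvar n) -> quad_alg f := qpi [set quad_rel f].
Let pot_pi : freealg k (xzvar n) -> pot_alg f := qpi (jacobi_rel (potential f)).

Lemma quad_presented : exists2 p : {lrmorphism freealg k (xvar n) -> quad_alg f},
  p = quad_pi :> (_ -> _) & presents [set quad_rel f] p.
Proof.
have p_lin : linear quad_pi.
  by move=> c a b; rewrite [LHS]raddfD; congr (_ + _); exact: qpiZ.
have p_mon : monoid_morphism quad_pi by split=> [|a b]; [exact: qpi1 | exact: qpiM].
pose p : {lrmorphism freealg k (xvar n) -> quad_alg f} := HB.pack quad_pi
  (GRing.isLinear.Build _ _ _ _ _ p_lin) (GRing.isMonoidMorphism.Build _ _ _ p_mon).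
by exists p => //; exact: qalg_presents.
Qed.

Lemma pot_presented : exists2 p : {lrmorphism freealg k (xzvar n) -> pot_alg f},
  p = pot_pi :> (_ -> _) & presents (jacobi_rel (potential f)) p.
Proof.
have p_lin : linear pot_pi.
  by move=> c a b; rewrite [LHS]raddfD; congr (_ + _); exact: qpiZ.
have p_mon : monoid_morphism pot_pi by split=> [|a b]; [exact: qpi1 | exact: qpiM].
pose p : {lrmorphism freealg k (xzvar n) -> pot_alg f} := HB.pack pot_pi
  (GRing.isLinear.Build _ _ _ _ _ p_lin) (GRing.isMonoidMorphism.Build _ _ _ p_mon).
by exists p => //; exact: qalg_presents.
Qed.

End QuotientPresentations.

Theorem theorem1p2 (R : realType) (k : fieldType) (n : nat) (f : 'M[k]_n)
    (n_ge2 : (2 <= n)%N) (f_nondeg : f \in unitmx) :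
  let A := quad_alg f : algType k in
  let B := pot_alg f : algType k in
  let z : B := pot_z f in
  let deg : nat -> set B := pot_deg f in
  (exists (sigma : {lrmorphism A -> A}) (iota : {lrmorphism A -> B}),
      (forall i, iota (quad_x f i) = pot_x f i) /\
      skew_polynomial iota sigma z) /\
  normal z /\
  ((alternating f -> central z) /\
   (2%N \notin [pchar k] -> central z -> alternating f)) /\
  (koszul deg /\ calabi_yau B 3 /\ is_domain B) /\
  (exists2 h, is_hilbert_series deg h &
     forall m, ps_mul (ps_of_poly
       (1 - (n.+1)%:R *: 'X + (n.+1)%:R *: 'X^2 - 'X^3)) h m = ps_one m) /\
  ((GKdim R B \is a fin_num <-> n = 2%N) /\ (n = 2%N -> GKdim R B = 3%:E)) /\
  ((left_noetherian B <-> n = 2%N) /\ (right_noetherian B <-> n = 2%N)).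
Proof.
move=> A B z deg.
have [pA pAE presA] := quad_presented f; have [pB pBE presB] := pot_presented f.
have [skew [norm [cent [alg [hilb [[GK2 GK3] [noeth2 noeth3]]]]]]] :=
  potential_algebra_main n_ge2 f_nondeg presA presB R.
have fT_unit : f^T \in unitmx by rewrite unitmx_tr.
have [qA qAE presAT] := quad_presented f^T; have [qB qBE presBT] := pot_presented f^T.
have [_ [_ [_ [_ [_ [_ [Tnoeth2 Tnoeth3]]]]]]] :=
  potential_algebra_main n_ge2 fT_unit presAT presBT R.
have n3 : n <> 2%N -> (2 < n)%N.
  by move=> ne; rewrite ltn_neqAle n_ge2 andbT eq_sym; apply/eqP.
rewrite {}pAE {}pBE in skew norm cent alg hilb.
split; first exact: skew.
split; first exact: norm.
split; first exact: cent.
split; first exact: alg.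
split; first by exists (fun d => (hilbB n d)%:Z); [exact: hilb | exact: hilbB_series].
split.
  split=> //; split=> [fin|/GK2 -> //].
  by apply: contrapT => /n3/GK3 E; rewrite E in fin.
split; split=> [nB|n2].
- by apply: contrapT => /n3/noeth3; apply.
- apply: (pot_antimorphism presBT presB); first by rewrite trmxK.
  exact: Tnoeth2.
- apply: contrapT => /n3/Tnoeth3; apply.
  exact: (pot_antimorphism presB presBT).
exact: noeth2.
Qed.
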